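(* Let $X$ be a real or complex Banach space with local unconditional structure. Suppose that $X$ has a uniform UFDD $(E_n)$. Then there is an unconditional basis $(f_{nj})_{j=1}^{\dim E_n}$ of each $E_n$ so that $(f_{nj})_{n,j}$ is an unconditional basis for $X$.
   Context: A UFDD (unconditional finite-dimensional Schauder decomposition) of a Banach space $X$ is a sequence $(E_n)$ of finite-dimensional subspaces of $X$ such that every $x\in X$ has a unique expansion $x=\sum_n x_n$ with $x_n\in E_n$, and this series converges unconditionally. It is uniform if $\sup_n\dim E_n<\infty$. A Banach space $X$ has (Gordon–Lewis) local unconditional structure if there is a constant $C$ so that whenever $E$ is a finite-dimensional subspace of $X$ there are a finite-dimensional Banach lattice $Y$ and operators $A:E\to Y$, $B:Y\to X$ with $\|A\|\|B\|\le C$ and $BA=I_E$ (i.e. $BAx=x$ for all $x\in E$). *)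

(* Defs.v *)
From mathcomp Require Import all_boot all_order all_algebra.
From mathcomp Require Import complex.
From mathcomp Require Import all_classical all_reals all_analysis.

Set Implicit Arguments.
Unset Strict Implicit.
Unset Printing Implicit Defensive.

Import Order.TTheory GRing.Theory Num.Theory.
Import numFieldNormedType.Exports.

Local Open Scope classical_set_scope.
Local Open Scope ring_scope.
Local Open Scope complex_scope.

Section subspaces.
Context {K : numFieldType} {X : normedModType K}.

Definition has_dim (E : set X) (d : nat) : Prop :=
  exists e : 'I_d -> X,
    (forall a : 'I_d -> K, \sum_(i < d) a i *: e i = 0 -> forall i, a i = 0) /\
    E = [set \sum_(i < d) a i *: e i | a in [set: 'I_d -> K]].

Definition fin_dim (E : set X) : Prop := exists d, has_dim E d.

(* Junk value 0 when E is not a finite-dimensional subspace. *)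
Definition fdim (E : set X) : nat := xget 0%N [set d | has_dim E d].

End subspaces.

Section unconditional.
Context {K : numFieldType} {X : normedModType K}.

(* Listing of a countable set; the blanks None allow the set to be finite. *)
Definition enumeration (I : countType) (s : nat -> option I) : Prop :=
  forall i, exists! k, s k = Some i.

Definition sum_along (I : countType) (s : nat -> option I) (u : I -> X) (x : X)
    : Prop :=
  series (fun k => oapp u 0 (s k)) @ \oo --> x.

(* Convergence to x under every rearrangement. *)
Definition unconditional_sum (I : countType) (u : I -> X) (x : X) : Prop :=
  forall s, enumeration s -> sum_along s u x.

Definition unconditional_basis (E : set X) (I : countType) (e : I -> X)
    : Prop :=
  (forall i, E (e i)) /\
  forall x, E x -> exists a : I -> K,
    unconditional_sum (fun i => a i *: e i) x /\
    forall (s : nat -> option I) (b : I -> K), enumeration s ->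
      sum_along s (fun i => b i *: e i) x -> b = a.

Definition ufdd (E : nat -> set X) : Prop :=
  (forall n, fin_dim (E n)) /\
  forall x, exists u : nat -> X,
    [/\ forall n, E n (u n),
        series u @ \oo --> x,
        forall v : nat -> X, (forall n, E n (v n)) ->
          series v @ \oo --> x -> v = u
      & unconditional_sum u x].

Definition uniform_ufdd (E : nat -> set X) : Prop :=
  ufdd E /\ exists N : nat, forall n, (fdim (E n) <= N)%N.

End unconditional.

Section banach_lattices.
Context {R : realType}.

Definition is_lub (Y : Type) (le : Y -> Y -> Prop) (A : set Y) (m : Y) : Prop :=
  (forall x, A x -> le x m) /\
  forall u, (forall x, A x -> le x u) -> le m u.

(* Binary infima need not be required: they come from suprema by negation. *)
Record is_banach_lattice (Y : completeNormedModType R) (le : Y -> Y -> Prop)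
    : Prop := {
  blat_refl : forall x, le x x;
  blat_anti : forall x y, le x y -> le y x -> x = y;
  blat_trans : forall x y z, le x y -> le y z -> le x z;
  blat_add : forall x y z, le x y -> le (x + z) (y + z);
  blat_scale : forall (a : R) x y, 0 <= a -> le x y -> le (a *: x) (a *: y);
  blat_join : forall x y, exists m, is_lub le [set x; y] m;
  blat_norm : forall x y mx my,
    is_lub le [set x; - x] mx -> is_lub le [set y; - y] my ->
    le mx my -> `|x| <= `|y|
}.

(* Z is the complexification Y + iY of the real Banach lattice (Y, le), with
   j the inclusion of Y, normed by `|x + iy| = `| |x + iy| | for the modulus
   |x + iy| = sup_t (cos t x + sin t y). *)
Definition is_complexification (Y : completeNormedModType R)
    (le : Y -> Y -> Prop) (Z : completeNormedModType R[i]) (j : Y -> Z)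
    : Prop :=
  [/\ forall (a : R) x y, j (a *: x + y) = a%:C *: j x + j y,
      forall z, exists! p : Y * Y, z = j p.1 + 'i *: j p.2
    & forall x y, exists m,
        is_lub le [set cos t *: x + sin t *: y | t in [set: R]] m /\
        `|j x + 'i *: j y| = `|m|%:C].

Definition real_banach_lattice (Y : completeNormedModType R) : Prop :=
  exists le : Y -> Y -> Prop, is_banach_lattice le.

Definition complex_banach_lattice (Z : completeNormedModType R[i]) : Prop :=
  exists (Y : completeNormedModType R) (le : Y -> Y -> Prop) (j : Y -> Z),
    is_banach_lattice le /\ is_complexification le j.

End banach_lattices.

Section local_unconditional_structure.
Context {K : numFieldType}.

(* c is the operator norm of the restriction of f to D. *)
Definition is_opnorm (X Y : normedModType K) (D : set X) (f : X -> Y) (c : K)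
    : Prop :=
  [/\ 0 <= c,
      forall x, D x -> `|f x| <= c * `|x|
    & forall b, 0 <= b -> (forall x, D x -> `|f x| <= b * `|x|) -> c <= b].

(* An operator A : E -> Y is a function on X of which only the restriction to E
   matters. *)
Definition has_lust_wrt (lat : completeNormedModType K -> Prop)
    (X : completeNormedModType K) : Prop :=
  exists C : K, forall E : set X, fin_dim E ->
    exists (Y : completeNormedModType K) (A : X -> Y) (B : {linear Y -> X})
           (a b : K),
      [/\ lat Y /\ fin_dim [set: Y],
          forall (k : K) x y, E x -> E y -> A (k *: x + y) = k *: A x + A y,
          is_opnorm E A a /\ is_opnorm [set: Y] B b,
          a * b <= C
        & forall x, E x -> B (A x) = x].

End local_unconditional_structure.

Definition has_real_lust (R : realType) (X : completeNormedModType R) : Prop :=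
  has_lust_wrt (@real_banach_lattice R) X.

Definition has_complex_lust (R : realType) (X : completeNormedModType R[i])
    : Prop :=
  has_lust_wrt (@complex_banach_lattice R) X.

(* Main.v *)
Require Import Defs.
From mathcomp Require Import all_boot all_order all_algebra.
From mathcomp Require Import complex.
From mathcomp Require Import all_classical all_reals all_analysis.
From mathcomp Require Import ring lra zify.
Import Order.TTheory GRing.Theory Num.Theory.
Import numFieldNormedType.Exports.
Local Open Scope classical_set_scope.
Local Open Scope ring_scope.
Local Open Scope complex_scope.
Set Implicit Arguments.
Unset Strict Implicit.
Unset Printing Implicit Defensive.

(** Let x_n denote the component of x in E_n.

    A factorization of the identity of F = E_0 + ... + E_(m-1) through a
    finite-dimensional lattice is, in the coordinates of the lattice
    ([finite_lattice_coordinates], [coordinate_lust]), a formula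
    x = sum_i alpha_i(x) beta_i for x in F.  Cutting it into blocks gives, for
    each n < m, matrices M_(n,i) = (beta_i)_n alpha_i of rank at most one with
    sum_i M_(n,i) = 1 on E_n.  The decisive estimate is [lust_multipliers]: for
    all scalars |theta_(n,i)| <= 1 the block-diagonal operator with blocks
    sum_i theta_(n,i) M_(n,i) is bounded on F by a constant independent of m
    and theta.  Indeed, if T_e denotes the change of signs x_n |-> e_n x_n, this
    operator maps x to the mean over the signs e of T_e (sum_i h_i(e) beta_i) as
    soon as h_i is a function of the signs whose n-th Rademacher coefficient is
    theta_(n,i) alpha_i(x_n).  Riesz products ([riesz_product]) provide such an
    h_i with |h_i| at most c times the l2 norm of the numbers alpha_i(x_n), and
    by the Khintchine inequality this is at most c' times the mean over e of
    |alpha_i(T_e x)|.  The norm of the lattice is monotone, and the T_e are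
    uniformly bounded because the decomposition is unconditional.

    It remains to find in each E_n idempotents of rank one, with bounds that are
    uniform in n.  The M_(n,i) of a block have bounded total mass, and the
    absolute values of their traces add up to at least one.  By pigeonhole, some
    of them that are all nearly proportional to each other carry a fixed share
    of the mass ([heavy_class]).  Their sum A_n, after normalization, is close
    to a matrix of rank one with trace bounded away from 0, so it has an
    isolated simple eigenvalue, and the eigenprojection is a polynomial in A_n
    of degree less than dim E_n with bounded coefficients
    ([near_rank1_projection]).  The A_n are the blocks of one of the operators
    above, and scalar multipliers of the blocks are bounded
    ([multipliers_bounded]); hence the block-diagonal operator made of the
    eigenprojections is bounded.  Compressing the M_(n,i) to the complement of
    the idempotents found so far and repeating this sup_n (dim E_n) times gives
    a resolution of the identity of every block E_n, n < m, into idempotents of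
    rank one ([bounded_partial_resolution]).  All constants depend on the
    dimensions only through their bound and not on m, so an ultrafilter limit in
    m yields such resolutions for all n at once ([limit_resolution]).  Vectors
    f_(n,j) spanning the ranges of these idempotents, with the functionals read
    off from them, form a biorthogonal system whose finite partial sums are
    uniformly bounded, hence an unconditional basis ([resolution_basis]).

    Real and complex scalars are treated together: the argument for
    [unconditional_basis_of_lust] is relative to a field K with the few
    properties collected in [scalars]. *)

(** * Scalars, and norms with real values *)

Section real_valued_norm.
Variables (R : realType) (K : numFieldType).

(** The properties of R and of R[i] on which the proof rests.  [ultra_cvg] is
    the form in which compactness is used; [root_near] is the persistence of
    the simple nonzero root t of X^d - t X^(d-1) under small perturbations (over
    the reals this comes from a change of sign); [grid] is the total boundedness
    of the unit ball; [rademacher] combines Riesz products with the Khintchine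
    inequality: coefficients dominated by those of v are the Rademacher
    coefficients of a function bounded by a multiple of the mean of
    |sum_n e_n v_n|. *)
Record scalars := Scalars {
  emb : {rmorphism R -> K};
  re : K -> R;
  emb_le : forall r s, (emb r <= emb s) = (r <= s);
  reK : forall k, 0 <= k -> emb (re k) = k;
  ultra_cvg : forall (G : set_system nat) (z : nat -> K) (b : R),
    UltraFilter G -> (forall k, `|z k| <= emb b) ->
    exists l : K, z k @[k --> G] --> l;
  root_near : forall (G : set_system nat) (p : nat -> {poly K}) (d : nat) (t : K),
    ProperFilter G -> (0 < d)%N -> t != 0 ->
    (forall k, p k \is monic /\ size (p k) = d.+1) ->
    (forall i, (p k)`_i @[k --> G] --> ('X^d - t *: 'X^(d.-1))`_i) ->
    \forall k \near G, exists l, root (p k) l /\ `|l - t| <= `|t| / 2;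
  grid : forall e : R, 0 < e -> exists (L : nat) (cl : K -> 'I_L),
    forall x y, `|x| <= 1 -> `|y| <= 1 -> cl x = cl y -> `|x - y| <= emb e;
  rademacher : exists c : R, 0 <= c /\ forall m (u v : 'I_m -> K),
    (forall n, `|u n| <= `|v n|) ->
    exists g : {ffun 'I_m -> bool} -> K,
      (forall n, (2 ^ m)%:R^-1 * \sum_(e : {ffun 'I_m -> bool}) (-1) ^+ (e n) * g e = u n) /\
      forall e, `|g e| <= emb c *
        ((2 ^ m)%:R^-1 * \sum_(e' : {ffun 'I_m -> bool}) `|\sum_n (-1) ^+ (e' n) * v n|)
}.

Variable S : scalars.
Local Notation iK := (emb S).

Lemma emb_lt r s : (iK r < iK s) = (r < s).
Proof. by rewrite !lt_neqAle (emb_le S) fmorph_eq. Qed.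

Lemma emb_ge0 r : (0 <= iK r) = (0 <= r).
Proof. by rewrite -(rmorph0 iK) (emb_le S). Qed.

Lemma exists_emb_ge (k : K) : 0 <= k -> exists2 r, 0 <= r & k = iK r.
Proof. by move=> k0; exists (re S k); rewrite ?reK // -emb_ge0 reK. Qed.

Section nrm.
Variable X : normedModType K.
Implicit Types x y : X.

(** The norm of a [normedModType K] has values in K; with values in R it can
    be compared, and suprema taken, in the same way for both kinds of scalars. *)
Definition nrm x : R := re S `|x|.

Lemma emb_nrm x : iK (nrm x) = `|x|. Proof. exact: reK. Qed.

Lemma nrm_ge0 x : 0 <= nrm x.
Proof. by rewrite -emb_ge0 emb_nrm. Qed.

Lemma nrm0_eq0 x : nrm x = 0 -> x = 0.
Proof. by move=> /(congr1 iK); rewrite emb_nrm rmorph0 => /normr0_eq0. Qed.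

Lemma nrm0 : nrm (0 : X) = 0.
Proof. by apply: (fmorph_inj iK); rewrite emb_nrm normr0 rmorph0. Qed.

Lemma nrmN x : nrm (- x) = nrm x. Proof. by rewrite /nrm normrN. Qed.

Lemma nrmC x y : nrm (x - y) = nrm (y - x). Proof. by rewrite /nrm distrC. Qed.

Lemma nrmD x y : nrm (x + y) <= nrm x + nrm y.
Proof. by rewrite -(emb_le S) rmorphD /= !emb_nrm ler_normD. Qed.

Lemma nrmB x y : nrm (x - y) <= nrm x + nrm y.
Proof. by rewrite -(nrmN y) nrmD. Qed.

Lemma nrm_sum (I : Type) (r : seq I) (P : pred I) (f : I -> X) :
  nrm (\sum_(i <- r | P i) f i) <= \sum_(i <- r | P i) nrm (f i).
Proof.
elim/big_ind2: _ => //; first by rewrite nrm0.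
by move=> ? ? ? ? h1 h2; apply: le_trans (nrmD _ _) (lerD h1 h2).
Qed.

Lemma nrm_cvg (T : Type) (F : set_system T) (FF : Filter F) (f : T -> X) l :
  f t @[t --> F] --> l <->
  forall e : R, 0 < e -> \forall t \near F, nrm (l - f t) < e.
Proof.
split=> [/cvgrPdist_lt h e e0|h].
  have /h : 0 < iK e by rewrite -(rmorph0 iK) emb_lt.
  by apply: filterS => t; rewrite -emb_nrm emb_lt.
apply/cvgrPdist_lt => e e0.
have [r _ er] := exists_emb_ge (ltW e0).
have /h : 0 < r by rewrite -emb_lt rmorph0 -er.
by apply: filterS => t; rewrite -emb_nrm er emb_lt.
Qed.

End nrm.

Definition av (k : K) : R := re S `|k|.

Lemma emb_av k : iK (av k) = `|k|. Proof. exact: reK. Qed.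

Lemma av_ge0 k : 0 <= av k. Proof. by rewrite -emb_ge0 emb_av. Qed.

Lemma av0_eq0 k : av k = 0 -> k = 0.
Proof. by move=> /(congr1 iK); rewrite emb_av rmorph0 => /normr0_eq0. Qed.

Lemma av0 : av 0 = 0.
Proof. by apply: (fmorph_inj iK); rewrite emb_av normr0 rmorph0. Qed.

Lemma av1 : av 1 = 1.
Proof. by apply: (fmorph_inj iK); rewrite emb_av normr1 rmorph1. Qed.

Lemma av_gt0 k : k != 0 -> 0 < av k.
Proof. by move=> k0; rewrite lt_neqAle av_ge0 andbT; apply: contra k0 => /eqP/esym/av0_eq0->. Qed.

Lemma avN k : av (- k) = av k. Proof. by rewrite /av normrN. Qed.

Lemma avC k l : av (k - l) = av (l - k). Proof. by rewrite /av distrC. Qed.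

Lemma avM k l : av (k * l) = av k * av l.
Proof. by apply: (fmorph_inj iK); rewrite rmorphM /= !emb_av normrM. Qed.

Lemma avV k : av (k^-1) = (av k)^-1.
Proof. by apply: (fmorph_inj iK); rewrite fmorphV /= !emb_av normfV. Qed.

Lemma avX k n : av (k ^+ n) = av k ^+ n.
Proof. by apply: (fmorph_inj iK); rewrite rmorphXn /= !emb_av normrX. Qed.

Lemma av_emb r : av (iK r) = `|r|.
Proof.
apply: (fmorph_inj iK); rewrite emb_av.
have [r0|r0] := leP 0 r.
  by rewrite !ger0_norm // emb_ge0.
rewrite !ltr0_norm ?rmorphN //.
by rewrite -(rmorph0 iK) emb_lt.
Qed.

Lemma avD k l : av (k + l) <= av k + av l.
Proof. by rewrite -(emb_le S) rmorphD /= !emb_av ler_normD. Qed.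

Lemma avB k l : av (k - l) <= av k + av l.
Proof. by rewrite -(avN l) avD. Qed.

Lemma av_sum (I : Type) (r : seq I) (P : pred I) (f : I -> K) :
  av (\sum_(i <- r | P i) f i) <= \sum_(i <- r | P i) av (f i).
Proof.
elim/big_ind2: _ => //; first by rewrite av0.
by move=> ? ? ? ? h1 h2; apply: le_trans (avD _ _) (lerD h1 h2).
Qed.

Lemma av_prod (I : Type) (r : seq I) (P : pred I) (f : I -> K) :
  av (\prod_(i <- r | P i) f i) = \prod_(i <- r | P i) av (f i).
Proof. exact: (big_morph av avM av1). Qed.

Lemma av_nat n : av n%:R = n%:R.
Proof. by rewrite -(rmorph_nat iK) av_emb ger0_norm ?ler0n. Qed.

Lemma av_sign b : av ((-1) ^+ b) = 1.
Proof. by rewrite avX avN av1 expr1n. Qed.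

Lemma av_le k r : (`|k| <= iK r) = (av k <= r).
Proof. by rewrite -emb_av (emb_le S). Qed.

Lemma av_le_av k l : (`|k| <= `|l|) = (av k <= av l).
Proof. by rewrite -!emb_av (emb_le S). Qed.

Lemma nrmZ (X : normedModType K) k (x : X) : nrm (k *: x) = av k * nrm x.
Proof.
by apply: (fmorph_inj iK); rewrite rmorphM /= emb_av !emb_nrm normrZ.
Qed.

Lemma av_cvg (T : Type) (F : set_system T) (FF : Filter F) (f : T -> K) l :
  f t @[t --> F] --> l <->
  forall e : R, 0 < e -> \forall t \near F, av (l - f t) < e.
Proof. exact: (@nrm_cvg K^o). Qed.

Lemma phase (k : K) : exists2 t, av t <= 1 & t * k = iK (av k).
Proof.
have [->|k0] := eqVneq k 0; first by exists 0; rewrite ?av0 // mulr0 rmorph0.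
exists (iK (av k) / k); last by rewrite divfK.
by rewrite avM avV av_emb ger0_norm ?av_ge0 // divff // gt_eqF ?av_gt0.
Qed.

Lemma av_ultra_cvg (G : set_system nat) (z : nat -> K) (b : R) :
  UltraFilter G -> (forall k, av (z k) <= b) -> exists l : K, z k @[k --> G] --> l.
Proof.
by move=> UG zb; apply: (@ultra_cvg S G z b UG) => k; rewrite av_le.
Qed.

Lemma av_cvg_le (T : Type) (F : set_system T) (FF : ProperFilter F) (f : T -> K) l b :
  f t @[t --> F] --> l -> (\forall t \near F, av (f t) <= b) -> av l <= b.
Proof.
move=> /av_cvg fl fb; apply/ler_addgt0Pl => e e0.
have [t [h1 h2]] := filter_ex (filterI (fl _ e0) fb).
rewrite -(subrK (f t) l); apply: le_trans (avD _ _) _.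
by apply: lerD => //; exact: ltW.
Qed.

Lemma nrm_cvg_le (X : normedModType K) (T : Type) (F : set_system T)
    (FF : ProperFilter F) (f : T -> X) l b :
  f t @[t --> F] --> l -> (\forall t \near F, nrm (f t) <= b) -> nrm l <= b.
Proof.
move=> /nrm_cvg fl fb; apply/ler_addgt0Pl => e e0.
have [t [h1 h2]] := filter_ex (filterI (fl _ e0) fb).
rewrite -(subrK (f t) l); apply: le_trans (nrmD _ _) _.
by apply: lerD => //; exact: ltW.
Qed.

Lemma cvg_fsum (X : normedModType K) (T : Type) (F : set_system T) (FF : Filter F)
    (I : Type) (r : seq I) (P : pred I) (f : I -> T -> X) (l : I -> X) :
  (forall i, P i -> f i t @[t --> F] --> l i) ->
  \sum_(i <- r | P i) f i t @[t --> F] --> \sum_(i <- r | P i) l i.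
Proof.
by move=> fl; apply: cvg_big => //; exact: add_continuous.
Qed.

End real_valued_norm.

(** * Bases of finite-dimensional subspaces *)

Section finite_dimension.
Variables (R : realType) (K : numFieldType) (S : scalars R K).
Variables (X : normedModType K).
Local Notation iK := (emb S).
Local Notation nrm := (nrm S).
Local Notation av := (av S).

Definition lincomb d (e : 'I_d -> X) (a : 'I_d -> K) : X := \sum_(i < d) a i *: e i.

Definition free_family d (e : 'I_d -> X) :=
  forall a : 'I_d -> K, lincomb e a = 0 -> forall i, a i = 0.

Lemma lincombD d (e : 'I_d -> X) a b :
  lincomb e (fun i => a i + b i) = lincomb e a + lincomb e b.
Proof. by rewrite -big_split; apply: eq_bigr => i _; rewrite scalerDl. Qed.

Lemma lincombZ d (e : 'I_d -> X) k a :
  lincomb e (fun i => k * a i) = k *: lincomb e a.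
Proof. by rewrite scaler_sumr; apply: eq_bigr => i _; rewrite scalerA. Qed.

Lemma lincombN d (e : 'I_d -> X) a :
  lincomb e (fun i => - a i) = - lincomb e a.
Proof. by rewrite -sumrN; apply: eq_bigr => i _; rewrite scaleNr. Qed.

Lemma lincombB d (e : 'I_d -> X) a b :
  lincomb e (fun i => a i - b i) = lincomb e a - lincomb e b.
Proof. by rewrite lincombD lincombN. Qed.

Lemma lincomb_inj d (e : 'I_d -> X) a b : free_family e ->
  lincomb e a = lincomb e b -> a = b.
Proof.
move=> fe ab; apply/funext => i; apply/eqP; rewrite -subr_eq0; apply/eqP.
by apply: (fe (fun i => a i - b i)); rewrite lincombB ab subrr.
Qed.

(** Coefficients of absolute sum 1 with ever smaller combinations would have a
    limit along an ultrafilter, which would be a nontrivial relation. *)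
Lemma coord_bounded d (e : 'I_d -> X) : free_family e ->
  exists2 C, 0 <= C & forall a i, av (a i) <= C * nrm (lincomb e a).
Proof.
move=> fe; apply: contrapT => noC.
have {}noC (k : nat) : exists a : 'I_d -> K,
    \sum_i av (a i) = 1 /\ k%:R * nrm (lincomb e a) < 1.
  apply: contrapT => noa; apply: noC; exists k%:R => // a i.
  rewrite leNgt; apply/negP => ai; apply: noa.
  pose s := \sum_i av (a i).
  have ais : av (a i) <= s.
    by rewrite /s (bigD1 i) //= lerDl sumr_ge0 // => j _; exact: av_ge0.
  have s0 : 0 < s.
    apply: lt_le_trans ais; apply: le_lt_trans ai.
    by rewrite mulr_ge0 // nrm_ge0.
  exists (fun j => (iK s)^-1 * a j); split.
    under eq_bigr do rewrite avM avV av_emb gtr0_norm //.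
    by rewrite -mulr_sumr -/s mulVf // gt_eqF.
  rewrite lincombZ nrmZ avV av_emb gtr0_norm // mulrCA mulrC.
  by rewrite ltr_pdivrMr // mul1r (lt_le_trans ai).
have [a /all_and2[a1 a2]] := choice noC.
have [G [UG Goo]] := ultraFilterLemma (@eventually_filter).
have PG : ProperFilter G by exact: ultra_proper.
have a_le1 i k : av (a k i) <= 1.
  by rewrite -(a1 k) (bigD1 i) //= lerDl sumr_ge0 // => j _; exact: av_ge0.
have [l al] := choice (fun i => av_ultra_cvg UG (a_le1 i)).
have al0 : lincomb e l = 0.
  apply: (nrm0_eq0 (S := S)); apply/eqP; rewrite eq_le nrm_ge0 andbT.
  apply/ler_addgt0Pl => eps eps0; rewrite addr0.
  have lim : lincomb e (a k) @[k --> G] --> lincomb e l.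
    by apply: cvg_fsum => i _; apply: cvgZr_tmp; exact: al.
  apply: (nrm_cvg_le _ lim).
  have : \forall k \near \oo, eps^-1 < (k%:R : R) by exact: nbhs_infty_gtr.
  move/Goo; apply: filterS => k ek.
  have k0 : 0 < (k%:R : R) by apply: lt_trans ek; rewrite invr_gt0.
  apply/ltW; apply: lt_le_trans (_ : k%:R^-1 <= _).
    by rewrite -(ltr_pM2l k0) divff ?a2 // gt_eqF.
  by rewrite -(invrK eps) lef_pV2 ?posrE ?invr_gt0 // ltW.
have l0 := fe l al0.
have /filter_ex[] : G [set k | forall i, av (a k i) < d.+1%:R^-1].
  apply: filter_forall => i.
  have e0 : 0 < (d.+1%:R : R)^-1 by rewrite invr_gt0.
  have /(av_cvg S _)/(_ _ e0) := al i.
  by apply: filterS => k; rewrite l0 sub0r avN.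
move=> k kd; have := a1 k; apply/eqP; rewrite lt_eqF //.
apply: le_lt_trans (_ : \sum_(i < d) d.+1%:R^-1 < _).
  by apply: ler_sum => i _; exact: ltW.
rewrite sumr_const card_ord -[ltLHS]mulr_natl ltr_pdivrMr ?ltr0Sn // mul1r ltr_nat.
exact: ltnSn.
Qed.

(** The coefficients of a bounded sequence are bounded, so they have a limit
    along the ultrafilter. *)
Lemma span_closed d (e : 'I_d -> X) (G : set_system nat) (UG : UltraFilter G)
    (x : nat -> X) l B :
  free_family e -> (forall k, range (lincomb e) (x k)) ->
  (forall k, nrm (x k) <= B) -> x k @[k --> G] --> l -> range (lincomb e) l.
Proof.
move=> fe xe xB xl.
have [C C0 eC] := coord_bounded fe.
have /choice[a ax] : forall k, exists a, lincomb e a = x k.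
  by move=> k; have [a _ <-] := xe k; exists a.
have aB i k : av (a k i) <= C * B.
  by apply: le_trans (eC _ _) _; rewrite ler_wpM2l // ax.
have [b ab] := choice (fun i => av_ultra_cvg UG (aB i)).
exists b => //; apply: cvg_unique xl; first exact: norm_hausdorff.
have -> : x = fun k => lincomb e (a k) by apply/funext => k; rewrite ax.
by apply: cvg_fsum => i _; apply: cvgZr_tmp; exact: ab.
Qed.

Lemma av_det_le d (M : 'M[K]_d) C :
  (forall i j, av (M i j) <= C) -> av (\det M) <= (d`!)%:R * C ^+ d.
Proof.
move=> MC; apply: le_trans (av_sum _ _ _ _) _.
rewrite -(perm.card_Sn d) mulr_natl -sumr_const.
apply: ler_sum => s _; rewrite avM av_sign mul1r av_prod.
rewrite -[X in C ^+ X](card_ord d) -prodr_const.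
by apply: ler_prod => i _; rewrite av_ge0 MC.
Qed.

Lemma det_row_subst d (a : 'I_d -> K) (i : 'I_d) :
  \det (\matrix_(k, j) if k == i then a j else (k == j)%:R) = a i.
Proof.
rewrite (expand_det_col _ i) (bigD1 i) //= mxE eqxx big1 => [|k ki].
  rewrite addr0 /cofactor addnn -mul2n exprM sqrrN expr1n expr1n mul1r.
  rewrite (_ : row' _ _ = 1%:M) ?det1 ?mulr1 //.
  apply/matrixP => k j; rewrite !mxE eq_sym (negbTE (neq_lift _ _)).
  by rewrite (inj_eq lift_inj).
by rewrite mxE (negbTE ki) mul0r.
Qed.

(** Auerbach's argument with a family in the unit ball whose determinant is
    only more than half the supremum: putting x / |x| in the place of g_i
    multiplies the determinant by the i-th coordinate of x / |x|, which
    therefore is less than 2. *)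
Lemma near_auerbach (E : set X) d : has_dim E d -> exists g : 'I_d -> X,
  [/\ free_family g, E = range (lincomb g), forall i, nrm (g i) <= 1
    & forall a i, av (a i) <= 2 * nrm (lincomb g a)].
Proof.
move=> [e [fe ->]].
have [C C0 eC] := coord_bounded (fe : free_family e).
pose v (M : 'M[K]_d) k := lincomb e (M k).
pose D := [set r | exists2 M : 'M[K]_d, (forall k, nrm (v M k) <= 1) & r = av (\det M)].
have D_le r : D r -> r <= (d`!)%:R * C ^+ d.
  move=> [M Mv ->]; apply: av_det_le => i j.
  by apply: le_trans (eC _ _) _; rewrite -[leRHS]mulr1 ler_wpM2l // Mv.
(* t scales all the e i into the unit ball, so the supremum is positive *)
pose t := (1 + \sum_i nrm (e i))^-1.
have s0 : 0 <= \sum_i nrm (e i) by apply: sumr_ge0 => i _; exact: nrm_ge0.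
have t0 : 0 < t by rewrite invr_gt0 ltr_wpDr.
have Dt : D (t ^+ d).
  exists (iK t)%:M; last by rewrite det_scalar avX av_emb gtr0_norm.
  move=> k; rewrite /v /lincomb (bigD1 k) //= mxE eqxx mulr1n big1 => [|j jk].
    rewrite addr0 nrmZ av_emb gtr0_norm // /t mulrC ler_pdivrMr ?ltr_wpDr //.
    rewrite mul1r (bigD1 k) //= addrCA lerDl addr_ge0 // sumr_ge0 // => j _.
    exact: nrm_ge0.
  by rewrite mxE eq_sym (negbTE jk) mulr0n scale0r.
have supD : has_sup D by split; [exists (t ^+ d)|exists ((d`!)%:R * C ^+ d)].
have s_gt0 : 0 < sup D.
  by apply: lt_le_trans (exprn_gt0 d t0) _; apply: ub_le_sup => //; case: supD.
have [r [M Mv rM] rs] : exists2 r, D r & sup D / 2 < r.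
  have h : 0 < sup D / 2 by rewrite divr_gt0.
  have [r Dr hr] := sup_adherent h supD; exists r => //.
  by apply: le_lt_trans hr; rewrite {2}(splitr (sup D)) addrK.
have r0 : 0 < r by apply: lt_trans rs; rewrite divr_gt0.
have detM : M \in unitmx.
  rewrite unitmxE unitfE; apply/eqP => M0.
  by move: r0; rewrite rM M0 av0 ltxx.
have vE a : lincomb (v M) a = lincomb e (fun j => \sum_k a k * M k j).
  rewrite /lincomb /v /lincomb.
  under eq_bigr do rewrite scaler_sumr.
  rewrite exchange_big; apply: eq_bigr => j _; rewrite scaler_suml.
  by apply: eq_bigr => k _; rewrite scalerA.
have fv : free_family (v M).
  move=> a; rewrite vE => /fe a0 i.
  have : (\row_j a j) *m M = 0.
    apply/rowP => j; rewrite !mxE -[RHS](a0 j).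
    by apply: eq_bigr => k _; rewrite mxE.
  move/(congr1 (mulmx^~ (invmx M))); rewrite mulmxK // mul0mx.
  by move/rowP/(_ i); rewrite !mxE.
exists (v M); split => //.
  apply/seteqP; split => x [a _ <-]; last by rewrite vE; eexists.
  exists (fun k => \sum_j a j * invmx M j k) => //; rewrite vE.
  apply: eq_bigr => j _; congr (_ *: _).
  under eq_bigr do rewrite mulr_suml.
  rewrite exchange_big /=.
  under eq_bigr => i _.
    under eq_bigr do rewrite -mulrA.
    rewrite -mulr_sumr (_ : \sum_(_ < _) _ = (i == j)%:R); first over.
    by have /matrixP/(_ i j) := mulVmx detM; rewrite !mxE => <-.
  rewrite /= (bigD1 j) //= eqxx mulr1 big1 ?addr0 // => i /negbTE->.
  by rewrite mulr0.
move=> a i; set x := lincomb _ _.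
have [x0|x0] := eqVneq (nrm x) 0.
  by rewrite x0 mulr0 (fv a) ?av0 //; exact: (nrm0_eq0 x0).
have {}x0 : 0 < nrm x by rewrite lt_neqAle eq_sym x0 nrm_ge0.
pose b j := (iK (nrm x))^-1 * a j.
pose T := \matrix_(k, j) (if k == i then b j else (k == j)%:R).
have : D (av (\det (T *m M))).
  exists (T *m M) => // k.
  have [->|ki] := eqVneq k i.
    rewrite (_ : v _ i = lincomb (v M) b).
      rewrite lincombZ nrmZ avV av_emb gtr0_norm // -/x mulVf //.
      by rewrite gt_eqF.
    rewrite vE; apply: eq_bigr => j _; rewrite mxE; congr (_ *: _).
    by apply: eq_bigr => l _; rewrite mxE eqxx.
  rewrite (_ : v _ k = v M k) ?Mv //.
  apply: eq_bigr => j _; congr (_ *: _).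
  rewrite mxE (bigD1 k) //= mxE (negbTE ki) eqxx mul1r big1 ?addr0 // => l lk.
  by rewrite mxE (negbTE ki) eq_sym (negbTE lk) mul0r.
move=> /(ub_le_sup supD.2); rewrite det_mulmx det_row_subst avM -rM => h.
have {}h : av (b i) * r < 2 * r.
  by apply: le_lt_trans h _; rewrite mulrC -ltr_pdivrMr.
move: h; rewrite ltr_pM2r // /b avM avV av_emb gtr0_norm // mulrC.
by rewrite ltr_pdivrMr // => /ltW.
Qed.

End finite_dimension.

(** * Unconditionally convergent series and a category argument *)

Section rearrangement.
Variables (R : realType) (K : numFieldType) (S : scalars R K).
Variables (X : normedModType K).
Local Notation nrm := (nrm S).

Lemma block_index (a : nat -> nat) : a 0 = 0%N -> (forall k, a k < a k.+1)%N ->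
  exists kap : nat -> nat, forall j k, (a k <= j < a k.+1)%N = (k == kap j).
Proof.
move=> a0 aS.
have aM : {homo a : k l / (k <= l)%N}.
  by apply: homo_leq => [//|? ? ?|k]; [exact: leq_trans|exact: ltnW].
have ex j : exists k, (a k <= j < a k.+1)%N.
  elim: j => [|j [k /andP[h1 h2]]]; first by exists 0%N; rewrite a0 /= -{1}a0.
  have [h|h] := ltnP j.+1 (a k.+1); first by exists k; rewrite h (leq_trans h1).
  exists k.+1; rewrite h /=; apply: leq_ltn_trans (aS _).
  by rewrite (leq_trans h2).
have [kap kapP] := choice ex; exists kap => j k.
apply/idP/eqP => [/andP[h1 h2]|->//].
have /andP[h3 h4] := kapP j.
by case: (ltngtP k (kap j)) => // /aM h; lia.
Qed.

(** The block [a k, a k.+1) is listed twice as slowly as it is long: its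
    elements in F k come during the first half, the others during the second
    half, and blanks fill the gaps.  The sum over the part of the block in F k
    is thus a difference of two partial sums of one rearrangement. *)
Lemma split_enumeration (a : nat -> nat) (F : nat -> pred nat) :
  a 0 = 0%N -> (forall k, a k < a k.+1)%N ->
  exists2 s : nat -> option nat, enumeration s &
    forall k t, (a k <= t < a k.+1)%N -> s (t + a k)%N = if F k t then Some t else None.
Proof.
move=> a0 aS; have [kap kapP] := block_index a0 aS.
pose s t := let k := kap t./2 in
  if (t < a k + a k.+1)%N then (if F k (t - a k)%N then Some (t - a k)%N else None)
  else (if F k (t - a k.+1)%N then None else Some (t - a k.+1)%N).
have half t k : (a k + a k <= t < a k.+1 + a k.+1)%N -> kap t./2 = k.
  move=> h; apply/esym/eqP; rewrite -kapP.
  have := odd_double_half t; lia.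
exists s => [j|k t h]; last first.
  by rewrite /s (half _ k) ?addnK; [case: ifP => //; lia | lia].
have [k /esym kj] : exists k, kap j = k by eexists.
have h : (a k <= j < a k.+1)%N by rewrite kapP kj.
(* the listing of the block of index k starts at time a k + a k *)
exists (if F k j then j + a k else j + a k.+1)%N; split.
  rewrite /s (half _ k); last by case: ifP => _; lia.
  have e1 : (j + a k < a k + a k.+1)%N by lia.
  have e2 : (j + a k.+1 < a k + a k.+1)%N = false by lia.
  by case: (boolP (F k j)) => [|/negbTE] Fj; rewrite ?e1 ?e2 addnK Fj.
move=> t; rewrite /s; set l := kap t./2.
have hl : (a l <= t./2 < a l.+1)%N by rewrite kapP.
have ht := odd_double_half t; have ot : (odd t <= 1)%N by case: (odd t).
have lk i : (a l <= i < a l.+1)%N -> i = j -> l = k.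
  by move=> hi ij; apply/eqP; rewrite kj -ij -kapP.
case: ifP => h1; case: ifP => h2 // -[tj].
  have e : l = k by apply: (lk (t - a l)%N) => //; lia.
  by rewrite -tj -e h2; lia.
have e : l = k by apply: (lk (t - a l.+1)%N) => //; lia.
by rewrite -tj -e h2; lia.
Qed.

(** Otherwise there are, beyond any index, finite sets with sums larger than 1,
    and a rearrangement that lists infinitely many of them consecutively has
    no limit. *)
Lemma unconditional_bounded (u : nat -> X) x : unconditional_sum u x ->
  exists B, forall (F : pred nat) m, nrm (\sum_(0 <= n < m | F n) u n) <= B.
Proof.
move=> ux; apply: contrapT => noB.
have /choice[M MP] : forall N, exists MF : nat * pred nat,
    1 < nrm (\sum_(N <= n < MF.1 | MF.2 n) u n).
  move=> N; apply: contrapT => noF; apply: noB.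
  exists (\sum_(0 <= n < N) nrm (u n) + 1) => F m.
  have le1 M : nrm (\sum_(N <= n < M | F n) u n) <= 1.
    by rewrite leNgt; apply/negP => h; apply: noF; exists (M, F).
  have sub k : (k <= N)%N ->
      nrm (\sum_(0 <= n < k | F n) u n) <= \sum_(0 <= n < N) nrm (u n).
    move=> kN; apply: le_trans (nrm_sum _ _ _ _) _.
    rewrite big_mkcond /= [leRHS](big_cat_nat (leq0n k) kN) /=.
    rewrite -[leLHS]addr0 lerD //; last by apply: sumr_ge0 => i _; exact: nrm_ge0.
    by apply: ler_sum => i _; case: ifP => // _; exact: nrm_ge0.
  have [mN|/ltnW mN] := leqP m N.
    by apply: le_trans (sub _ mN) _; rewrite lerDl.
  rewrite (big_cat_nat (leq0n N) mN) /=; apply: le_trans (nrmD _ _ _) _.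
  by apply: lerD => //; exact: sub.
pose a := fix a k := if k is k.+1 then (M (a k)).1 else 0%N.
have aS k : (a k < a k.+1)%N.
  rewrite ltnNge /=; apply/negP => h; have := MP (a k).
  by rewrite big_geq // nrm0 ltNge ler01.
have [s es sF] := split_enumeration (fun k => (M (a k)).2) (erefl _) aS.
have /(nrm_cvg S)/(_ (1/2)) := ux _ es.
have h2 : 0 < 1 / 2 :> R by rewrite divr_gt0.
move=> /(_ h2)[N _ NP].
have Na : (N <= a N)%N.
  have : forall k, (k <= a k)%N by elim=> // k ih; exact: leq_ltn_trans (aS _).
  exact.
have := MP (a N); rewrite ltNge => /negP; apply.
have := NP (a N + a N)%N; have := NP (a N.+1 + a N)%N => /=.
set w := (fun k => oapp u 0 (s k)).
have le2 : (a N + a N <= a N.+1 + a N)%N by rewrite leq_add2r ltnW.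
have -> : \sum_(0 <= k < a N.+1 + a N) w k =
  \sum_(0 <= k < a N + a N) w k + \sum_(a N <= n < (M (a N)).1 | (M (a N)).2 n) u n.
  rewrite (big_cat_nat (leq0n _) le2) /=; congr (_ + _).
  rewrite big_addn addnK [RHS]big_mkcond.
  apply: eq_big_nat => i hi; rewrite /w sF //.
  by case: ifP.
move: (\sum_(_ <= _ < _ | _) _) (\sum_(_ <= _ < _) _) => y z h1 h3.
have {}h1 := h1 (leq_trans Na (leq_addl _ _)).
have {}h3 := h3 (leq_trans Na (leq_addl _ _)).
have -> : y = (x - z) - (x - (z + y)) by rewrite opprB addrC addrA subrK addrC addKr.
by apply: le_trans (nrmB _ _ _) _; lra.
Qed.

End rearrangement.

Section complete.
Variables (R : realType) (K : numFieldType) (S : scalars R K).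
Variables (X : completeNormedModType K).
Local Notation nrm := (nrm S).

Lemma nrm_complete (u : nat -> X) (b : nat -> R) :
  (forall e, 0 < e -> exists N, b N < e) ->
  (forall N n, (N <= n)%N -> nrm (u n - u N) <= b N) ->
  exists l : X, u n @[n --> \oo] --> l.
Proof.
move=> b0 ub; apply/cvg_ex; apply: cauchy_cvg; apply: cauchy_exP => e e0.
have [r _ er] := exists_emb_ge S (ltW e0).
have r0 : 0 < r by rewrite -(emb_lt S) rmorph0 -er.
have [N Nr] := b0 r r0; exists (u N).
exists N => // n /= Nn; rewrite -ball_normE /= -(emb_nrm S) er emb_lt nrmC.
exact: le_lt_trans (ub _ _ Nn) Nr.
Qed.

Lemma pow_half_lt (c e : R) : 0 <= c -> 0 < e -> exists N, c * 2^-1 ^+ N < e.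
Proof.
move=> c0 e0.
have : (fun n => c * 2^-1 ^+ n) n @[n --> \oo] --> c * 0.
  by apply: cvgM; [exact: cvg_cst|apply: cvg_expr; rewrite ger0_norm; lra].
rewrite mulr0 => /cvgrPdist_lt/(_ e e0)[N _ /(_ N (leqnn _))] /=.
rewrite sub0r normrN ger0_norm; first by exists N.
by rewrite mulr_ge0 // exprn_ge0 // invr_ge0.
Qed.

(** Baire's theorem for a countable cover: if no C k is dense in a ball, any
    ball contains one of at most half the radius, away from C k; the common
    point of a sequence of such balls, one for each k, would not be covered. *)
Lemma countable_cover_dense_ball (C : nat -> set X) : (forall x, exists k, C k x) ->
  exists k x0 r, 0 < r /\ forall y, nrm (y - x0) <= r ->
    forall e, 0 < e -> exists2 z, C k z & nrm (y - z) < e.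
Proof.
move=> cov; apply: contrapT => nob.
have step (p : nat * (X * R)) : exists q : X * R, 0 < p.2.2 ->
    [/\ 0 < q.2, q.2 <= p.2.2 / 2, nrm (q.1 - p.2.1) <= p.2.2 / 2 &
      forall z, C p.1 z -> 2 * q.2 <= nrm (q.1 - z)].
  case: p => k [x r] /=; have [r0|r0] := pselect (0 < r); last by exists (x, r).
  have r20 : 0 < r / 2 by rewrite divr_gt0.
  apply: contrapT => noq; apply: nob; exists k, x, (r / 2); split => // y yx e e0.
  apply: contrapT => noz; apply: noq; exists (y, Num.min (r / 2) (e / 2)) => _ /=.
  split => //; first by rewrite lt_min r20 divr_gt0.
    by rewrite ge_min lexx.
  move=> z Cz; apply: le_trans (_ : e <= _).
    rewrite mulrC -ler_pdivlMr // ge_min lexx orbT //.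
  by rewrite leNgt; apply/negP => h; apply: noz; exists z.
have [f fP] := choice step.
pose p := fix p k : X * R := if k is k.+1 then f (k, p k) else (0, 1).
have p0 k : 0 < (p k).2 by elim: k => [|k /= ih] //=; case: (fP (k, p k) ih).
have pS k := fP (k, p k) (p0 k).
have dist N n : (N <= n)%N -> nrm ((p n).1 - (p N).1) <= (p N).2 - (p n).2.
  move=> /subnKC <-; elim: (n - N)%N => [|i ih]; first by rewrite addn0 !subrr nrm0.
  rewrite addnS /=; have [_ /= h1 h2 _] := pS (N + i)%N.
  rewrite -(subrK (p (N + i)%N).1 (f _).1) -addrA; apply: le_trans (nrmD _ _ _) _.
  apply: le_trans (lerD h2 ih) _; lra.
have pN N : (p N).2 <= 1 * 2^-1 ^+ N.
  elim: N => [|N ih] /=; first by rewrite mulr1.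
  by have [_ /= h _ _] := pS N; rewrite exprS; lra.
have [|N n /dist h|l pl] := nrm_complete (u := fun k => (p k).1) (b := fun k => (p k).2).
- move=> e e0; have [N Ne] := pow_half_lt ler01 e0.
  by exists N; apply: le_lt_trans Ne.
- by apply: le_trans h _; rewrite gerBl ltW.
have [k Ck] := cov l.
have [h0 /= _ _ /(_ _ Ck) h] := pS k.
suff : nrm (l - (p k.+1).1) <= (p k.+1).2.
  rewrite nrmC => /(le_trans h) /=; lra.
have pl' : (p n).1 - (p k.+1).1 @[n --> \oo] --> l - (p k.+1).1.
  by apply: cvgB => //; exact: cvg_cst.
apply: nrm_cvg_le pl' _.
exists k.+1 => // n /= /dist /= h1; apply: le_trans h1 _.
by rewrite gerBl ltW.
Qed.

End complete.

(** * Boundedness of projections and multipliers of a decomposition *)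

Section subspace_facts.
Variables (K : numFieldType) (X : normedModType K).

Lemma fin_dim_range (E : set X) : fin_dim E ->
  exists d (e : 'I_d -> X), free_family e /\ E = range (lincomb e).
Proof. by move=> [d [e [fe ->]]]; exists d, e. Qed.

Lemma fin_dim_lin (E : set X) k x y : fin_dim E -> E x -> E y -> E (k *: x + y).
Proof.
move=> /fin_dim_range[d [e [_ ->]]] [a _ <-] [b _ <-].
by exists (fun i => k * a i + b i) => //; rewrite lincombD lincombZ.
Qed.

Lemma fin_dim0 (E : set X) : fin_dim E -> E 0.
Proof.
move=> /fin_dim_range[d [e [_ ->]]]; exists (fun=> 0) => //.
by apply: big1 => i _; rewrite scale0r.
Qed.

Lemma fin_dimZ (E : set X) k x : fin_dim E -> E x -> E (k *: x).
Proof.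
by move=> fE Ex; rewrite -[_ *: _]addr0; apply: fin_dim_lin => //; exact: fin_dim0.
Qed.

Lemma fin_dimD (E : set X) x y : fin_dim E -> E x -> E y -> E (x + y).
Proof. by move=> fE Ex Ey; rewrite -[x]scale1r; exact: fin_dim_lin. Qed.

Lemma fin_dim_sum (E : set X) (I : Type) (r : seq I) (P : pred I) (f : I -> X) :
  fin_dim E -> (forall i, P i -> E (f i)) -> E (\sum_(i <- r | P i) f i).
Proof.
move=> fE Ef; elim/big_ind: _ => //; first exact: fin_dim0.
by move=> x y; exact: fin_dimD.
Qed.

End subspace_facts.

Section ufdd_projections.
Variables (R : realType) (K : numFieldType) (S : scalars R K).
Variables (X : completeNormedModType K) (E : nat -> set X) (uE : ufdd E).
Local Notation iK := (emb S).
Local Notation nrm := (nrm S).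
Local Notation av := (av S).

Definition proj (n : nat) (x : X) : X := sval (cid (uE.2 x)) n.

Lemma projP x : [/\ forall n, E n (proj n x),
        series (proj^~ x) @ \oo --> x,
        forall v : nat -> X, (forall n, E n (v n)) ->
          series v @ \oo --> x -> v = proj^~ x
      & unconditional_sum (proj^~ x) x].
Proof. by rewrite /proj; case: (cid _). Qed.

Lemma proj_in n x : E n (proj n x). Proof. by case: (projP x). Qed.

Lemma proj_uniq x v : (forall n, E n (v n)) -> series v @ \oo --> x ->
  forall n, proj n x = v n.
Proof. by move=> Ev vx n; case: (projP x) => _ _ /(_ v Ev vx) -> _. Qed.

Lemma proj_lin n k x y : proj n (k *: x + y) = k *: proj n x + proj n y.
Proof.
apply: (@proj_uniq _ (fun n => k *: proj n x + proj n y)).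
  by move=> m; apply: fin_dim_lin; [exact: uE.1|exact: proj_in|exact: proj_in].
have [_ hx _ _] := projP x; have [_ hy _ _] := projP y.
rewrite (_ : series _ = fun m => k *: series (proj^~ x) m + series (proj^~ y) m).
  by apply: cvgD => //; apply: cvgZl_tmp.
apply/funext => m; rewrite /series /= scaler_sumr -big_split.
by apply: eq_bigr.
Qed.

Lemma projD n x y : proj n (x + y) = proj n x + proj n y.
Proof. by have := proj_lin n 1 x y; rewrite !scale1r. Qed.

Lemma proj0 n : proj n 0 = 0.
Proof. by apply: (addrI (proj n 0)); rewrite -projD !addr0. Qed.

Lemma projZ n k x : proj n (k *: x) = k *: proj n x.
Proof. by have := proj_lin n k x 0; rewrite proj0 !addr0. Qed.

Lemma projN n x : proj n (- x) = - proj n x.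
Proof. by rewrite -scaleN1r projZ scaleN1r. Qed.

Lemma projB n x y : proj n (x - y) = proj n x - proj n y.
Proof. by rewrite projD projN. Qed.

Lemma proj_sum n (I : Type) (r : seq I) (P : pred I) (f : I -> X) :
  proj n (\sum_(i <- r | P i) f i) = \sum_(i <- r | P i) proj n (f i).
Proof. exact: (big_morph (proj n) (projD n) (proj0 n)). Qed.

Lemma proj_fsum n m (v : nat -> X) : (forall k, E k (v k)) ->
  proj n (\sum_(0 <= k < m) v k) = if (n < m)%N then v n else 0.
Proof.
move=> Ev; apply: (@proj_uniq _ (fun n => if (n < m)%N then v n else 0)).
  by move=> k; case: ifP => // _; apply: fin_dim0; exact: uE.1.
apply: cvg_near_cst; exists m => // j /= mj.
rewrite /series /= (big_cat_nat (leq0n m) mj) /= [X in _ + X]big_nat_cond [X in _ + X]big1 ?addr0.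
  by apply: eq_big_nat => i /andP[_ ->].
by move=> i; rewrite andbT => /andP[mi _]; rewrite ltnNge mi.
Qed.

Lemma proj_id n x : E n x -> forall m, proj m x = if m == n then x else 0.
Proof.
move=> Ex m.
pose v k := if k == n then x else 0.
have Ev k : E k (v k).
  by rewrite /v; case: eqP => [->//|_]; apply: fin_dim0; exact: uE.1.
have e : \sum_(0 <= k < n.+1) v k = x.
  rewrite big_nat_recr //= big_nat_cond big1 ?add0r /v ?eqxx // => i.
  by rewrite andbT => /andP[_ /ltn_eqF->].
by rewrite -{1}e (proj_fsum _ _ Ev) ltnS /v; case: eqP => [->|]; rewrite ?leqnn // if_same.
Qed.

Definition subsum (F : pred nat) m (x : X) := \sum_(0 <= n < m | F n) proj n x.

Lemma subsum1 n x : subsum (pred1 n) n.+1 x = proj n x.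
Proof.
rewrite /subsum big_mkcond big_nat_recr //= eqxx big_nat_cond big1 ?add0r //.
by move=> i; rewrite andbT => /andP[_ /ltn_eqF->].
Qed.

Lemma subsumB F m x y : subsum F m (x - y) = subsum F m x - subsum F m y.
Proof. by rewrite /subsum -sumrB; apply: eq_bigr => i _; rewrite projB. Qed.

Lemma subsumD F m x y : subsum F m (x + y) = subsum F m x + subsum F m y.
Proof. by rewrite /subsum -big_split; apply: eq_bigr => i _; rewrite projD. Qed.

Lemma subsumZ F m k x : subsum F m (k *: x) = k *: subsum F m x.
Proof. by rewrite /subsum scaler_sumr; apply: eq_bigr => i _; rewrite projZ. Qed.

Let subsums_le (t : R) (x : X) := forall F m, nrm (subsum F m x) <= t.

Let subsums_leB s t x y : subsums_le s x -> subsums_le t y -> subsums_le (s + t) (x - y).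
Proof.
move=> hx hy F m; rewrite subsumB.
by apply: le_trans (nrmB _ _ _) (lerD (hx _ _) (hy _ _)).
Qed.

Let subsums_leD s t x y : subsums_le s x -> subsums_le t y -> subsums_le (s + t) (x + y).
Proof.
move=> hx hy F m; rewrite subsumD.
by apply: le_trans (nrmD _ _ _) (lerD (hx _ _) (hy _ _)).
Qed.

(** By unconditional convergence the points with bounded subsums form a
    countable union, so for some bound they are dense in a ball, by Baire;
    differences and scaling carry this to the whole space. *)
Lemma subsums_le_dense : exists2 B, 0 <= B & forall x e, 0 < e ->
  exists2 z, subsums_le (B * nrm x) z & nrm (x - z) < e.
Proof.
have cov x : exists k : nat, subsums_le k%:R x.
  have [_ _ _ /(unconditional_bounded S)[B BP]] := projP x.
  exists (Num.truncn B).+1 => F m; apply: le_trans (BP F m) _.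
  exact/ltW/truncnS_gt.
have [k [x0 [r [r0 kP]]]] := countable_cover_dense_ball S cov.
exists ((k%:R + k%:R) / r); first by rewrite divr_ge0 ?addr_ge0 // ltW.
move=> x e e0; have [x00|x_neq0] := eqVneq (nrm x) 0.
  have -> := nrm0_eq0 x00; exists 0; last by rewrite subr0 nrm0.
  move=> F m; rewrite nrm0 mulr0 /subsum big1 ?nrm0 // => i _; exact: proj0.
have {}x_neq0 : 0 < nrm x by rewrite lt_neqAle eq_sym x_neq0 nrm_ge0.
pose c := r / nrm x; have c0 : 0 < c by rewrite divr_gt0.
have d0 : 0 < e * c / 2 by rewrite divr_gt0 // mulr_gt0.
have [|z1 z1k z1x] := kP (x0 + iK c *: x) _ _ d0.
  rewrite addrC addKr nrmZ av_emb gtr0_norm // /c divfK //.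
  by rewrite gt_eqF.
have [|z2 z2k z2x] := kP x0 _ _ d0; first by rewrite subrr nrm0 ltW.
have cK : iK c != 0 by rewrite fmorph_eq0 gt_eqF.
exists ((iK c)^-1 *: (z1 - z2)).
  move=> F m; rewrite subsumZ nrmZ avV av_emb gtr0_norm //.
  have -> : (k%:R + k%:R) / r * nrm x = c^-1 * (k%:R + k%:R).
    by rewrite /c invf_div; ring.
  by rewrite ler_wpM2l ?invr_ge0 ?(ltW c0) //; exact: subsums_leB.
rewrite -(scalerK cK x) -scalerBr nrmZ avV av_emb gtr0_norm //.
rewrite mulrC ltr_pdivrMr //.
have -> : iK c *: x - (z1 - z2) = (x0 + iK c *: x - z1) - (x0 - z2).
  by rewrite !opprB [RHS]addrC !addrA subrK (addrC z2).
apply: le_lt_trans (nrmB _ _ _) _; lra.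
Qed.

(** Successive approximations, as in the open mapping theorem: x is the sum of
    corrections with subsums bounded by multiples of |x| / 2^k.  The components
    of the partial sums converge, and by uniqueness their limits are the
    components of x. *)
Lemma projections_bounded : exists2 B, 0 <= B & forall F m x,
  nrm (subsum F m x) <= B * nrm x.
Proof.
have [B B0 BP] := subsums_le_dense; exists (2 * B); first by rewrite mulr_ge0.
move=> F m x; set t := nrm x.
have [t0|t_neq0] := eqVneq t 0.
  have -> := nrm0_eq0 t0; rewrite t0 mulr0 /subsum big1 ?nrm0 // => i _.
  exact: proj0.
have {}t_gt0 : 0 < t by rewrite lt_neqAle eq_sym t_neq0 nrm_ge0.
pose h k := t * 2^-1 ^+ k.
have h0 k : 0 < h k by rewrite mulr_gt0 // exprn_gt0.
have hS k : h k.+1 = h k / 2 by rewrite /h exprS mulrCA mulrC.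
have /choice[f fP] : forall p : nat * X, exists z,
    subsums_le (B * nrm p.2) z /\ nrm (p.2 - z) < h p.1.+1.
  by move=> [k y] /=; have [z] := BP y _ (h0 k.+1); exists z.
pose w := fix w k : X := if k is k.+1 then w k + f (k, x - w k) else 0.
have w1 k : nrm (x - w k) <= h k.
  case: k => [|k] /=; first by rewrite subr0 /h expr0 mulr1.
  by have [_ /ltW] := fP (k, x - w k); rewrite /= opprD addrA.
have w2 k n : (k <= n)%N -> subsums_le (2 * B * (h k - h n)) (w n - w k).
  move=> /subnKC <-; elim: (n - k)%N => [|i ih].
    move=> G j; rewrite addn0 !subrr mulr0 /subsum big1 ?nrm0 // => l _.
    exact: proj0.
  rewrite addnS /= addrAC => G j.
  have [bf _] := fP ((k + i)%N, x - w (k + i)%N).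
  apply: le_trans (subsums_leD ih bf G j) _; rewrite hS /=.
  have := ler_wpM2l B0 (w1 (k + i)%N); lra.
have w3 k n : (k <= n)%N -> subsums_le (2 * B * h k) (w n - w k).
  move=> kn G j; apply: le_trans (w2 _ _ kn G j) _.
  by rewrite ler_wpM2l ?mulr_ge0 // gerBl ltW.
have Bh e : 0 < e -> exists N, 2 * B * h N < e.
  move=> e0; rewrite /h; under eq_exists do rewrite mulrA.
  by apply: pow_half_lt => //; rewrite !mulr_ge0 // ltW.
(* the limits z n of the components of w k are an expansion of x *)
have lim1 n : exists l : X, proj n (w k) @[k --> \oo] --> l.
  apply: (nrm_complete (S := S) Bh) => k j kj.
  by have := w3 k j kj (pred1 n) n.+1; rewrite subsum1 projB.
have [z zP] := choice lim1.
have [G [UG Goo]] := ultraFilterLemma (@eventually_filter).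
have PG : ProperFilter G by exact: ultra_proper.
have Ez n : E n (z n).
  have [d [e [fe En]]] := fin_dim_range (uE.1 n); rewrite En.
  apply: (@span_closed _ _ S _ _ _ G UG (fun k => proj n (w k)) _ (2 * B * h 0%N) fe).
  - by move=> k; rewrite -En; exact: proj_in.
  - by move=> k; have := w3 0%N k (leq0n k) (pred1 n) n.+1; rewrite subsum1 subr0.
  - by move=> A /zP; exact: Goo.
have sub_lim H m' : subsum H m' (w k) @[k --> \oo] --> \sum_(0 <= n < m' | H n) z n.
  by apply: cvg_fsum => i _; exact: zP.
have sub_near H m' k :
    nrm (\sum_(0 <= n < m' | H n) z n - subsum H m' (w k)) <= 2 * B * h k.
  have lim : subsum H m' (w j) - subsum H m' (w k) @[j --> \oo] -->
      \sum_(0 <= n < m' | H n) z n - subsum H m' (w k).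
    by apply: cvgB => //; exact: cvg_cst.
  apply: nrm_cvg_le lim _; exists k => // j /= kj; rewrite -subsumB.
  exact: w3.
have zx : series z @ \oo --> x.
  apply/(nrm_cvg S) => e e0.
  have e4 : 0 < e / 4 by rewrite divr_gt0.
  have [N] : exists N, (2 * B + 1) * t * 2^-1 ^+ N < e / 4.
    by apply: pow_half_lt => //; rewrite mulr_ge0 ?addr_ge0 ?mulr_ge0 // ltW.
  rewrite -mulrA -/(h N) mulrDl mul1r => hN.
  have [_ /(nrm_cvg S _)/(_ _ e4) + _ _] := projP (w N).
  apply: filterS => k kN; have := sub_near xpredT k N; have := w1 N.
  move: kN; rewrite -[X in nrm (w N - X)]/(subsum xpredT k (w N)).
  move: (subsum _ _ _) (\sum_(_ <= _ < _) _) => a b h1 h2 h3.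
  have -> : x - b = (x - w N) + (w N - a) - (b - a) by rewrite addrA subrK opprB addrA subrK.
  apply: le_lt_trans (nrmB _ _ _) _.
  have := nrmD S (x - w N) (w N - a); have := h0 N.
  have : 0 <= 2 * B * h N by rewrite !mulr_ge0 // ltW.
  lra.
have zproj := proj_uniq Ez zx.
rewrite /subsum; under eq_bigr do rewrite zproj.
apply: nrm_cvg_le (sub_lim F m) _; exists 0%N => // k _ /=.
have := w2 0%N k (leq0n k) F m; rewrite /= subr0 => /le_trans; apply.
rewrite ler_wpM2l ?mulr_ge0 // /h expr0 mulr1 gerBl ltW //; exact: h0.
Qed.

(** Cut the unit ball of K into L cells of diameter at most 1/2.  A multiplier
    with values in the unit ball is a combination of L of the projections
    [subsum], up to half of another such multiplier; so the supremum s of the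
    norms satisfies s <= L B |x| + s / 2. *)
Lemma multipliers_bounded : exists2 B, 0 <= B &
  forall (l : nat -> K) m x, (forall n, av (l n) <= 1) ->
    nrm (\sum_(0 <= n < m) l n *: proj n x) <= B * nrm x.
Proof.
have [B B0 BP] := projections_bounded.
have h20 : 0 < 2^-1 :> R by rewrite invr_gt0.
have [L [cl clP]] := grid S h20.
(* c i represents the cell i in the unit ball, when they meet *)
have /choice[c cP] : forall i : 'I_L, exists y : K, av y <= 1 /\
    forall z, av z <= 1 -> cl z = i -> cl y = i.
  move=> i; have [[z [z1 zi]]|no] := pselect (exists z, av z <= 1 /\ cl z = i).
    by exists z.
  by exists 0; rewrite av0; split=> // z z1 zi; case: no; exists z.
have c_near z : av z <= 1 -> av (z - c (cl z)) <= 2^-1.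
  move=> z1; have [h1 h2] := cP (cl z); rewrite -av_le; apply: clP.
  - by rewrite -(rmorph1 (emb S)) av_le.
  - by rewrite -(rmorph1 (emb S)) av_le.
  - by rewrite (h2 z).
exists (2 * (L%:R * B)); first by rewrite !mulr_ge0.
move=> l0 m x l01.
pose V := [set r | exists2 l : nat -> K, (forall n, av (l n) <= 1) &
   r = nrm (\sum_(0 <= n < m) l n *: proj n x)].
have V_sup : has_sup V.
  split; first by exists (nrm (\sum_(0 <= n < m) l0 n *: proj n x)), l0.
  exists (\sum_(0 <= n < m) nrm (proj n x)) => _ [l l1 ->].
  apply: le_trans (nrm_sum _ _ _ _) _; apply: ler_sum => n _.
  by rewrite nrmZ -[leRHS]mul1r ler_wpM2r // nrm_ge0.
have step : sup V <= L%:R * B * nrm x + sup V / 2.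
  apply: ge_sup; first by case: V_sup.
  move=> _ [l l1 ->].
  have -> : \sum_(0 <= n < m) l n *: proj n x =
      \sum_(i < L) c i *: subsum (fun n => cl (l n) == i) m x +
      2^-1 *: \sum_(0 <= n < m) (2 * (l n - c (cl (l n)))) *: proj n x.
    have -> : \sum_(i < L) c i *: subsum (fun n => cl (l n) == i) m x =
        \sum_(0 <= n < m) c (cl (l n)) *: proj n x.
      under eq_bigr do rewrite /subsum big_mkcond scaler_sumr.
      rewrite exchange_big; apply: eq_bigr => n _ /=.
      rewrite (bigD1 (cl (l n))) //= eqxx big1 ?addr0 // => i.
      by rewrite eq_sym => /negbTE ->; rewrite scaler0.
    rewrite scaler_sumr -big_split; apply: eq_bigr => n _ /=.
    by rewrite scalerA mulKf ?pnatr_eq0 // -scalerDl addrC subrK.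
  apply: le_trans (nrmD _ _ _) (lerD _ _).
    apply: le_trans (nrm_sum _ _ _ _) _.
    apply: le_trans (_ : \sum_(i < L) B * nrm x <= _).
      apply: ler_sum => i _; rewrite nrmZ; have [ci _] := cP i.
      rewrite -[leRHS]mul1r; apply: ler_pM => //; [exact: av_ge0|exact: nrm_ge0].
    by rewrite sumr_const card_ord -[leLHS]mulr_natl mulrA.
  rewrite nrmZ avV av_nat mulrC ler_wpM2r ?invr_ge0 //.
  apply: ub_le_sup; first by case: V_sup.
  eexists; last by []; move=> n; rewrite avM av_nat -ler_pdivlMl // mulr1.
  exact: c_near.
apply: le_trans (_ : sup V <= _); last lra.
by apply: ub_le_sup; [case: V_sup|exists l0].
Qed.

End ufdd_projections.

(** * Block-diagonal operators on the initial segments of a decomposition *)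

Section direct_sums.
Variables (K : numFieldType) (X : normedModType K).

Lemma fin_dim_add (E F : set X) : fin_dim E -> fin_dim F ->
  (forall x y, E x -> F y -> x + y = 0 -> x = 0 /\ y = 0) ->
  fin_dim [set z | exists x y, [/\ E x, F y & z = x + y]].
Proof.
move=> [d [e [fe ->]]] [d' [f [ff ->]]] direct; exists (d + d')%N.
exists (fun i => match fintype.split i with inl j => e j | inr j => f j end).
have sumE (a : 'I_(d + d') -> K) :
    \sum_(i < d + d') a i *: match fintype.split i with inl j => e j | inr j => f j end =
    \sum_(i < d) a (lshift d' i) *: e i + \sum_(i < d') a (rshift d i) *: f i.
  rewrite big_split_ord; congr (_ + _); apply: eq_bigr => i _.
    by rewrite (unsplitK (inl _ i)).
  by rewrite (unsplitK (inr _ i)).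
split=> [a|].
  rewrite sumE => /direct[||a1 a2].
  - by eexists.
  - by eexists.
  - move=> i; rewrite -(splitK i); case: (fintype.split i) => j /=.
      exact: (fe _ a1).
    exact: (ff _ a2).
apply/seteqP; split=> z.
  move=> [_ [_ [[a _ <-] [b _ <-] ->]]].
  exists (fun i => match fintype.split i with inl j => a j | inr j => b j end) => //.
  rewrite sumE; congr (_ + _); apply: eq_bigr => i _.
    by rewrite (unsplitK (inl _ i)).
  by rewrite (unsplitK (inr _ i)).
move=> [a _ <-]; rewrite sumE.
by do 2 eexists; split; [eexists; [|reflexivity]|eexists; [|reflexivity]|].
Qed.

Lemma fin_dim_zero : fin_dim [set (0 : X)].
Proof.
exists 0%N, (fun=> 0); split=> [? ? []//|].
apply/seteqP; split=> x /=; last by move=> [a _ <-]; rewrite big_ord0.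
by move=> ->; exists (fun=> 0); rewrite ?big_ord0.
Qed.

End direct_sums.

Section coordinates.
Variables (R : realType) (K : numFieldType) (S : scalars R K).
Variables (X : completeNormedModType K) (E : nat -> set X) (uE : ufdd E).
Local Notation iK := (emb S).
Local Notation nrm := (nrm S).
Local Notation av := (av S).

(** Local unconditional structure in coordinates: the lattice is K^D, normed by
    a monotone function rho of the absolute values of the coordinates, so that
    real and complex lattices look the same. *)
Definition coordinate_lust := exists2 C, 0 <= C & forall F : set X, fin_dim F ->
  exists D (al : X -> 'I_D -> K) (be : 'I_D -> X) (rho : ('I_D -> R) -> R),
  [/\ forall s t, rho (fun i => s i + t i) <= rho s + rho t,
      forall (c : R) s, 0 <= c -> rho (fun i => c * s i) <= c * rho s
    & forall s t, (forall i, 0 <= s i <= t i) -> rho s <= rho t] /\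
  [/\ forall z, nrm (lincomb be z) <= rho (fun i => av (z i)),
      forall x, F x -> rho (fun i => av (al x i)) <= C * nrm x,
      forall k x y, F x -> F y -> forall i, al (k *: x + y) i = k * al x i + al y i
    & forall x, F x -> lincomb be (al x) = x].

Definition partial_space m : set X :=
  [set x | exists2 u : nat -> X, (forall n, E n (u n)) & x = \sum_(0 <= n < m) u n].

Lemma fin_dim_partial_space m : fin_dim (partial_space m).
Proof.
elim: m => [|m ih].
  rewrite (_ : partial_space 0 = [set 0]); first exact: fin_dim_zero.
  apply/seteqP; split=> x /=; first by move=> [u _ ->]; rewrite big_geq.
  move=> ->; exists (fun=> 0); last by rewrite big_geq.
  by move=> n; apply: fin_dim0; exact: uE.1.
rewrite (_ : partial_space _ =
  [set z | exists x y, [/\ partial_space m x, E m y & z = x + y]]).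
  apply: fin_dim_add ih (uE.1 m) _ => x y [u Eu ->] Ey /eqP.
  rewrite addr_eq0 => /eqP xy; suff y0 : y = 0 by rewrite xy y0 oppr0.
  have := proj_fsum uE m m Eu.
  by rewrite ltnn xy projN (proj_id uE Ey) eqxx => /eqP; rewrite oppr_eq0 => /eqP.
apply/seteqP; split=> z /=.
  move=> [u Eu ->]; exists (\sum_(0 <= n < m) u n), (u m); split => //.
    by exists u.
  by rewrite big_nat_recr.
move=> [_ [y [[u Eu ->] Ey ->]]].
exists (fun n => if (n < m)%N then u n else if n == m then y else 0).
  move=> n; case: ifP => // _; case: eqP => [->//|_].
  by apply: fin_dim0; exact: uE.1.
rewrite big_nat_recr //= ltnn eqxx; congr (_ + _).
by apply: eq_big_nat => i /andP[_ ->].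
Qed.

Variables (d : nat -> nat) (g : forall n, 'I_(d n) -> X).
Hypothesis g_free : forall n, free_family (@g n).
Hypothesis g_span : forall n, E n = range (lincomb (@g n)).
Hypothesis g_nrm : forall n i, nrm (@g n i) <= 1.
Hypothesis g_coord : forall n a i, av (a i) <= 2 * nrm (lincomb (@g n) a).

Definition vec n (c : 'cV[K]_(d n)) : X := lincomb (@g n) (fun k => c k 0).

Lemma vec_in n c : E n (@vec n c).
Proof. by rewrite g_span; exists (fun k => c k 0). Qed.

Lemma vec_delta n (l : 'I_(d n)) : vec (delta_mx l 0) = g l.
Proof.
rewrite /vec /lincomb (bigD1 l) //= mxE !eqxx scale1r big1 ?addr0 // => i /negbTE il.
by rewrite mxE il scale0r.
Qed.

Lemma vecD n c c' : @vec n (c + c') = vec c + vec c'.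
Proof. by rewrite /vec -lincombD; congr lincomb; apply/funext => k; rewrite mxE. Qed.

Lemma vecZ n k c : @vec n (k *: c) = k *: vec c.
Proof. by rewrite /vec -lincombZ; congr lincomb; apply/funext => i; rewrite mxE. Qed.

Lemma vec0 n : @vec n 0 = 0.
Proof. by rewrite -(scale0r 0) vecZ scale0r. Qed.

Lemma vec_sum n (I : Type) (r : seq I) (P : pred I) (f : I -> 'cV_(d n)) :
  vec (\sum_(i <- r | P i) f i) = \sum_(i <- r | P i) vec (f i).
Proof. exact: (big_morph (@vec n) (@vecD n) (@vec0 n)). Qed.

Lemma vec_inj n : injective (@vec n).
Proof.
move=> c c' /(lincomb_inj (@g_free n)) cc'; apply/colP => k.
by rewrite -[LHS]/((fun k => c k 0) k) cc'.
Qed.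

Definition crd n (x : X) : 'cV[K]_(d n) := xget 0 [set c | vec c = x].

Lemma crdK n x : E n x -> vec (crd n x) = x.
Proof.
rewrite g_span => -[a _ ax]; rewrite /crd; case: xgetP => // /(_ (\col_k a k)) [] /=.
by rewrite -ax /vec; congr lincomb; apply/funext => k; rewrite mxE.
Qed.

Lemma vecK n c : crd n (vec c) = c.
Proof. by apply: vec_inj; rewrite crdK //; exact: vec_in. Qed.

(** The block-diagonal operator with blocks T n, n < m, has norm at most C on
    E_0 + ... + E_(m-1). *)
Definition bdd m (T : forall n, 'M[K]_(d n)) (C : R) := forall c : forall n, 'cV[K]_(d n),
  nrm (\sum_(0 <= n < m) vec (T n *m c n)) <= C * nrm (\sum_(0 <= n < m) vec (c n)).

Lemma bdd_eq m T T' C : (forall n, (n < m)%N -> T n = T' n) -> bdd m T C -> bdd m T' C.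
Proof.
move=> TT' hT c; have := hT c; congr (nrm _ <= _).
by apply: eq_big_nat => i /andP[_ /TT' ->].
Qed.

Lemma bdd_mul m T T' C C' : 0 <= C -> bdd m T C -> bdd m T' C' ->
  bdd m (fun n => T n *m T' n) (C * C').
Proof.
move=> C0 hT hT' c; under eq_bigr do rewrite -mulmxA.
apply: le_trans (hT (fun n => T' n *m c n)) _.
by rewrite -mulrA ler_wpM2l.
Qed.

Lemma bdd_add m T T' C C' : bdd m T C -> bdd m T' C' ->
  bdd m (fun n => T n + T' n) (C + C').
Proof.
move=> hT hT' c; under eq_bigr do rewrite mulmxDl vecD.
rewrite big_split mulrDl; apply: le_trans (nrmD _ _ _) _.
exact: lerD.
Qed.

Lemma bdd0 m : bdd m (fun n => 0) 0.
Proof.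
move=> c; rewrite big1 ?nrm0 ?mul0r // => n _.
by rewrite mul0mx vec0.
Qed.

Lemma bdd_sum m (I : Type) (r : seq I) (P : pred I)
    (T : I -> forall n, 'M[K]_(d n)) (C : I -> R) :
  (forall i, P i -> bdd m (T i) (C i)) ->
  bdd m (fun n => \sum_(i <- r | P i) T i n) (\sum_(i <- r | P i) C i).
Proof.
move=> hT; elim: r => [|i r ih].
  rewrite big_nil; apply: bdd_eq (bdd0 m) => n _; by rewrite big_nil.
rewrite big_cons; case: ifP => Pi.
  by apply: bdd_eq (bdd_add (hT _ Pi) ih) => n _; rewrite big_cons Pi.
by apply: bdd_eq ih => n _; rewrite big_cons Pi.
Qed.

Lemma bdd_le m T C C' : C <= C' -> bdd m T C -> bdd m T C'.
Proof. by move=> CC' hT c; apply: le_trans (hT c) _; rewrite ler_wpM2r // nrm_ge0. Qed.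

Lemma bdd_scalar : exists2 B, 0 <= B & forall m (l : nat -> K) b, 0 <= b ->
  (forall n, av (l n) <= b) -> bdd m (fun n => (l n)%:M) (b * B).
Proof.
have [B B0 BP] := multipliers_bounded S uE; exists B => // m l b b0 lb c.
have [b00|b_neq0] := eqVneq b 0.
  rewrite b00 !mul0r big1 ?nrm0 // => n _.
  have -> : l n = 0 by apply: (av0_eq0 (S := S)); apply/le_anti; rewrite -{1}b00 lb av_ge0.
  by rewrite mul_scalar_mx scale0r vec0.
have {}b0 : 0 < b by rewrite lt_neqAle eq_sym b_neq0.
have bK : iK b != 0 by rewrite fmorph_eq0 gt_eqF.
set x := \sum_(0 <= n < m) vec (c n).
have pn n : (n < m)%N -> proj uE n x = vec (c n).
  by move=> nm; rewrite (proj_fsum uE n m (v := fun n => vec (c n))) ?nm // => k; exact: vec_in.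
have -> : \sum_(0 <= n < m) vec ((l n)%:M *m c n) =
   iK b *: \sum_(0 <= n < m) ((iK b)^-1 * l n) *: proj uE n x.
  rewrite scaler_sumr; apply: eq_big_nat => n /andP[_ nm].
  by rewrite mul_scalar_mx vecZ pn // scalerA mulVKf.
rewrite nrmZ av_emb gtr0_norm // -mulrA ler_wpM2l ?(ltW b0) //.
apply: BP => n; rewrite avM avV av_emb gtr0_norm // mulrC ler_pdivrMr // mul1r.
exact: lb.
Qed.

(** Apply the operator to the basis vector g l and read off the coordinate k;
    the factor 2 is that of the near-Auerbach basis. *)
Lemma bdd_entry m T C n k l : 0 <= C -> bdd m T C -> (n < m)%N -> av (T n k l) <= 2 * C.
Proof.
move=> C0 hT nm.
pose c j : 'cV[K]_(d j) := crd j (if j == n then g l else 0).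
have cn : c n = delta_mx l 0.
  by rewrite /c eqxx -vec_delta vecK.
have cj j : j != n -> c j = 0.
  move=> jn; apply: vec_inj; rewrite vec0 crdK (negbTE jn) //.
  by apply: fin_dim0; exact: uE.1.
have only (f : forall j, 'cV[K]_(d j)) : (forall j, j != n -> f j = 0) ->
    \sum_(0 <= j < m) vec (f j) = vec (f n).
  move=> f0; rewrite big_mkord (bigD1 (Ordinal nm)) //= big1 ?addr0 // => i.
  by rewrite -val_eqE => /f0 -> ; rewrite vec0.
have := hT c; rewrite (only c cj) (only (fun j => T j *m c j)); last first.
  by move=> j /cj ->; rewrite mulmx0.
rewrite cn vec_delta.
rewrite -colE => h.
have := @g_coord n (fun k => col l (T n) k 0) k; rewrite mxE => /le_trans; apply.
rewrite ler_pM2l //; apply: le_trans h _.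
by rewrite -[leRHS]mulr1 ler_wpM2l.
Qed.

End coordinates.

(** * Bounded multipliers from a factorization through a lattice *)

Section lust_multipliers.
Variables (R : realType) (K : numFieldType) (S : scalars R K).
Variables (X : completeNormedModType K) (E : nat -> set X) (uE : ufdd E).
Local Notation nrm := (nrm S).
Local Notation av := (av S).
Variables (d : nat -> nat) (g : forall n, 'I_(d n) -> X).
Hypothesis g_free : forall n, free_family (@g n).
Hypothesis g_span : forall n, E n = range (lincomb (@g n)).

Local Notation vec := (vec g).
Local Notation crd := (crd g).

(** Signs of the first m blocks, extended by 0 to a multiplier. *)
Let signs m (e : {ffun 'I_m -> bool}) (n : nat) : K :=
  if insub n is Some i then (-1) ^+ (e i) else 0.

Let signs_le1 m e n : av (@signs m e n) <= 1.
Proof. by rewrite /signs; case: insubP => [i _ _|_]; rewrite ?av_sign ?av0. Qed.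

Let signs_ord m e (n : 'I_m) : @signs m e n = (-1) ^+ (e n).
Proof. by rewrite /signs valK. Qed.

Let signs_sum m (e : {ffun 'I_m -> bool}) (f : nat -> X) :
  \sum_(0 <= n < m) signs e n *: f n = \sum_(n < m) (-1) ^+ (e n) *: f n.
Proof. by rewrite big_mkord; apply: eq_bigr => n _; rewrite signs_ord. Qed.

(** The square function argument.  Given x = sum_n x_n, let h_i be a function of
    the signs whose n-th Rademacher coefficient is theta_(n,i) alpha_i(x_n) and
    which is bounded by the mean of |alpha_i(sum_n e_n x_n)|, up to a constant.
    The operator with blocks sum_i theta_(n,i) M_(n,i) maps x to the mean over
    the signs e of the multiplier e applied to y(e) = sum_i h_i(e) beta_i.  Now
    y(e) is bounded by rho, which is monotone and sublinear, and the vectors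
    sum_n e_n x_n are bounded by unconditionality. *)
Lemma lust_multipliers : coordinate_lust S X -> exists2 C, 0 <= C & forall m,
  exists D (M : forall n, 'I_D -> 'M[K]_(d n)),
  [/\ forall n i, exists (b : 'cV[K]_(d n)) (a : 'rV[K]_(d n)), M n i = b *m a,
      forall n, (n < m)%N -> \sum_i M n i = 1%:M
    & forall th : nat -> 'I_D -> K, (forall n i, av (th n i) <= 1) ->
        bdd S g m (fun n => \sum_i th n i *: M n i) C].
Proof.
move=> [C C0 lustC].
have [c [c0 radem]] := rademacher S.
have [B B0 BP] := multipliers_bounded S uE.
exists (B * (c * (C * B))); first by rewrite !mulr_ge0.
move=> m.
have [D [al [be [rho [[rhoD rhoZ rho_le] [be_rho al_rho al_lin al_be]]]]]] :=
  lustC _ (fin_dim_partial_space uE m).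
pose M n i : 'M[K]_(d n) := crd n (proj uE n (be i)) *m (\row_l al (g l) i).
(* M n i is the block in E n of the rank-one operator be i * al i *)
have En_partial n x : (n < m)%N -> E n x -> partial_space E m x.
  move=> nm Ex; exists (fun k => if k == n then x else 0).
    by move=> k; case: eqP => [->//|_]; apply: fin_dim0; exact: uE.1.
  by rewrite big_mkord (bigD1 (Ordinal nm)) //= eqxx big1 ?addr0 // => k;
    rewrite -val_eqE => /negbTE ->.
have fp := fin_dim_partial_space uE m.
have al0 i : al 0 i = 0.
  have := al_lin 1 0 0 (fin_dim0 fp) (fin_dim0 fp) i.
  by rewrite scaler0 addr0 mul1r => /eqP; rewrite -subr_eq subrr eq_sym => /eqP.
have al_comb i (I : Type) (r : seq I) (k : I -> K) (f : I -> X) :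
    (forall j, partial_space E m (f j)) ->
    al (\sum_(j <- r) k j *: f j) i = \sum_(j <- r) k j * al (f j) i.
  move=> Ef; elim: r => [|j r ih]; first by rewrite !big_nil.
  rewrite !big_cons al_lin ?ih //; apply: fin_dim_sum => // l _.
  by apply: fin_dimZ.
have g_in n (l : 'I_(d n)) : E n (g l) by rewrite -vec_delta; exact: vec_in.
have M_vec n i cc : (n < m)%N -> vec (M n i *m cc) = al (vec cc) i *: proj uE n (be i).
  move=> nm.
  have -> : al (vec cc) i = \sum_l cc l 0 * al (g l) i.
    by apply: al_comb => l; apply: En_partial nm (g_in n l).
  have -> : M n i *m cc = (\sum_l cc l 0 * al (g l) i) *: crd n (proj uE n (be i)).
    rewrite /M -mulmxA [X in _ *m X]mx11_scalar mul_mx_scalar; congr (_ *: _).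
    by rewrite !mxE; apply: eq_bigr => l _; rewrite mxE mulrC.
  by rewrite vecZ (crdK g_span) //; exact: proj_in.
have vecE n (cc : 'cV[K]_(d n)) : E n (vec cc) by exact: vec_in.
exists D, M; split=> [n i|n nm|th th1 cc]; first by do 2 eexists.
  apply/matrixP => k l; rewrite -[LHS]mulr1 -[RHS]mulr1.
  have : (\sum_i M n i) *m delta_mx l (0 : 'I_1) = delta_mx l 0.
    apply: (vec_inj g_free); rewrite mulmx_suml vec_sum.
    under eq_bigr do rewrite M_vec // -projZ.
    rewrite -proj_sum -/(lincomb _ _) al_be; last exact: (En_partial n).
    by rewrite (proj_id uE (vecE _ _)) eqxx.
  by rewrite -colE -[X in _ = X](mul1mx) -colE => /colP/(_ k); rewrite !mxE !mulr1.
set x := \sum_(0 <= n < m) vec (cc n).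
have px n : (n < m)%N -> proj uE n x = vec (cc n).
  by move=> nm; rewrite (proj_fsum uE n m (v := fun n => vec (cc n))) ?nm.
have /choice[h hP] : forall i, exists gi : {ffun 'I_m -> bool} -> K,
   (forall n, (2 ^ m)%:R^-1 * \sum_(e : {ffun 'I_m -> bool}) (-1) ^+ (e n) * gi e =
        th n i * al (vec (cc n)) i) /\
   (forall e, av (gi e) <= c * ((2 ^ m)%:R^-1 * \sum_(e' : {ffun 'I_m -> bool})
        av (\sum_(n < m) (-1) ^+ (e' n) * al (vec (cc n)) i))).
  move=> i.
  have [|gi [gi1 gi2]] := radem m (fun n => th n i * al (vec (cc n)) i)
     (fun n => al (vec (cc n)) i).
    move=> n; rewrite (av_le_av S) avM -[leRHS]mul1r ler_wpM2r //; exact: av_ge0.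
  exists gi; split=> // e; rewrite -av_le; apply: le_trans (gi2 e) _.
  rewrite rmorphM /= rmorphM /= fmorphV rmorph_nat rmorph_sum /=.
  by rewrite [X in _ <= _ * (_ * X)](eq_bigr _ (fun e _ => emb_av S _)).
pose y e := \sum_i h i e *: be i.
have -> : \sum_(0 <= n < m) vec ((\sum_i th n i *: M n i) *m cc n) =
   (2 ^ m)%:R^-1 *: \sum_e \sum_(0 <= n < m) signs e n *: proj uE n (y e).
  under [in RHS]eq_bigr do rewrite signs_sum.
  rewrite exchange_big big_mkord scaler_sumr; apply: eq_bigr => n _ /=.
  rewrite mulmx_suml vec_sum.
  under [LHS]eq_bigr do rewrite -scalemxAl vecZ M_vec // scalerA -(hP _).1.
  under [in RHS]eq_bigr do rewrite proj_sum scaler_sumr.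
  rewrite exchange_big scaler_sumr; apply: eq_bigr => i _ /=.
  rewrite -scalerA scaler_suml; congr (_ *: _); apply: eq_bigr => e _.
  by rewrite projZ scalerA.
have two0 : 0 < (2 ^ m)%:R :> R by rewrite ltr0n expn_gt0.
have avg (f : {ffun 'I_m -> bool} -> R) b : (forall e, f e <= b) ->
    (2 ^ m)%:R^-1 * \sum_e f e <= b.
  move=> fb; rewrite mulrC ler_pdivrMr // mulrC.
  apply: le_trans (ler_sum _ (fun e _ => fb e)) _.
  by rewrite sumr_const card_ffun card_bool card_ord mulr_natl.
rewrite nrmZ avV av_nat.
apply: le_trans (_ : (2 ^ m)%:R^-1 * \sum_e B * nrm (y e) <= _).
  rewrite ler_wpM2l ?invr_ge0 ?(ltW two0) //; apply: le_trans (nrm_sum _ _ _ _) _.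
  by apply: ler_sum => e _; apply: BP.
apply: (avg) => e; rewrite -mulrA ler_wpM2l //.
apply: le_trans (be_rho _) _.
have rho0 : rho (fun=> 0) <= 0.
  by have := rhoZ 0 (fun=> 0) (lexx 0); rewrite !mul0r.
have rho_sum (I : Type) (r : seq I) (f : I -> 'I_D -> R) :
    rho (fun i => \sum_(j <- r) f j i) <= \sum_(j <- r) rho (f j).
  elim: r => [|j r ih].
    by rewrite big_nil; under eq_fun do rewrite big_nil.
  rewrite big_cons; under eq_fun do rewrite big_cons.
  by apply: le_trans (rhoD _ _) _; rewrite lerD2l.
apply: le_trans (rho_le _ _ (fun i => _)) _; last first.
  apply: le_trans (rhoZ c (fun i => (2 ^ m)%:R^-1 * \sum_(e' : {ffun 'I_m -> bool})
        av (\sum_(n < m) (-1) ^+ (e' n) * al (vec (cc n)) i)) c0) _.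
  rewrite -mulrA ler_wpM2l //.
  apply: le_trans (rhoZ _ _ _) _; first by rewrite invr_ge0 ltW.
  apply: le_trans (_ : (2 ^ m)%:R^-1 * \sum_(e' : {ffun 'I_m -> bool})
     rho (fun i => av (\sum_(n < m) (-1) ^+ (e' n) * al (vec (cc n)) i)) <= _).
    by rewrite ler_wpM2l ?invr_ge0 ?(ltW two0).
  apply: (avg) => e'.
  have -> : (fun i => av (\sum_(n < m) (-1) ^+ (e' n) * al (vec (cc n)) i)) =
     (fun i => av (al (\sum_(0 <= n < m) signs e' n *: proj uE n x) i)).
    apply/funext => i; rewrite signs_sum; congr av; rewrite al_comb.
      by apply: eq_bigr => n _; rewrite px.
    by move=> n; apply: (En_partial n) => //; exact: proj_in.
  apply: le_trans (al_rho _ _) _.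
    by exists (fun n => signs e' n *: proj uE n x) => // n; apply: fin_dimZ (uE.1 n) _;
      exact: proj_in.
  by rewrite -mulrA ler_wpM2l //; exact: BP.
by move=> i /=; rewrite av_ge0 (hP i).2.
Qed.

End lust_multipliers.

(** * Idempotents, characteristic polynomials and entrywise limits *)

Section idempotents.
Variable (K : numFieldType).

(** In a rank factorization P = C W of an idempotent, W C is an identity
    matrix whose size is the rank. *)
Lemma idem_trace d (P : 'M[K]_d) : P *m P = P -> \tr P = (\rank P)%:R.
Proof.
move=> PP.
have CW : row_base P *m col_base P = 1%:M.
  apply: (row_free_inj (row_base_free P)); apply: (row_full_inj (col_base_full P)).
  by rewrite mul1mx -mulmxA mulmx_base mulmxA mulmx_base PP.
by rewrite -{1}[P]mulmx_base mxtrace_mulC CW mxtrace1.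
Qed.

Lemma idem_trace0 d (P : 'M[K]_d) : P *m P = P -> \tr P = 0 -> P = 0.
Proof.
move=> /idem_trace -> /eqP; rewrite pnatr_eq0 => r0.
by apply/eqP; rewrite -mxrank_eq0.
Qed.

(** The determinant of X - b a is evaluated through the two Schur complements of
    a bordered matrix with corners 1 and X. *)
Lemma char_poly_rank1 d (b : 'cV[K]_d) (a : 'rV[K]_d) : (0 < d)%N ->
  char_poly (b *m a) = 'X^d - \tr (b *m a) *: 'X^(d.-1).
Proof.
move=> d0.
pose b' := map_mx polyC b; pose a' := map_mx polyC a.
have -> : char_poly (b *m a) = \det ('X%:M - b' *m a').
  by rewrite /char_poly /char_poly_mx map_mxM.
have abE : a' *m b' = (\tr (b *m a))%:P%:M.
  rewrite mxtrace_mulC /mxtrace big_ord1 -map_mxM [LHS]mx11_scalar mxE.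
  by congr (_ %:P%:M).
pose B := block_mx (1%:M : 'M[{poly K}]_1) a' b' ('X%:M : 'M[{poly K}]_d).
have e1 : \det B = \det ('X%:M - b' *m a').
  have -> : B = block_mx (1%:M : 'M[{poly K}]_1) 0 b' (1%:M : 'M[{poly K}]_d) *m
      block_mx (1%:M : 'M[{poly K}]_1) a' 0 ('X%:M - b' *m a').
    rewrite mulmx_block !(mul1mx, mulmx1, mul0mx, mulmx0, addr0).
    by rewrite addrC subrK.
  by rewrite det_mulmx det_lblock det_ublock !det1 !mul1r.
have e2 : \det B * 'X = ('X - (\tr (b *m a))%:P) * 'X^d.
  have e3 : \det (block_mx ('X%:M : 'M[{poly K}]_1) 0 (- b') (1%:M : 'M[{poly K}]_d)) =
      'X :> {poly K}.
    by rewrite det_lblock det1 mulr1 det_scalar1.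
  rewrite -[X in _ * X = _]e3 -det_mulmx mulmx_block.
  rewrite !(mul1mx, mulmx1, mul0mx, mulmx0, addr0, add0r).
  rewrite mulmxN abE mul_mx_scalar mul_scalar_mx scalerN subrr -raddfB /=.
  by rewrite det_ublock det_scalar1 det_scalar.
rewrite -e1; apply: (mulIf (x := 'X)); first by rewrite polyX_eq0.
rewrite e2 !mulrBl -exprS -exprSr; congr (_ - _).
by rewrite -scalerAl -exprSr prednK // mul_polyC.
Qed.

End idempotents.

Section entrywise_limits.
Variables (K : numFieldType) (G : set_system nat) (PG : ProperFilter G).

Definition pcvg (p : nat -> {poly K}) (q : {poly K}) :=
  forall i, (fun k => (p k)`_i) k @[k --> G] --> q`_i.

Lemma pcvg_cst p : pcvg (fun=> p) p.
Proof. by move=> i; exact: cvg_cst. Qed.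

Lemma pcvgM p q p' q' : pcvg p p' -> pcvg q q' -> pcvg (fun k => p k * q k) (p' * q').
Proof.
move=> hp hq i; rewrite coefM; under eq_fun do rewrite coefM.
by apply: (@cvg_fsum _ K^o) => j _; apply: cvgM; [exact: hp|exact: hq].
Qed.

Lemma pcvg_sum (I : Type) (r : seq I) (P : pred I) (p : I -> nat -> {poly K}) q :
  (forall i, P i -> pcvg (p i) (q i)) ->
  pcvg (fun k => \sum_(i <- r | P i) p i k) (\sum_(i <- r | P i) q i).
Proof.
move=> h j; rewrite coef_sum; under eq_fun do rewrite coef_sum.
by apply: (@cvg_fsum _ K^o) => i Pi; exact: h.
Qed.

Lemma pcvg_prod (I : Type) (r : seq I) (P : pred I) (p : I -> nat -> {poly K}) q :
  (forall i, P i -> pcvg (p i) (q i)) ->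
  pcvg (fun k => \prod_(i <- r | P i) p i k) (\prod_(i <- r | P i) q i).
Proof.
move=> h; elim: r => [|i r ih].
  by under [X in pcvg X]eq_fun do rewrite big_nil; rewrite big_nil; exact: pcvg_cst.
rewrite big_cons; under [X in pcvg X]eq_fun do rewrite big_cons.
by case: ifP => // Pi; apply: pcvgM => //; exact: h.
Qed.

Definition mcvg m n (A : nat -> 'M[K]_(m, n)) (L : 'M[K]_(m, n)) :=
  forall i j, A k i j @[k --> G] --> L i j.

Lemma mcvgM m n p (A : nat -> 'M[K]_(m, n)) (B : nat -> 'M[K]_(n, p)) A' B' :
  mcvg A A' -> mcvg B B' -> mcvg (fun k => A k *m B k) (A' *m B').
Proof.
move=> hA hB i j; rewrite mxE; under eq_fun do rewrite mxE.
by apply: (@cvg_fsum _ K^o) => l _; apply: cvgM; [exact: hA|exact: hB].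
Qed.

Lemma mcvgX n (A : nat -> 'M[K]_n) A' i :
  mcvg A A' -> mcvg (fun k => A k ^+ i) (A' ^+ i).
Proof.
move=> hA; elim: i => [|i ih]; first by move=> ? ?; exact: cvg_cst.
rewrite exprS; under [X in mcvg X]eq_fun do rewrite exprS.
exact: mcvgM.
Qed.

Lemma mcvg_trace n (A : nat -> 'M[K]_n) A' :
  mcvg A A' -> \tr (A k) @[k --> G] --> \tr A'.
Proof. by move=> hA; apply: (@cvg_fsum _ K^o) => i _; exact: hA. Qed.

Lemma pcvg_char_poly n (A : nat -> 'M[K]_n) A' :
  mcvg A A' -> pcvg (fun k => char_poly (A k)) (char_poly A').
Proof.
move=> hA; rewrite /char_poly /determinant; apply: pcvg_sum => s _.
apply: pcvgM; first exact: pcvg_cst.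
apply: pcvg_prod => i _ j; rewrite !mxE !coefB !coefMn !coefC.
under eq_fun do rewrite !mxE coefB coefMn coefC.
apply: cvgB; first exact: cvg_cst.
by case: eqP => _; [exact: hA|exact: cvg_cst].
Qed.

Lemma pcvg_horner (p : nat -> {poly K}) q (x : nat -> K) y N :
  pcvg p q -> (size q <= N)%N -> (forall k, (size (p k) <= N)%N) ->
  x k @[k --> G] --> y -> (p k).[x k] @[k --> G] --> q.[y].
Proof.
move=> hp hq pN xy; rewrite (horner_coef_wide _ hq).
under eq_fun do rewrite (horner_coef_wide _ (pN _)).
apply: (@cvg_fsum _ K^o) => i _; apply: cvgM; first exact: hp.
by elim: (nat_of_ord i) => [|j ih];
  [exact: cvg_cst|rewrite exprS; under eq_fun do rewrite exprS; apply: cvgM].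
Qed.

End entrywise_limits.

Section eigenprojection.
Variable (K : numFieldType).

Lemma horner_mx_wide n (A : 'M[K]_n.+1) (q : {poly K}) N : (size q <= N)%N ->
  horner_mx A q = \sum_(i < N) q`_i *: A ^+ i.
Proof.
move=> qN; rewrite -{1}(coefK q) poly_def raddf_sum /=.
rewrite (big_ord_widen _ (fun i => horner_mx A (q`_i *: 'X^i)) qN) big_mkcond.
apply: eq_bigr => i _; rewrite linearZ /= rmorphXn /= horner_mx_X.
by case: ltnP => // /leq_sizeP-> //; rewrite scale0r.
Qed.

(** By Cayley-Hamilton q(A) is annihilated by A - l, so a polynomial p(A) acts
    on q(A) as the scalar p(l); in particular q(A) q(A) = q(l) q(A). *)
Lemma eigenprojection n (A : 'M[K]_n.+1) (q : {poly K}) (l : K) :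
  char_poly A = q * ('X - l%:P) -> q.[l] != 0 ->
  let Q := horner_mx A (q.[l]^-1 *: q) in Q *m Q = Q /\ A *m Q = l *: Q.
Proof.
move=> Aq ql Q.
have AQ0 : horner_mx A ('X - l%:P) *m horner_mx A q = 0.
  by have := Cayley_Hamilton A; rewrite Aq mulrC rmorphM.
have AQ : A *m horner_mx A q = l *: horner_mx A q.
  apply/eqP; rewrite -subr_eq0 -mul_scalar_mx -mulmxBl; apply/eqP.
  by rewrite -[RHS]AQ0 rmorphB /= horner_mx_X horner_mx_C.
have pQ p : horner_mx A p *m horner_mx A q = p.[l] *: horner_mx A q.
  have : root (p - p.[l]%:P) l by rewrite /root !hornerE subrr.
  move=> /factor_theorem[p1 hp].
  rewrite -(subrK (p.[l])%:P p) hp rmorphD /= mulmxDl horner_mx_C mul_scalar_mx.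
  by rewrite rmorphM /= -mulmxE -mulmxA AQ0 mulmx0 add0r !hornerE subrr mulr0 add0r.
split; rewrite /Q linearZ /=.
  by rewrite -scalemxAl -scalemxAr pQ (scalerA _ q.[l]) mulVf // scale1r.
by rewrite -scalemxAr AQ scalerA mulrC -scalerA.
Qed.

End eigenprojection.

(** * The eigenprojection of a matrix close to one of rank one *)

Section near_rank_one.
Variables (R : realType) (K : numFieldType) (S : scalars R K).
Local Notation av := (av S).

Lemma trace_rank1_pow n (M : 'M[K]_n.+1) (b : 'cV[K]_n.+1) (a : 'rV[K]_n.+1) :
  M = b *m a -> \tr (M ^+ n) = (\tr M) ^+ n.
Proof.
move=> Mba.
have MM : M * M = \tr M *: M.
  rewrite -mulmxE Mba mxtrace_mulC -mulmxA [in LHS](mulmxA a b a) {1}[a *m b]mx11_scalar.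
  by rewrite mul_scalar_mx -scalemxAr /mxtrace big_ord1.
case: n M b a Mba MM => [|n] M b a _ MM; first by rewrite !expr0 mxtrace1.
have pw k : M ^+ k.+1 = (\tr M) ^+ k *: M.
  elim: k => [|k ih]; first by rewrite expr1 expr0 scale1r.
  by rewrite exprS ih -scalerAr MM scalerA -exprSr.
by rewrite pw mxtraceZ -exprSr.
Qed.

Lemma near_cvg (G : set_system nat) {FG : Filter G} (f g : nat -> K) (l : K) :
  (\forall k \near G, f k = g k) -> g k @[k --> G] --> l -> f k @[k --> G] --> l.
Proof.
move=> fg /(av_cvg S) gl; apply/(av_cvg S) => e e0.
by apply: filterS2 fg (gl e e0) => k ->.
Qed.

Lemma cvgKX (G : set_system nat) {FG : Filter G} (f : nat -> K) (l : K) n :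
  f k @[k --> G] --> l -> (fun k => f k ^+ n) k @[k --> G] --> l ^+ n.
Proof.
move=> fl; elim: n => [|j ih]; first exact: cvg_cst.
by rewrite exprS; under eq_fun do rewrite exprS; apply: cvgM.
Qed.

Lemma cvgK_unique (G : set_system nat) (PG : ProperFilter G) (f : nat -> K) (l l' : K) :
  f k @[k --> G] --> l -> f k @[k --> G] --> l' -> l = l'.
Proof.
move=> h1 h2; apply: cvg_unique h1 h2; exact: norm_hausdorff.
Qed.

(** By compactness it is enough to look at matrices A_k, closer and closer to
    matrices M_k of rank one, with a common limit L.  Then the characteristic
    polynomials tend to X^n (X - t), where t, the limit of the traces, is not 0;
    A_k has an eigenvalue l_k tending to t; the quotients q_k of the
    characteristic polynomials by X - l_k tend to X^n, and q_k(l_k) to t^n.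
    Hence the eigenprojections q_k(A_k) / q_k(l_k) are defined, with bounded
    coefficients.  Their traces tend to 1, and they are natural numbers. *)
Lemma near_rank1_projection n (kap : R) : 0 < kap -> exists2 eps, 0 < eps &
  exists2 B, 0 <= B & forall (M A : 'M[K]_n.+1) (b : 'cV_n.+1) (a : 'rV_n.+1),
    M = b *m a -> (forall i j, av (M i j) <= 1) -> kap <= av (\tr M) ->
    (forall i j, av (A i j - M i j) <= eps) ->
    exists (q : {poly K}) (l : K),
      [/\ (size q <= n.+1)%N, forall i, av q`_i <= B & l != 0] /\
      let Q := horner_mx A q in [/\ Q *m Q = Q, A *m Q = l *: Q & \tr Q = 1].
Proof.
move=> kap0; apply: contrapT => no.
pose good (A : 'M[K]_n.+1) (B : R) (q : {poly K}) (l : K) :=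
      [/\ (size q <= n.+1)%N, forall i, av q`_i <= B & l != 0] /\
      let Q := horner_mx A q in [/\ Q *m Q = Q, A *m Q = l *: Q & \tr Q = 1].
have /choice[f fP] : forall k : nat, exists t : 'M[K]_n.+1 * 'M[K]_n.+1,
    [/\ exists b : 'cV_n.+1, exists a : 'rV_n.+1, t.1 = b *m a,
      forall i j, av (t.1 i j) <= 1, kap <= av (\tr t.1),
      forall i j, av (t.2 i j - t.1 i j) <= k.+1%:R^-1 &
      ~ exists q l, good t.2 k%:R q l].
  move=> k; apply: contrapT => noT; apply: no; exists k.+1%:R^-1.
    by rewrite invr_gt0.
  exists k%:R => // M A b a Mba M1 kM AM; apply: contrapT => nq; apply: noT.
  by exists (M, A); split => //; exists b, a.
pose M k := (f k).1; pose A k := (f k).2.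
have M_rank1 k : exists b : 'cV_n.+1, exists a : 'rV_n.+1, M k = b *m a by case: (fP k).
have M_le1 i j k : av (M k i j) <= 1 by case: (fP k).
have M_kap k : kap <= av (\tr (M k)) by case: (fP k).
have A_near i j k : av (A k i j - M k i j) <= k.+1%:R^-1 by case: (fP k).
have A_bad k : ~ exists q l, good (A k) k%:R q l by case: (fP k).
have [G [UG Goo]] := ultraFilterLemma (@eventually_filter).
have PG : ProperFilter G by exact: ultra_proper.
have /choice[L0 L0P] : forall ij : 'I_n.+1 * 'I_n.+1, exists l : K,
    M k ij.1 ij.2 @[k --> G] --> l.
  by move=> [i j]; apply: (av_ultra_cvg UG (M_le1 i j)).
pose L := \matrix_(i, j) L0 (i, j).
have ML : mcvg G M L by move=> i j; rewrite mxE; exact: (L0P (i, j)).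
have AL : mcvg G A L.
  move=> i j; rewrite -[L i j]addr0.
  rewrite (_ : (fun k => _) = (fun k => M k i j + (A k i j - M k i j))); last first.
    by apply/funext => k; rewrite addrC subrK.
  apply: cvgD; first exact: ML.
  apply/(av_cvg S) => e e0.
  have : \forall k \near \oo, e^-1 < (k%:R : R) by exact: nbhs_infty_gtr.
  move/Goo; apply: filterS => k ek; rewrite sub0r avN.
  apply: le_lt_trans (A_near _ _ _) _.
  rewrite invf_plt ?posrE //; apply: lt_trans ek _.
  by rewrite ltr_nat.
pose t := \tr L.
have trM : \tr (M k) @[k --> G] --> t by exact: mcvg_trace.
have t_kap : kap <= av t.
  rewrite leNgt; apply/negP => tk.
  have e0 : 0 < kap - av t by rewrite subr_gt0.
  have /(av_cvg S _)/(_ _ e0)/filter_ex[k] := trM.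
  have := M_kap k; have := avB S t (t - \tr (M k)).
  by rewrite opprB addrC subrK; lra.
have t0 : t != 0.
  by apply: contraTneq t_kap => ->; rewrite av0 -ltNge.
have chiE : forall i, (char_poly L)`_i = ('X^(n.+1) - t *: 'X^n)`_i.
  move=> i; have h : (fun k => (char_poly (M k))`_i) k @[k --> G] --> (char_poly L)`_i.
    exact: (pcvg_char_poly PG ML).
  apply: (cvgK_unique PG h).
  under eq_fun.
    move=> k; have [b [a Mba]] := M_rank1 k.
    rewrite Mba char_poly_rank1 // -Mba coefB coefZ; over.
  rewrite coefB coefZ; apply: cvgB; first exact: cvg_cst.
  by apply: cvgM => //; exact: cvg_cst.
have chi_cvg : pcvg G (fun k => char_poly (A k)) (char_poly L) by exact: pcvg_char_poly.
have : \forall k \near G, exists l, root (char_poly (A k)) l /\ `|l - t| <= `|t| / 2.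
  apply: (root_near S (d := n.+1)) => //.
    by move=> k; rewrite char_poly_monic size_char_poly.
  by move=> i; rewrite -chiE; exact: chi_cvg.
move=> near_root.
(* lam k is a nearby eigenvalue of A k if there is one, and t otherwise *)
have /choice[lam lamP] : forall k, exists l, av (l - t) <= av t /\
   ((exists l, root (char_poly (A k)) l /\ `|l - t| <= `|t| / 2) ->
     root (char_poly (A k)) l /\ av (l - t) <= av t / 2).
  move=> k; have [[l [h1 h2]]|no_root] := pselect (exists l,
     root (char_poly (A k)) l /\ `|l - t| <= `|t| / 2); last first.
    by exists t; rewrite subrr av0 av_ge0; split => // /no_root.
  have h3 : av (l - t) <= av t / 2.
    by rewrite -av_le rmorphM fmorphV rmorph_nat /= emb_av.
  exists l; split => //; apply: le_trans h3 _.
  by have := av_ge0 S t; lra.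
have near_good : \forall k \near G, root (char_poly (A k)) (lam k) /\ av (lam k - t) <= av t / 2.
  by apply: filterS near_root => k; exact: (lamP k).2.
have lam_b k : av (lam k) <= 2 * av t.
  rewrite -(subrK t (lam k)); apply: le_trans (avD _ _ _) _.
  by have [h _] := lamP k; lra.
have [l lam_l] := av_ultra_cvg UG lam_b.
(* l is a root of X^n (X - t), and it is not 0 as |l - t| <= |t| / 2 *)
have lt : l = t.
  have l_near : av (l - t) <= av t / 2.
    have : lam k - t @[k --> G] --> l - t by apply: cvgB => //; exact: cvg_cst.
    by move/av_cvg_le; apply; apply: filterS near_good => k [].
  have root_l : (char_poly L).[l] = 0.
    have h : (char_poly (A k)).[lam k] @[k --> G] --> (char_poly L).[l].
      by apply: (@pcvg_horner _ _ PG _ _ _ _ n.+2) => // [|k]; rewrite size_char_poly.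
    apply: (cvgK_unique PG h).
    apply: (near_cvg (g := fun=> 0)); last exact: cvg_cst.
    apply: filterS near_good => k [+ _].
    by move/rootP.
  move: root_l; rewrite (_ : char_poly L = 'X^(n.+1) - t *: 'X^n); last exact/polyP.
  rewrite !hornerE exprS -mulrBl => /eqP; rewrite mulf_eq0 expf_eq0 => /orP[|/andP[_ /eqP l0]].
    by rewrite subr_eq0 => /eqP.
  by exfalso; move: l_near; rewrite l0 sub0r avN; have := av_gt0 S t0; lra.
pose q k := char_poly (A k) %/ ('X - (lam k)%:P).
have q_size k : size (q k) = n.+1.
  by rewrite size_divp ?polyXsubC_eq0 // size_char_poly size_XsubC subn1.
have q_chi : \forall k \near G, char_poly (A k) = q k * ('X - (lam k)%:P).
  by apply: filterS near_good => k [+ _]; rewrite -dvdp_XsubCl => /divpK.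
have q_cvg : pcvg G q 'X^n.
  have big i : (n < i)%N -> (fun k => (q k)`_i) k @[k --> G] --> ('X^n : {poly K})`_i.
    move=> ni; rewrite coefXn gtn_eqF //.
    under eq_fun do rewrite nth_default ?q_size //.
    exact: cvg_cst.
  suff h j i : (n < i + j)%N ->
      (fun k => (q k)`_i) k @[k --> G] --> ('X^n : {poly K})`_i.
    by move=> i; apply: (h n.+1); rewrite addnS ltnS leq_addl.
  (* comparing coefficients in q (X - lam) determines those of q from the top *)
  elim: j i => [|j ih] i ij; first by apply: big; rewrite addn0 in ij.
  have [/big//|i_n] := ltnP n i.
  have -> : ('X^n : {poly K})`_i = (char_poly L)`_i.+1 + l * ('X^n : {poly K})`_i.+1.
    by rewrite chiE coefB coefZ !coefXn eqSS lt subrK.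
  have near_rec : \forall k \near G, (q k)`_i = (char_poly (A k))`_i.+1 + lam k * (q k)`_i.+1.
    apply: filterS q_chi => k ->; rewrite mulrBr coefB coefMX /= coefMC.
    by rewrite mulrC subrK.
  apply: near_cvg near_rec _; apply: cvgD; first exact: chi_cvg.
  by apply: cvgM => //; apply: ih; rewrite addSnnS.
have ql_cvg : (q k).[lam k] @[k --> G] --> t ^+ n.
  rewrite -lt -hornerXn.
  by apply: (@pcvg_horner _ _ PG _ _ _ _ n.+1) => // [|k]; rewrite ?size_polyXn ?q_size.
have tn0 : t ^+ n != 0 by rewrite expf_neq0.
have ql0 : \forall k \near G, (q k).[lam k] != 0.
  have /(av_cvg S _)/(_ _ (av_gt0 S tn0)) := ql_cvg.
  by apply: filterS => k; apply: contraTneq => ->; rewrite subr0 ltxx.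
have qV_cvg : ((q k).[lam k])^-1 @[k --> G] --> (t ^+ n)^-1 by exact: cvgV.
pose p k := (q k).[lam k]^-1 *: q k.
have p_cvg i : (p k)`_i @[k --> G] --> (t ^+ n)^-1 * ('X^n : {poly K})`_i.
  by under eq_fun do rewrite coefZ; apply: cvgM => //; exact: q_cvg.
have p_size k : (size (p k) <= n.+1)%N.
  by rewrite -(q_size k); exact: size_scale_leq.
have tr_cvg : \tr (horner_mx (A k) (p k)) @[k --> G] --> (1 : K).
  have -> : (1 : K) = \sum_(i < n.+1) (t ^+ n)^-1 * ('X^n : {poly K})`_i * \tr (L ^+ i).
    rewrite big_ord_recr big1 /= ?add0r => [|i _]; last first.
      by rewrite coefXn ltn_eqF // mulr0 mul0r.
    rewrite coefXn eqxx mulr1 (_ : \tr (L ^+ n) = t ^+ n) ?mulVf //.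
    apply: (cvgK_unique PG (mcvg_trace PG (@mcvgX _ _ PG _ _ _ n ML))).
    under eq_fun.
      by move=> k; have [b [a Mba]] := M_rank1 k; rewrite (trace_rank1_pow Mba); over.
    exact: cvgKX.
  under eq_fun do rewrite (horner_mx_wide _ (p_size _)) raddf_sum /=.
  apply: (@cvg_fsum _ K^o) => i _; under eq_fun do rewrite mxtraceZ.
  by apply: cvgM; [exact: p_cvg|apply: mcvg_trace; exact: mcvgX].
have p_bdd : \forall k \near G, forall i : 'I_n.+1,
    av (p k)`_i <= av ((t ^+ n)^-1 * ('X^n : {poly K})`_i) + 1.
  apply: filter_forall => i; have /(av_cvg S _)/(_ _ ltr01) := p_cvg i.
  apply: filterS => k h; rewrite addrC -lerBlDr ltW //; apply: le_lt_trans h.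
  rewrite avC lerBlDr -{1}(subrK ((t ^+ n)^-1 * ('X^n : {poly K})`_i) (p k)`_i).
  exact: avD.
pose B := \sum_(i < n.+1) (av ((t ^+ n)^-1 * ('X^n : {poly K})`_i) + 1).
have B_large : \forall k \near G, B < k%:R by apply/Goo; exact: nbhs_infty_gtr.
have /(av_cvg S _)/(_ _ ltr01) tr_near := tr_cvg.
have both P1 P2 : G P1 -> G P2 -> G (P1 `&` P2) by exact: filterI.
have all_near := both _ _ near_good (both _ _ q_chi (both _ _ ql0
  (both _ _ p_bdd (both _ _ B_large tr_near)))).
have [k [h7 [h2 [h3 [h4 [h5 h6]]]]]] := filter_ex all_near.
apply: (A_bad k); exists (p k), (lam k).
have [QQ AQ] := eigenprojection h2 h3.
split; last first.
  split => //; move: h6; rewrite (idem_trace QQ).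
  case: (\rank _) => [|[|r]] //; first by rewrite subr0 av1 ltxx.
  by rewrite avC -addn1 natrD addrK av_nat ltrn1.
split => // [i|].
  have [ni|i_n] := leqP n.+1 i.
    by rewrite nth_default ?av0 //; apply: leq_trans ni.
  apply: le_trans (h4 (Ordinal i_n)) _; apply: le_trans (ltW h5).
  rewrite /B (bigD1 (Ordinal i_n)) //= lerDl sumr_ge0 // => j _.
  by rewrite addr_ge0 // av_ge0.
apply: contraTneq h7.2 => ->; rewrite sub0r avN -ltNge.
by have := av_gt0 S t0; lra.
Qed.

End near_rank_one.

(** * Splitting off an idempotent of rank one *)

Section spectral_splitting.
Variables (R : realType) (K : numFieldType) (S : scalars R K).
Local Notation iK := (emb S).
Local Notation av := (av S).

Let size1 d (M : 'M[K]_d) : R := \sum_k \sum_l av (M k l).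

Let size1_ge0 d (M : 'M[K]_d) : 0 <= size1 M.
Proof. by apply: sumr_ge0 => k _; apply: sumr_ge0 => l _; exact: av_ge0. Qed.

Let entry_size1 d (M : 'M[K]_d) k l : av (M k l) <= size1 M.
Proof.
rewrite /size1 (bigD1 k) //= (bigD1 l) //= -addrA lerDl addr_ge0 //.
  by apply: sumr_ge0 => j _; exact: av_ge0.
by apply: sumr_ge0 => j _; apply: sumr_ge0 => i _; exact: av_ge0.
Qed.

Let trace_size1 d (M : 'M[K]_d) : av (\tr M) <= size1 M.
Proof.
apply: le_trans (av_sum _ _ _ _) _; apply: ler_sum => k _.
by rewrite (bigD1 k) //= lerDl; apply: sumr_ge0 => l _; exact: av_ge0.
Qed.

(** The matrices whose trace is small against their size contribute at most half
    of the sum of the traces, so the others have mass at least 1/2.  The entries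
    of the normalized matrices fall into finitely many cells, and matrices with
    all entries in the same cells are nearly equal after normalization. *)
Lemma heavy_class d (C eps kap : R) : 0 < kap -> kap * C <= 2^-1 -> 0 < eps ->
  exists2 w0, 0 < w0 & forall D (M : 'I_D -> 'M[K]_d),
    1 <= \sum_i av (\tr (M i)) -> \sum_i size1 (M i) <= C ->
    exists c : pred 'I_D, w0 <= \sum_(i | c i) size1 (M i) /\
      forall i, c i -> [/\ 0 < size1 (M i), kap * size1 (M i) <= av (\tr (M i)) &
        forall j, c j -> forall k l,
          av ((iK (size1 (M i)))^-1 * M i k l - (iK (size1 (M j)))^-1 * M j k l) <= eps].
Proof.
move=> kap0 kapC eps0; have [L [cl clP]] := grid S eps0.
pose T := {ffun 'I_d * 'I_d -> 'I_L}.
pose w0 : R := (2 * (#|T|.+1)%:R)^-1.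
have w00 : 0 < w0 by rewrite invr_gt0 mulr_gt0.
exists w0 => // D M trM sM.
pose nM i k l := (iK (size1 (M i)))^-1 * M i k l.
pose cM i : T := [ffun kl => cl (nM i kl.1 kl.2)].
pose good i := (0 < size1 (M i)) && (kap * size1 (M i) <= av (\tr (M i))).
have good_mass : 2^-1 <= \sum_(i | good i) size1 (M i).
  apply: le_trans (_ : \sum_(i | good i) av (\tr (M i)) <= _); last first.
    by apply: ler_sum => i _; exact: trace_size1.
  have bad : \sum_(i | ~~ good i) av (\tr (M i)) <= 2^-1.
    apply: le_trans kapC; apply: le_trans (_ : kap * \sum_i size1 (M i) <= _); last first.
      by rewrite ler_wpM2l // ltW.
    rewrite mulr_sumr [leRHS](bigID good) /= -[leLHS]add0r lerD //.
      by apply: sumr_ge0 => i _; rewrite mulr_ge0 // ltW.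
    apply: ler_sum => i; rewrite negb_and -leNgt -ltNge => /orP[s0|/ltW //].
    apply: le_trans (trace_size1 _) _; apply: le_trans s0 _.
    by rewrite mulr_ge0 // ltW.
  by move: trM; rewrite (bigID good) /=; lra.
have [t tP] : exists t : T, w0 <= \sum_(i | good i && (cM i == t)) size1 (M i).
  apply: contrapT => not; move: good_mass; rewrite leNgt => /negP; apply.
  rewrite (partition_big cM xpredT) //=.
  apply: le_lt_trans (_ : \sum_(t : T) w0 < _).
    by apply: ler_sum => t _; rewrite leNgt; apply/negP => h; apply: not; exists t; exact: ltW.
  rewrite sumr_const -[ltLHS]mulr_natl /w0 invfM mulrCA mulrC.
  rewrite -[ltRHS]mul1r ltr_pM2r ?invr_gt0 // ltr_pdivrMr // mul1r ltr_nat.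
  exact: ltnSn.
exists (fun i => good i && (cM i == t)); split=> // i /andP[/andP[si ki] /eqP ci].
split=> // j /andP[/andP[sj _] /eqP cj] k l; rewrite -av_le; apply: clP.
- rewrite -(rmorph1 iK) av_le avM avV av_emb gtr0_norm // mulrC ler_pdivrMr //.
  by rewrite mul1r entry_size1.
- rewrite -(rmorph1 iK) av_le avM avV av_emb gtr0_norm // mulrC ler_pdivrMr //.
  by rewrite mul1r entry_size1.
- by have := congr1 (fun f : T => f (k, l)) (etrans ci (esym cj)); rewrite !ffunE.
Qed.

(** The sum of a heavy class, divided by its mass w, is a convex combination of
    normalized matrices close to one of them, which has rank one and a trace
    bounded below; so [near_rank1_projection] applies to it.  Rescaling by the
    powers of 1/w gives a polynomial in the sum itself.  The idempotent lies
    under P because it is a multiple of its product with the sum. *)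
Lemma split_rank1_idempotent d (C : R) : exists2 B, 0 <= B &
  forall D (M : 'I_D -> 'M[K]_d) (P : 'M[K]_d),
  (forall i, exists (b : 'cV[K]_d) (a : 'rV[K]_d), M i = b *m a) ->
  \sum_i M i = P -> P *m P = P -> P != 0 ->
  (forall i, P *m M i = M i) -> (forall i, M i *m P = M i) ->
  \sum_i \sum_k \sum_l av (M i k l) <= C ->
  exists (th : 'I_D -> K) (q : {poly K}),
    [/\ forall i, av (th i) <= 1, (size q <= d)%N & forall j, av q`_j <= B] /\
    let Q := \sum_(j < d) q`_j *: (\sum_i th i *: M i) ^+ j in
    [/\ Q *m Q = Q, \tr Q = 1, P *m Q = Q & Q *m P = Q].
Proof.
case: d => [|n].
  exists 0 => // D M P _ _ _ /eqP P0; exfalso; apply: P0.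
  by apply/matrixP => -[].
(* C1 bounds the mass as C does, and it is positive *)
pose C1 := `|C| + 1; have C10 : 0 < C1 by rewrite ltr_wpDl.
pose kap := (2 * C1)^-1; have kap0 : 0 < kap by rewrite invr_gt0 mulr_gt0.
have kapC : kap * C1 <= 2^-1 by rewrite /kap invfM -mulrA mulVf ?mulr1 // gt_eqF.
have [eps eps0 [B0 B00 proj]] := near_rank1_projection S n kap0.
have [w0 w00 heavy] := @heavy_class n.+1 C1 eps kap kap0 kapC eps0.
exists (B0 * (1 + w0^-1) ^+ n.+1).
  by rewrite mulr_ge0 // exprn_ge0 // addr_ge0 // invr_ge0 ltW.
move=> D M P M1 MP PP P0 PM MP' MC.
have trP : 1 <= \sum_i av (\tr (M i)).
  apply: le_trans (_ : av (\tr P) <= _); last first.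
    by rewrite -MP raddf_sum; exact: av_sum.
  by rewrite (idem_trace PP) av_nat ler1n lt0n mxrank_eq0.
have [|c [cw cP]] := heavy D M trP.
  by apply: le_trans MC _; rewrite /C1; have := ler_norm C; lra.
set w := \sum_(i | c i) size1 (M i) in cw.
have w_gt0 : 0 < w by apply: lt_le_trans cw.
have [i0 ci0] : exists i0, c i0.
  apply: contrapT => noc; move: w_gt0; rewrite /w big1 ?ltxx // => i ci.
  by case: noc; exists i.
have wK : iK w != 0 by rewrite fmorph_eq0 gt_eqF.
have sK i : c i -> iK (size1 (M i)) != 0.
  by case/cP => si _ _; rewrite fmorph_eq0 gt_eqF.
pose A0 := \sum_i (c i)%:R *: M i.
pose A := (iK w)^-1 *: A0.
pose N := (iK (size1 (M i0)))^-1 *: M i0.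
have A0E : A0 = \sum_(i | c i) M i.
  rewrite /A0 [RHS]big_mkcond; apply: eq_bigr => i _.
  by case: ifP => _; rewrite ?scale1r ?scale0r.
have [s0 k0 near0] := cP _ ci0.
have [b [a Mba]] := M1 i0.
have [||||q0 [l [[q0s q0B l0] [QQ AQ trQ]]]] :=
    proj N A ((iK (size1 (M i0)))^-1 *: b) a.
- by rewrite /N Mba scalemxAl.
- move=> i j; rewrite mxE avM avV av_emb gtr0_norm // mulrC ler_pdivrMr //.
  by rewrite mul1r entry_size1.
- rewrite mxtraceZ avM avV av_emb gtr0_norm // mulrC ler_pdivlMr //.
- move=> k l; rewrite !mxE A0E summxE.
  have -> : (iK w)^-1 * \sum_(i | c i) M i k l - (iK (size1 (M i0)))^-1 * M i0 k l =
    (iK w)^-1 * \sum_(i | c i) iK (size1 (M i)) *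
      ((iK (size1 (M i)))^-1 * M i k l - (iK (size1 (M i0)))^-1 * M i0 k l).
    rewrite [in RHS](eq_bigr (fun i => M i k l -
      iK (size1 (M i)) * ((iK (size1 (M i0)))^-1 * M i0 k l))); last first.
      by move=> i ci; rewrite mulrBr mulVKf ?sK.
    by rewrite sumrB mulrBr -mulr_suml -rmorph_sum -/w mulKf.
  rewrite avM avV av_emb gtr0_norm // mulrC ler_pdivrMr // /w mulr_sumr.
  apply: le_trans (av_sum _ _ _ _) _; apply: ler_sum => i ci.
  have [si _ neari] := cP _ ci.
  rewrite avM av_emb gtr0_norm // mulrC ler_wpM2r ?(ltW si) //.
  exact: neari.
pose q := \poly_(j < n.+1) (q0`_j * (iK w)^-1 ^+ j).
have QE : \sum_(j < n.+1) q`_j *: A0 ^+ j = horner_mx A q0.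
  rewrite (horner_mx_wide _ q0s); apply: eq_bigr => j _.
  by rewrite coef_poly ltn_ord /A exprZn scalerA.
exists (fun i => (c i)%:R), q; split.
  split=> [i||j]; first by case: (c i); rewrite ?av1 ?av0.
    exact: size_poly.
  rewrite coef_poly; case: ifP => [jn|_]; last first.
    by rewrite av0 mulr_ge0 // exprn_ge0 // addr_ge0 // invr_ge0 ltW.
  rewrite avM avX avV av_emb gtr0_norm // ler_pM ?av_ge0 ?exprn_ge0 ?invr_ge0 ?(ltW w_gt0) //.
  have w_ge1 : 1 <= 1 + w0^-1 by rewrite lerDl invr_ge0 ltW.
  apply: le_trans (_ : (1 + w0^-1) ^+ j <= _); last by rewrite ler_weXn2l // ltnW.
  apply: lerXn2r; rewrite ?nnegrE ?invr_ge0 ?(ltW w_gt0) //; first lra.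
  by apply: ler_wpDl => //; rewrite lef_pV2.
rewrite -/A0 QE.
have PA0 : P *m A0 = A0.
  by rewrite mulmx_sumr; apply: eq_bigr => i _; rewrite -scalemxAr PM.
have A0P : A0 *m P = A0.
  by rewrite mulmx_suml; apply: eq_bigr => i _; rewrite -scalemxAl MP'.
have Ql : horner_mx A q0 = l^-1 *: (A *m horner_mx A q0) by rewrite AQ scalerA mulVf ?scale1r.
have Qr : horner_mx A q0 = l^-1 *: (horner_mx A q0 *m A).
  rewrite {1}Ql; congr (_ *: _).
  by rewrite -{1 4}(horner_mx_X A) !mulmxE -!rmorphM mulrC.
split=> //.
  by rewrite {1}Ql -scalemxAr mulmxA /A -(scalemxAr _ P) PA0 -/A -Ql.
by rewrite {1}Qr -scalemxAl -mulmxA /A -(scalemxAl _ A0 P) A0P -/A -Qr.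
Qed.

End spectral_splitting.

(** * Bounded resolutions of the identity on initial segments *)

Section partial_resolutions.
Variables (R : realType) (K : numFieldType) (S : scalars R K).
Variables (X : completeNormedModType K) (E : nat -> set X) (uE : ufdd E).
Local Notation iK := (emb S).
Local Notation nrm := (nrm S).
Local Notation av := (av S).
Variables (d : nat -> nat) (g : forall n, 'I_(d n) -> X).
Hypothesis g_free : forall n, free_family (@g n).
Hypothesis g_span : forall n, E n = range (lincomb (@g n)).
Hypothesis g_nrm : forall n i, nrm (@g n i) <= 1.
Hypothesis g_coord : forall n a i, av (a i) <= 2 * nrm (lincomb (@g n) a).
Variables (N : nat) (dN : forall n, (d n <= N)%N).

Local Notation bdd := (bdd S g).

Lemma bdd1 m : bdd m (fun n => 1%:M) 1.
Proof. by move=> c; rewrite mul1r; under eq_bigr do rewrite mul1mx. Qed.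

Lemma bdd_opp m T C : bdd m T C -> bdd m (fun n => - T n) C.
Proof.
move=> hT c; have := hT (fun n => - c n).
under eq_bigr do rewrite mulmxN -mulNmx.
under [X in _ <= _ * nrm X]eq_bigr do rewrite -scaleN1r vecZ scaleN1r.
by rewrite sumrN nrmN.
Qed.

Lemma bdd_pow m T C j : 0 <= C -> bdd m T C -> bdd m (fun n => T n ^+ j) (C ^+ j).
Proof.
move=> C0 hT; elim: j => [|j ih]; first exact: bdd1.
by rewrite exprS; apply: bdd_eq (bdd_mul C0 hT ih) => n _; rewrite exprS.
Qed.

Lemma trace_prefix r e : \sum_(s < r) ((s < e)%N%:R : K) = (minn r e)%:R.
Proof.
elim: r => [|r ih]; first by rewrite big_ord0 min0n.
rewrite big_ord_recr /= ih -natrD; congr (_%:R).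
by case: ltnP => h /=; lia.
Qed.

(** Choosing theta_i as the phase that makes the entry (k, l) of
    theta_i M_(n,i) equal to its absolute value turns the bound for the
    operators into a bound for the sum of these absolute values. *)
Lemma entries_summable m D (M : forall n, 'I_D -> 'M[K]_(d n)) C : 0 <= C ->
  (forall th : nat -> 'I_D -> K, (forall n i, av (th n i) <= 1) ->
        bdd m (fun n => \sum_i th n i *: M n i) C) ->
  forall n, (n < m)%N -> \sum_i \sum_k \sum_l av (M n i k l) <= N%:R * (N%:R * (2 * C)).
Proof.
move=> C0 hM n nm.
have one k l : \sum_i av (M n i k l) <= 2 * C.
  have /choice[t tP] : forall i, exists t, av t <= 1 /\ t * M n i k l = iK (av (M n i k l)).
    by move=> i; have [t t1 t2] := phase S (M n i k l); exists t.
  have := bdd_entry uE g_free g_span g_nrm g_coord k l C0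
    (hM (fun _ i => t i) (fun _ i => (tP i).1)) nm.
  rewrite summxE (eq_bigr (fun i => iK (av (M n i k l)))); last first.
    by move=> i _; rewrite mxE (tP i).2.
  rewrite -rmorph_sum av_emb ger0_norm //.
  by apply: sumr_ge0 => i _; exact: av_ge0.
have c0 : 0 <= 2 * C by rewrite mulr_ge0.
have ordN (b : R) (f : 'I_(d n) -> R) : 0 <= b -> (forall k, f k <= b) ->
    \sum_k f k <= N%:R * b.
  move=> b0 fb; apply: le_trans (ler_sum _ (fun k _ => fb k)) _.
  by rewrite sumr_const card_ord -[leLHS]mulr_natl ler_wpM2r // ler_nat.
rewrite exchange_big; apply: (ordN) => [|k]; first by rewrite mulr_ge0.
by rewrite exchange_big; apply: (ordN).
Qed.

(** Beyond the dimension the idempotents have trace 0 and so vanish; the same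
    number of idempotents can thus be used in all blocks. *)
Definition partial_resolution r n (Q : nat -> 'M[K]_(d n)) :=
  (forall s t, (s < r)%N -> (t < r)%N -> Q s *m Q t = if s == t then Q s else 0) /\
  (forall s, (s < r)%N -> \tr (Q s) = (s < d n)%:R).

Lemma resolution_rest r n (Q : nat -> 'M[K]_(d n)) : partial_resolution r Q ->
  let P := 1%:M - \sum_(s < r) Q s in
  [/\ P *m P = P, forall s, (s < r)%N -> P *m Q s = 0 /\ Q s *m P = 0 &
      \tr P = (d n)%:R - (minn r (d n))%:R].
Proof.
move=> [QQ trQ] P.
have PQ s : (s < r)%N -> P *m Q s = 0 /\ Q s *m P = 0.
  move=> sr; rewrite /P mulmxBl mulmxBr mul1mx mulmx1 mulmx_suml mulmx_sumr.
  have e1 : \sum_(i < r) Q i *m Q s = Q s.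
    rewrite (bigD1 (Ordinal sr)) //= QQ // eqxx big1 ?addr0 // => i.
    by rewrite -val_eqE QQ //= => /negbTE ->.
  have e2 : \sum_(i < r) Q s *m Q i = Q s.
    rewrite (bigD1 (Ordinal sr)) //= QQ // eqxx big1 ?addr0 // => i.
    by rewrite -val_eqE QQ //= eq_sym => /negbTE ->.
  by rewrite e1 e2 subrr.
split => //.
  rewrite {2}/P mulmxBr mulmx1 mulmx_sumr big1 ?subr0 // => i _.
  exact: (PQ i (ltn_ord i)).1.
have tr_sum : \sum_(i < r) \tr (Q i) = (minn r (d n))%:R.
  by rewrite -trace_prefix; apply: eq_bigr => i _; exact: trQ.
have trB (A B : 'M[K]_(d n)) : \tr (A - B) = \tr A - \tr B by rewrite raddfB.
have trS (A : 'I_r -> 'M[K]_(d n)) : \tr (\sum_i A i) = \sum_i \tr (A i) by rewrite raddf_sum.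
by rewrite trB trS mxtrace1 tr_sum.
Qed.

Lemma resolution_complete n (Q : nat -> 'M[K]_(d n)) : partial_resolution N Q ->
  \sum_(s < N) Q s = 1%:M.
Proof.
move=> /resolution_rest[PP _ trP]; apply/esym/eqP; rewrite -subr_eq0; apply/eqP.
by apply: idem_trace0 => //; rewrite trP (minn_idPr (dN n)) subrr.
Qed.

Hypothesis lust : coordinate_lust S X.

(** Let P be the complement of the idempotents found so far.  The compressions
    P M_(n,i) P again have rank at most one and bounded combinations, and their
    sum is P; so they yield one more idempotent under P in each block.  It is a
    polynomial of degree less than N with bounded coefficients in a combination
    of the compressions, and therefore bounded uniformly in m. *)
Lemma bounded_partial_resolution r : exists2 C, 0 <= C &
  forall m, exists Q : forall n, nat -> 'M[K]_(d n),
  (forall n, (n < m)%N -> partial_resolution r (Q n)) /\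
  forall s, (s < r)%N -> bdd m (fun n => Q n s) C.
Proof.
have [Cl Cl0 multP] := lust_multipliers uE g_free g_span lust.
have [Bs Bs0 scalP] := bdd_scalar S uE g_span.
elim: r => [|r [C C0 IH]]; first by exists 0 => // m; exists (fun n _ => 0).
pose CP := 1 + r%:R * C; have CP0 : 0 <= CP by rewrite addr_ge0 ?mulr_ge0.
pose C2 := CP * Cl * CP; have C20 : 0 <= C2 by rewrite !mulr_ge0.
pose C3 := N%:R * (N%:R * (2 * C2)).
pose Bd e := s2val (cid2 (split_rank1_idempotent S e C3)).
have Bd0 e : 0 <= Bd e by exact: (s2valP (cid2 (split_rank1_idempotent S e C3))).
(* a bound that serves all blocks, as only finitely many dimensions occur *)
pose B := \sum_(e < N.+1) Bd e.
have B0 : 0 <= B by apply: sumr_ge0 => e _; exact: Bd0.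
have BdB n : Bd (d n) <= B.
  rewrite /B (bigD1 (Ordinal (dN n : (d n < N.+1)%N))) //= lerDl.
  by apply: sumr_ge0 => e _; exact: Bd0.
pose C4 := \sum_(j < N) B * Bs * C2 ^+ j.
have C40 : 0 <= C4 by apply: sumr_ge0 => j _; rewrite !mulr_ge0 // exprn_ge0.
exists (C + C4); first by rewrite addr_ge0.
move=> m; have [Q [QP Qb]] := IH m.
have [D [M [M1 MI Mb]]] := multP m.
pose P n := 1%:M - \sum_(s < r) Q n s.
have Pb : bdd m P CP.
  apply: bdd_add (bdd1 m) _; apply: bdd_opp.
  have := bdd_sum (index_enum 'I_r) (P := predT) (fun s _ => Qb s (ltn_ord s)).
  by rewrite sumr_const card_ord -[X in bdd _ _ X -> _]mulr_natl.
pose M' n i := P n *m M n i *m P n.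
have M'b (th : nat -> 'I_D -> K) : (forall n i, av (th n i) <= 1) ->
    bdd m (fun n => \sum_i th n i *: M' n i) C2.
  move=> th1; apply: bdd_eq (bdd_mul _ (bdd_mul CP0 Pb (Mb _ th1)) Pb); last first.
    by rewrite mulr_ge0.
  move=> n _; rewrite mulmx_sumr mulmx_suml; apply: eq_bigr => i _.
  by rewrite -scalemxAr -scalemxAl.
have M'sum n : (n < m)%N -> \sum_i M' n i = P n.
  move=> nm; rewrite -mulmx_suml -mulmx_sumr MI // mulmx1.
  by case: (resolution_rest (QP n nm)).
(* blocks beyond m, and blocks that are already resolved, get the zero matrix *)
have step n : exists thq : ('I_D -> K) * {poly K},
  [/\ forall i, av (thq.1 i) <= 1, (size thq.2 <= d n)%N,
    forall j, av thq.2`_j <= B &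
    (n < m)%N -> let Qr := \sum_(j < d n) thq.2`_j *: (\sum_i thq.1 i *: M' n i) ^+ j in
     [/\ Qr *m Qr = Qr, \tr Qr = (r < d n)%:R, P n *m Qr = Qr & Qr *m P n = Qr]].
  have [nm|mn] := ltnP n m; last first.
    exists (fun=> 0, 0); split=> //= [i||j]; first by rewrite av0.
      by rewrite size_poly0.
    by rewrite coef0 av0.
  have [PP PQ trP] := resolution_rest (QP n nm).
  have [P0|P0] := eqVneq (P n) 0.
    exists (fun=> 0, 0); split=> //= [i||j|_]; first by rewrite av0.
        by rewrite size_poly0.
      by rewrite coef0 av0.
    rewrite big1; last by move=> j _; rewrite coef0 scale0r.
    rewrite !mulmx0 mul0mx; split=> //.
    rewrite raddf0; case: ltnP => // rd; exfalso.
    move: trP; rewrite -/(P n) P0 raddf0 (minn_idPl (ltnW rd)) -natrB ?(ltnW rd) //.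
    by move/esym/eqP; rewrite pnatr_eq0 subn_eq0 leqNgt rd.
  have [|||||||th [q [[th1 qd qB] [QQ trQ PQr QrP]]]] :=
      s2valP' (cid2 (split_rank1_idempotent S (d n) C3)) D (M' n) (P n).
  - move=> i; have [b [a Mba]] := M1 n i; exists (P n *m b), (a *m P n).
    by rewrite /M' Mba !mulmxA.
  - exact: M'sum.
  - exact: PP.
  - exact: P0.
  - by move=> i; rewrite /M' !mulmxA PP.
  - by move=> i; rewrite /M' -!mulmxA PP.
  - exact: (entries_summable C20 M'b nm).
  exists (th, q); split=> //= [j|_]; first exact: le_trans (qB j) (BdB n).
  split=> //; rewrite trQ; case: ltnP => // dr; exfalso.
  move/eqP: P0; apply; apply: idem_trace0 => //.
  by rewrite trP (minn_idPr dr) subrr.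
have /choice[thq thqP] := step.
pose Qr n := \sum_(j < d n) (thq n).2`_j *: (\sum_i (thq n).1 i *: M' n i) ^+ j.
pose Q' n s := if (s < r)%N then Q n s else Qr n.
exists Q'; split=> [n nm|s]; last first.
  rewrite ltnS /Q' => sr; have [sr'|_] := ltnP s r.
    by apply: bdd_le (Qb s sr'); rewrite lerDl.
  apply: (@bdd_le _ _ _ _ _ _ _ _ C4); first by rewrite lerDr.
  have hA : bdd m (fun n => \sum_i (thq n).1 i *: M' n i) C2.
    by apply: M'b => n i; case: (thqP n).
  have hQ (j : 'I_N) : bdd m (fun n => ((thq n).2`_j)%:M *m
      (\sum_i (thq n).1 i *: M' n i) ^+ j) (B * Bs * C2 ^+ j).
    apply: bdd_mul (bdd_pow _ C20 hA); first by rewrite mulr_ge0.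
    by apply: scalP => // n; case: (thqP n).
  apply: bdd_eq (bdd_sum (index_enum 'I_N) (P := predT) (fun j _ => hQ j)) => n _.
  rewrite /Qr (big_ord_widen _
    (fun j => (thq n).2`_j *: (\sum_i (thq n).1 i *: M' n i) ^+ j) (dN n)).
  rewrite [RHS]big_mkcond; apply: eq_bigr => j _; rewrite mul_scalar_mx.
  case: ltnP => // dj; have [_ qd _ _] := thqP n.
  by rewrite nth_default ?scale0r // (leq_trans qd).
have [PP PQ trP] := resolution_rest (QP n nm).
have [_ _ _ /(_ nm)[QQ trQ PQr QrP]] := thqP n.
have [QQn trQn] := QP n nm.
split=> [s t|s]; rewrite !ltnS /Q'.
  case: (ltnP s r) => sr; case: (ltnP t r) => tr sr' tr'.
  - exact: QQn.
  - have -> : (s == t) = false by lia.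
    by rewrite /Qr -[X in _ *m X]PQr mulmxA (PQ s sr).2 mul0mx.
  - have -> : (s == t) = false by lia.
    by rewrite /Qr -[X in X *m _]QrP -mulmxA (PQ t tr).1 mulmx0.
  - have -> : s == t by lia.
    exact: QQ.
case: (ltnP s r) => [sr _|rs sr]; first exact: trQn.
by have -> : s = r by lia.
Qed.

End partial_resolutions.

(** * From resolutions of the identity to unconditional bases *)

Section criterion.
Variables (R : realType) (K : numFieldType) (S : scalars R K).
Variables (X : normedModType K).
Local Notation nrm := (nrm S).
Local Notation av := (av S).

Section listing.
Variables (I : countType) (s : nat -> option I) (es : enumeration s).

Definition listed n : seq I := pmap s (iota 0 n).

Lemma listedS n : listed n.+1 = listed n ++ (if s n is Some i then [:: i] else [::]).
Proof.
rewrite /listed -addn1 iotaD add0n /= pmap_cat /=.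
by case: (s n).
Qed.

Lemma series_listed (u : I -> X) n :
  series (fun k => oapp u 0 (s k)) n = \sum_(i <- listed n) u i.
Proof.
rewrite /series /=; elim: n => [|n ih]; first by rewrite big_geq // /listed big_nil.
rewrite big_nat_recr //= ih listedS big_cat /=; congr (_ + _).
by case: (s n) => [i|] /=; rewrite ?big_seq1 ?big_nil.
Qed.

Lemma mem_listed n i : (i \in listed n) = [exists k : 'I_n, s k == Some i].
Proof.
rewrite /listed mem_pmap; apply/mapP/existsP => [[k]|[k /eqP sk]].
  by rewrite mem_iota add0n => /andP[_ kn] ->; exists (Ordinal kn).
by exists (nat_of_ord k); rewrite ?sk // mem_iota add0n /=.
Qed.

Lemma listed_uniq n : uniq (listed n).
Proof.
elim: n => [|n ih] //; rewrite listedS cat_uniq ih /=.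
case sn: (s n) => [i|] //=; rewrite orbF andbT mem_listed.
apply/existsP => -[k /eqP sk]; have [k0 [_ k0u]] := es i.
by have := ltn_ord k; rewrite -(k0u _ sk) (k0u _ sn) ltnn.
Qed.

Lemma eventually_listed (F : seq I) : exists n0, forall n, (n0 <= n)%N ->
  {subset F <= listed n}.
Proof.
elim: F => [|i F [n0 ih]]; first by exists 0%N.
have [k [sk _]] := es i.
exists (maxn n0 k.+1) => n; rewrite geq_max => /andP[h1 h2] j.
rewrite inE => /orP[/eqP ->|]; last exact: ih.
by rewrite mem_listed; apply/existsP; exists (Ordinal h2); rewrite /= sk.
Qed.

End listing.

(** The partial sums over finite sets are uniformly bounded operators, and they
    fix the combinations of the f i with i in the set.  Any partial sum over a
    set that contains F is therefore close to the identity at points close to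
    a combination over F, whatever the order of summation. *)
Lemma unconditional_basis_criterion (E : set X) (I : countType) (f : I -> X)
    (phi : I -> X -> K) (C : R) : 0 <= C ->
  (forall i, E (f i)) ->
  (forall i k x y, phi i (k *: x + y) = k * phi i x + phi i y) ->
  (forall i j, phi i (f j) = (i == j)%:R) ->
  (forall (F : seq I) x, uniq F -> nrm (\sum_(i <- F) phi i x *: f i) <= C * nrm x) ->
  (forall x, E x -> forall e, 0 < e -> exists2 F : seq I, uniq F &
     nrm (x - \sum_(i <- F) phi i x *: f i) < e) ->
  unconditional_basis E f.
Proof.
move=> C0 Ef phi_lin phi_f bound dense.
have phi0 i : phi i 0 = 0.
  have := phi_lin i 1 0 0; rewrite scaler0 addr0 mul1r => /eqP.
  by rewrite -subr_eq subrr eq_sym => /eqP.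
have phiB i x y : phi i (x - y) = phi i x - phi i y.
  by rewrite addrC -scaleN1r phi_lin mulN1r addrC.
have phi_comb i (F : seq I) (a : I -> K) : uniq F ->
    phi i (\sum_(j <- F) a j *: f j) = if i \in F then a i else 0.
  elim: F => [|j F ih] /=; first by rewrite big_nil phi0.
  move=> /andP[jF uF]; rewrite big_cons phi_lin phi_f ih // inE.
  have [->|] /= := eqVneq i j; first by rewrite (negbTE jF) mulr1 addr0.
  by rewrite mulr0 add0r.
split=> // x Ex; exists (phi^~ x); split=> [s es|s b es sb].
  apply/(nrm_cvg S) => e e0.
  have e'0 : 0 < e / (1 + C) by rewrite divr_gt0 // ltr_pwDl.
  have [F uF xF] := dense x Ex _ e'0.
  set y := \sum_(i <- F) phi i x *: f i in xF.
  have [n0 n0P] := eventually_listed es F.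
  exists n0 => // n /= n0n.
  rewrite -[X in x - X]/(series (fun k => oapp (fun i => phi i x *: f i) 0 (s k)) n).
  rewrite series_listed.
  have uL := listed_uniq es n.
  have yL : \sum_(i <- listed s n) phi i y *: f i = y.
    rewrite /y [LHS](eq_bigr (fun i => if i \in F then phi i x *: f i else 0)); last first.
      by move=> i _; rewrite phi_comb //; case: ifP => //; rewrite scale0r.
    rewrite -big_mkcond -big_filter; apply: perm_big.
    apply: uniq_perm => //; first exact: filter_uniq.
    move=> i; rewrite mem_filter; case iF : (i \in F) => //=.
    by apply/(n0P n n0n).
  have -> : x - \sum_(i <- listed s n) phi i x *: f i =
     (x - y) - \sum_(i <- listed s n) phi i (x - y) *: f i.
    under [in RHS]eq_bigr do rewrite phiB scalerBl.
    by rewrite sumrB yL opprB addrA subrK.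
  apply: le_lt_trans (nrmB _ _ _) _.
  apply: le_lt_trans (_ : (1 + C) * nrm (x - y) < _).
    by rewrite mulrDl mul1r lerD2l bound.
  by rewrite mulrC -ltr_pdivlMr // ltr_pwDl.
apply/funext => i; apply/eqP; rewrite -subr_eq0; apply/eqP.
have fi0 : 0 < nrm (f i).
  rewrite lt_neqAle nrm_ge0 andbT; apply/eqP => /esym/nrm0_eq0 fi.
  by have := phi_f i i; rewrite fi phi0 eqxx => /esym/eqP; rewrite oner_eq0.
apply: (av0_eq0 (S := S)); apply/eqP; rewrite eq_le av_ge0 andbT.
rewrite -(ler_pM2r fi0) mul0r; apply/ler_addgt0Pl => e e0; rewrite addr0.
have e'0 : 0 < e / (1 + C) by rewrite divr_gt0 // ltr_pwDl.
have /(nrm_cvg S _)/(_ _ e'0)[n1 _ n1P] := sb.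
have [n2 n2P] := eventually_listed es [:: i].
have := n1P (maxn n1 n2) (leq_maxl _ _).
have := n2P (maxn n1 n2) (leq_maxr _ _) i (mem_head _ _).
set n := maxn n1 n2 => iL /=.
rewrite -[X in x - X]/(series (fun k => oapp (fun i => b i *: f i) 0 (s k)) n).
rewrite series_listed; set z := \sum_(j <- _) _ => xz.
have phi_z : phi i z = b i by rewrite /z phi_comb ?iL // listed_uniq.
have := bound [:: i] (z - x) isT; rewrite big_seq1 => bound1.
rewrite -phi_z -phiB -nrmZ; apply: le_trans bound1 _.
apply: le_trans (_ : (1 + C) * nrm (z - x) <= _).
  by rewrite mulrDl mul1r lerDr nrm_ge0.
by rewrite mulrC -ler_pdivlMr ?ltr_pwDl // nrmC ltW.
Qed.

End criterion.

Section resolution.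
Variables (R : realType) (K : numFieldType) (S : scalars R K).
Variables (X : completeNormedModType K) (E : nat -> set X) (uE : ufdd E).
Local Notation nrm := (nrm S).
Local Notation av := (av S).
Variables (d : nat -> nat) (g : forall n, 'I_(d n) -> X).
Hypothesis g_free : forall n, free_family (@g n).
Hypothesis g_span : forall n, E n = range (lincomb (@g n)).
Hypothesis g_nrm : forall n i, nrm (@g n i) <= 1.
Hypothesis g_coord : forall n a i, av (a i) <= 2 * nrm (lincomb (@g n) a).
Variables (N : nat) (dN : forall n, (d n <= N)%N).
Hypothesis lust : coordinate_lust S X.

Local Notation bdd := (bdd S g).
Local Notation vec := (vec g).
Local Notation crd := (crd g).

Lemma bdd_restrict m m' T C : (m' <= m)%N -> bdd m T C -> bdd m' T C.
Proof.
move=> mm' hT c; have := hT (fun n => if (n < m')%N then c n else 0).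
have cut (F : forall n, 'cV[K]_(d n)) :
    \sum_(0 <= n < m) vec (if (n < m')%N then F n else 0) = \sum_(0 <= n < m') vec (F n).
  rewrite (big_cat_nat (leq0n m') mm') /= [X in _ + X]big_nat_cond [X in _ + X]big1 ?addr0.
    by apply: eq_big_nat => n /andP[_ ->].
  by move=> n; rewrite andbT => /andP[h _]; rewrite ltnNge h vec0.
rewrite cut (_ : \sum_(0 <= n < m) _ =
    \sum_(0 <= n < m) vec (if (n < m')%N then T n *m c n else 0)).
  by rewrite cut.
by apply: eq_bigr => n _; case: ifP => // _; rewrite mulmx0.
Qed.

(** For fixed n the entries of the idempotents given for the segments of length
    m are bounded, so they converge along an ultrafilter in m; algebraic
    relations and norm bounds pass to the limit. *)
Lemma limit_resolution : exists2 C, 0 <= C & exists Q : forall n, nat -> 'M[K]_(d n),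
  (forall n, partial_resolution N (Q n)) /\
  forall m s, (s < N)%N -> bdd m (fun n => Q n s) C.
Proof.
have [C C0 stageP] := bounded_partial_resolution uE g_free g_span g_nrm g_coord dN lust N.
exists C => //.
have /choice[Qm QmP] := stageP.
have [G [UG Goo]] := ultraFilterLemma (@eventually_filter).
have PG : ProperFilter G by exact: ultra_proper.
pose q m n s : 'M[K]_(d n) := if (n < m)%N && (s < N)%N then Qm m n s else 0.
have near_lt n : G [set m | (n < m)%N] by apply: Goo; exists n.+1.
have q_le n s k l m : av (q m n s k l) <= 2 * C.
  rewrite /q; case: ifP => [/andP[nm sN]|_]; last by rewrite mxE av0 mulr_ge0.
  exact: (bdd_entry uE g_free g_span g_nrm g_coord k l C0 ((QmP m).2 s sN) nm).
have lim n s : exists L : 'M[K]_(d n), mcvg G (fun m => q m n s) L.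
  have /choice[L LP] : forall kl : 'I_(d n) * 'I_(d n), exists l : K,
      q m n s kl.1 kl.2 @[m --> G] --> l.
    by move=> [k l]; apply: (av_ultra_cvg UG (q_le n s k l)).
  by exists (\matrix_(k, l) L (k, l)) => k l; rewrite mxE; exact: (LP (k, l)).
pose Q' n s := sval (cid (lim n s)).
have Q'P n s : mcvg G (fun m => q m n s) (Q' n s) by exact: svalP (cid (lim n s)).
exists Q'; split=> [n|m s sN c].
  split=> [s t sN tN|s sN].
    apply/matrixP => k l.
    apply: (cvgK_unique PG (mcvgM PG (Q'P n s) (Q'P n t) (i := k) (j := l))).
    apply: (near_cvg S (g := fun m => (if s == t then q m n s else 0) k l)).
      apply: filterS (near_lt n) => m /= nm; rewrite /q nm sN tN /=.
      by rewrite ((QmP m).1 n nm).1 //; case: eqP.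
    by case: eqP => _; [exact: Q'P|exact: cvg_cst].
  apply: (cvgK_unique PG (mcvg_trace PG (Q'P n s))).
  apply: (near_cvg S (g := fun=> (s < d n)%:R)); last exact: cvg_cst.
  apply: filterS (near_lt n) => m /= nm; rewrite /q nm sN /=.
  by rewrite ((QmP m).1 n nm).2.
have lim_sum : \sum_(0 <= n < m) vec (q j n s *m c n) @[j --> G] -->
    \sum_(0 <= n < m) vec (Q' n s *m c n).
  apply: cvg_fsum => n _; apply: cvg_fsum => k _; apply: cvgZr_tmp.
  apply: (mcvgM PG (Q'P n s) (B := fun=> c n) (B' := c n)).
  by move=> ? ?; exact: cvg_cst.
apply: nrm_cvg_le lim_sum _.
have : G [set j | (m <= j)%N] by apply: Goo; exists m.
apply: filterS => j /= mj.
rewrite (eq_big_nat _ _ (F2 := fun n => vec (Qm j n s *m c n))); last first.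
  by move=> n /andP[_ nm]; rewrite /q sN (leq_trans nm mj).
exact: (bdd_restrict mj ((QmP j).2 s sN)).
Qed.

Lemma idem_rank1 e (Q : 'M[K]_e) : Q *m Q = Q -> \tr Q = 1 ->
  exists vw : 'cV[K]_e * 'rV[K]_e, Q = vw.1 *m vw.2 /\ vw.2 *m vw.1 = 1%:M.
Proof.
move=> QQ trQ.
have rQ : \rank Q = 1%N.
  by apply/eqP; rewrite -(eqr_nat K) -idem_trace // trQ.
have := mulmx_base Q.
have : row_base Q *m col_base Q = 1%:M.
  apply: (row_free_inj (row_base_free Q)); apply: (row_full_inj (col_base_full Q)).
  by rewrite mul1mx -mulmxA mulmx_base mulmxA mulmx_base QQ.
move: (col_base Q) (row_base Q); rewrite rQ => v w wv vw.
by exists (v, w).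
Qed.

(** The j-th idempotent of E_n is v w with w v = 1; take f_(n,j) to be v and the
    functional x |-> w x_n.  A partial sum over a finite set H is the sum over
    s < N of the s-th block-diagonal idempotent multiplied by the indicator
    function of the n with (n, s) in H, which is bounded uniformly in H. *)
Theorem resolution_basis : exists f : forall n, 'I_(d n) -> X,
  (forall n, unconditional_basis (E n) (f n)) /\
  unconditional_basis [set: X]
    (fun p : {n : nat & 'I_(d n)} => f (tag p) (tagged p)).
Proof.
have [C C0 [Q [QP Qb]]] := limit_resolution.
have [Bs Bs0 scalP] := bdd_scalar S uE g_span.
have [B B0 BP] := multipliers_bounded S uE.
have jN n (j : 'I_(d n)) : (j < N)%N by apply: leq_trans (ltn_ord j) (dN n).
have ex n (j : 'I_(d n)) : exists vw : 'cV[K]_(d n) * 'rV[K]_(d n),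
    Q n j = vw.1 *m vw.2 /\ vw.2 *m vw.1 = 1%:M.
  have [QQ trQ] := QP n; apply: idem_rank1; first by rewrite QQ // eqxx.
  by rewrite trQ // ltn_ord.
pose v n j := (sval (cid (ex n j))).1; pose w n j := (sval (cid (ex n j))).2.
have Qvw n (j : 'I_(d n)) : Q n j = v n j *m w n j by exact: (svalP (cid (ex n j))).1.
have wv1 n (j : 'I_(d n)) : w n j *m v n j = 1%:M by exact: (svalP (cid (ex n j))).2.
have wv0 n (i j : 'I_(d n)) : i != j -> w n i *m v n j = 0.
  move=> ij; have [/(_ i j (jN _ _) (jN _ _)) + _] := QP n.
  rewrite (negbTE (ij : (i : nat) != j)) !Qvw => h.
  rewrite (_ : _ *m _ = w n i *m (v n i *m w n i *m (v n j *m w n j)) *m v n j).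
    by rewrite h mulmx0 mul0mx.
  by rewrite !mulmxA wv1 mul1mx -(mulmxA _ (w n j)) wv1 mulmx1.
have crd_lin n k x y : E n x -> E n y -> crd n (k *: x + y) = k *: crd n x + crd n y.
  move=> Ex Ey; apply: (vec_inj g_free); rewrite vecD vecZ !(crdK g_span) //.
  by apply: fin_dim_lin => //; exact: uE.1.
have crd0 n : crd n 0 = 0 by rewrite -(vec0 g n) (vecK g_free g_span).
pose c n x := crd n (proj uE n x).
have vec_c n x : vec (c n x) = proj uE n x.
  by rewrite (crdK g_span) //; exact: proj_in.
pose I := {n : nat & 'I_(d n)} : countType.
pose pr n (j : 'I_(d n)) : I := existT (fun n => 'I_(d n)) n j.
pose f n j := vec (v n j).
pose phi (p : I) x := (w (tag p) (tagged p) *m c (tag p) x) 0 0.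
pose F (p : I) := f (tag p) (tagged p).
have phi_lin p k x y : phi p (k *: x + y) = k * phi p x + phi p y.
  rewrite /phi /c proj_lin crd_lin; [|exact: proj_in|exact: proj_in].
  by rewrite mulmxDr -scalemxAr !mxE.
have phi_F p q : phi p (F q) = (p == q)%:R.
  case: p q => [n i] [n' j]; rewrite /phi /F /c /=.
  rewrite (proj_id uE (vec_in g_span (v n' j))).
  case: eqVneq => [nn|nn]; last first.
    by rewrite crd0 mulmx0 mxE -tag_eqE /tag_eq /= (negbTE nn).
  subst n'; rewrite (vecK g_free g_span) eq_Tagged /=.
  case: eqVneq => [->|ij]; first by rewrite wv1 mxE eqxx.
  by rewrite wv0 // mxE.
have phi_vec n (j : 'I_(d n)) x : phi (pr n j) x *: f n j = vec (Q n j *m c n x).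
  rewrite /phi /f Qvw -mulmxA [w n j *m _]mx11_scalar mul_mx_scalar vecZ.
  by rewrite !mxE.
have expand n x : \sum_j phi (pr n j) x *: f n j = proj uE n x.
  under eq_bigr do rewrite phi_vec.
  rewrite -vec_sum -mulmx_suml -[RHS]vec_c; congr vec.
  rewrite -[RHS]mul1mx -(resolution_complete dN (QP n)); congr (_ *m _).
  rewrite (big_ord_widen _ (Q n) (dN n)) [LHS]big_mkcond; apply: eq_bigr => s _.
  case: ltnP => // ds; apply/esym; have [QQ trQ] := QP n.
  apply: idem_trace0; first by rewrite QQ // eqxx.
  by rewrite trQ // ltnNge ds.
pose pairs m : seq I := [seq pr n j | n <- iota 0 m, j <- enum 'I_(d n)].
have mem_pairs m p : (p \in pairs m) = (tag p < m)%N.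
  apply/allpairsPdep/idP => [[n [j [nm _ ->]]]|pm].
    by move: nm; rewrite mem_iota.
  exists (tag p), (tagged p); split; rewrite ?mem_iota ?mem_enum //.
  by case: (p).
have uniq_pairs m : uniq (pairs m).
  apply: allpairs_uniq_dep => [|n _|]; [exact: iota_uniq|exact: enum_uniq|].
  by move=> [n i] [n' j] _ _ /=.
have sum_pairs m (G : I -> X) : \sum_(p <- pairs m) G p =
    \sum_(0 <= n < m) \sum_j G (pr n j).
  rewrite /pairs big_allpairs_dep /index_iota subn0; apply: eq_bigr => n _.
  by rewrite big_enum.
pose C' := (\sum_(s < N) 1 * Bs * C) * B.
have C'0 : 0 <= C' by rewrite mulr_ge0 // sumr_ge0 // => s _; rewrite !mulr_ge0.
have bound (H : seq I) x : uniq H -> nrm (\sum_(p <- H) phi p x *: F p) <= C' * nrm x.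
  move=> uH; pose m := (\max_(p <- H) tag p).+1.
  have Hm p : p \in H -> (tag p < m)%N.
    by move=> pH; rewrite ltnS; apply: (leq_bigmax_seq (F := fun p : I => tag p)).
  have -> : \sum_(p <- H) phi p x *: F p =
      \sum_(p <- pairs m | p \in H) phi p x *: F p.
    rewrite -[RHS]big_filter; apply: perm_big; apply: uniq_perm => //.
      exact: filter_uniq.
    move=> p; rewrite mem_filter mem_pairs.
    by case pH : (p \in H) => //=; rewrite Hm.
  rewrite big_mkcond sum_pairs.
  pose l n s : K := if insub s is Some j then (pr n j \in H)%:R else 0.
  have l1 n s : av (l n s) <= 1.
    by rewrite /l; case: insubP => [j _ _|_]; [case: (_ \in _)|]; rewrite ?av1 ?av0.
  have lQ : bdd m (fun n => \sum_(s < N) (l n s)%:M *m Q n s) (\sum_(s < N) 1 * Bs * C).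
    apply: bdd_sum => s _; apply: bdd_mul; [by rewrite mulr_ge0| |exact: Qb].
    by apply: scalP => // n.
  rewrite (eq_bigr (fun n => vec ((\sum_(s < N) (l n s)%:M *m Q n s) *m c n x))); last first.
    move=> n _; rewrite mulmx_suml vec_sum.
    rewrite (eq_bigr (fun j : 'I_(d n) => vec ((l n j)%:M *m Q n j *m c n x))); last first.
      move=> j _; rewrite /l valK -mulmxA mul_scalar_mx vecZ /F /= phi_vec.
      by case: ifP => _; rewrite ?scale1r ?scale0r.
    rewrite (big_ord_widen _ (fun j => vec ((l n j)%:M *m Q n j *m c n x)) (dN n)).
    rewrite [LHS]big_mkcond; apply: eq_bigr => s _; case: ltnP => // ds.
    by rewrite /l insubF ?mul_scalar_mx ?scale0r ?mul0mx ?vec0 // ltnNge ds.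
  apply: le_trans (lQ (fun n => c n x)) _; rewrite /C' -[leRHS]mulrA ler_wpM2l //.
    by rewrite sumr_ge0 // => s _; rewrite !mulr_ge0.
  have := BP (fun=> 1) m x; rewrite av1 => /(_ (fun=> lexx _)).
  by under eq_bigr do rewrite scale1r; under [X in _ -> nrm X <= _]eq_bigr do rewrite vec_c.
exists f; split=> [n|].
  apply: (unconditional_basis_criterion (S := S) (C := C')
    (phi := fun j => phi (pr n j))) => //.
  - by move=> j; exact: (vec_in g_span).
  - by move=> i j; rewrite (phi_F (pr n i) (pr n j)) eq_Tagged.
  - move=> H x uH; have inj : injective (pr n).
      by move=> i j /eqP; rewrite eq_Tagged => /eqP.
    have := bound (map (pr n) H) x; rewrite map_inj_uniq // => /(_ uH).
    by rewrite big_map.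
  - move=> x Ex e e0; exists (enum 'I_(d n)); first exact: enum_uniq.
    by rewrite big_enum expand (proj_id uE Ex) eqxx subrr nrm0.
apply: (unconditional_basis_criterion (S := S) (C := C') (phi := phi)) => //.
move=> x _ e e0; have [_ /(nrm_cvg S _)/(_ _ e0)[m _ mP] _ _] := projP uE x.
exists (pairs m) => //; rewrite sum_pairs.
have := mP m (leqnn m).
by under [X in _ -> nrm (_ - X) < _]eq_bigr do rewrite expand.
Qed.

End resolution.

(** * Finite-dimensional Banach lattices *)

Section finite_lattice.
Variables (R : realType) (Y : completeNormedModType R) (le : Y -> Y -> Prop).
Hypothesis HL : is_banach_lattice le.

Let refl := blat_refl HL.
Let anti := blat_anti HL.
Let trans := blat_trans HL.

Lemma blat_addl x y z : le x y -> le (z + x) (z + y).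
Proof. by move=> h; rewrite ![z + _]addrC; exact: (blat_add HL). Qed.

Lemma blat_add2 x y u v : le x y -> le u v -> le (x + u) (y + v).
Proof. by move=> h k; apply: (trans (blat_add HL u h)); exact: blat_addl. Qed.

Lemma blat_subr_ge0 x y : le 0 (y - x) <-> le x y.
Proof.
split=> [/(blat_add HL x)|/(blat_add HL (- x))]; first by rewrite add0r subrK.
by rewrite subrr.
Qed.

Lemma blat_opp x y : le x y -> le (- y) (- x).
Proof. by move=> /blat_subr_ge0 h; apply/blat_subr_ge0; rewrite opprK addrC. Qed.

Lemma blat_opp_le0 x : le 0 x -> le (- x) 0.
Proof. by move=> /blat_opp; rewrite oppr0. Qed.

Lemma blat_add_ge0 x y : le 0 x -> le 0 y -> le 0 (x + y).
Proof. by move=> h k; rewrite -[0]addr0; exact: blat_add2. Qed.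

Lemma blat_scale_ge0 (c : R) x : 0 <= c -> le 0 x -> le 0 (c *: x).
Proof. by move=> c0 /(blat_scale HL c0); rewrite scaler0. Qed.

Lemma blat_scale2 (c c' : R) x : c <= c' -> le 0 x -> le (c *: x) (c' *: x).
Proof.
move=> cc' x0; apply/blat_subr_ge0; rewrite -scalerBl.
by apply: blat_scale_ge0; rewrite ?subr_ge0.
Qed.

Lemma blat_sum_ge0 (I : Type) (r : seq I) (P : pred I) (f : I -> Y) :
  (forall i, P i -> le 0 (f i)) -> le 0 (\sum_(i <- r | P i) f i).
Proof. by move=> h; elim/big_ind: _ => //; exact: blat_add_ge0. Qed.

Definition pospart (x : Y) : Y := sval (cid (blat_join HL x 0)).

Lemma pospart_ge0 x : le 0 (pospart x).
Proof. by rewrite /pospart; case: (cid _) => m /= [h _]; apply: h; right. Qed.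

Lemma pospart_ge x : le x (pospart x).
Proof. by rewrite /pospart; case: (cid _) => m /= [h _]; apply: h; left. Qed.

Lemma pospart_le x y : le x y -> le 0 y -> le (pospart x) y.
Proof. by rewrite /pospart; case: (cid _) => m /= [_ h] xy y0; apply: h => z [->|->]. Qed.

Lemma blat_norm_le x y : le 0 x -> le x y -> `|x| <= `|y|.
Proof.
have lub z : le 0 z -> is_lub le [set z; - z] z.
  move=> z0; split=> [u [->|->]//|u h]; last by apply: h; left.
  exact: trans (blat_opp_le0 z0) z0.
by move=> x0 xy; apply: (blat_norm HL (lub x x0) (lub y _) xy); exact: trans x0 xy.
Qed.

(** The positive part of x is dominated by all eps e, so by monotonicity its
    norm is 0. *)
Lemma blat_archi x e : le 0 e -> (forall eps : R, 0 < eps -> le x (eps *: e)) -> le x 0.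
Proof.
move=> e0 h; suff p0 : pospart x = 0 by rewrite -p0; exact: pospart_ge.
apply/eqP; rewrite -normr_eq0 eq_le normr_ge0 andbT.
apply/ler_addgt0Pl => t t0; rewrite addr0.
have d0 : 0 < `|e| + 1 by rewrite ltr_wpDl.
have q0 : 0 < t / (`|e| + 1) by rewrite divr_gt0.
have := blat_norm_le (pospart_ge0 x) (pospart_le (h _ q0) (blat_scale_ge0 (ltW q0) e0)).
move/le_trans; apply; rewrite normrZ gtr0_norm // mulrAC ler_pdivrMr //.
by rewrite ler_wpM2l ?(ltW t0) // lerDl.
Qed.

(** The Riesz decomposition property, with w2 the positive part of w - x. *)
Lemma blat_riesz w x y : le 0 w -> le 0 x -> le 0 y -> le w (x + y) ->
  exists w1 w2, [/\ w = w1 + w2, le 0 w1, le w1 x, le 0 w2 & le w2 y].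
Proof.
move=> w0 x0 y0 wxy; exists (w - pospart (w - x)), (pospart (w - x)); split.
- by rewrite subrK.
- apply/blat_subr_ge0/pospart_le => //.
  by rewrite -[X in le _ X]addr0; apply: blat_addl; exact: blat_opp_le0.
- apply/blat_subr_ge0; rewrite opprB addrCA addrC -opprB addrC.
  by apply/blat_subr_ge0; exact: pospart_ge.
- exact: pospart_ge0.
- apply: pospart_le => //; apply/blat_subr_ge0; rewrite opprB addrA (addrC y).
  exact/blat_subr_ge0.
Qed.

(** Disjointness of positive elements, in terms of the order alone. *)
Definition orth x y := forall w, le 0 w -> le w x -> le w y -> w = 0.

Lemma orth_sym x y : orth x y -> orth y x.
Proof. by move=> h w w0 wy wx; exact: h. Qed.

Lemma orth0 x : orth x 0.
Proof. by move=> w w0 _ w0'; exact: anti. Qed.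

Lemma orth_le x y z : orth x y -> le z y -> orth x z.
Proof. by move=> h zy w w0 wx wz; apply: h => //; exact: trans wz zy. Qed.

Lemma orthD x y z : le 0 y -> le 0 z -> orth x y -> orth x z -> orth x (y + z).
Proof.
move=> y0 z0 xy xz w w0 wx wyz.
have [w1 [w2 [e w10 w1y w20 w2z]]] := blat_riesz w0 y0 z0 wyz.
have w1w : le w1 w by apply/blat_subr_ge0; rewrite e addrC addKr.
have w2w : le w2 w by apply/blat_subr_ge0; rewrite e addrK.
have w1_0 : w1 = 0 by apply: xy w10 _ w1y; exact: trans w1w wx.
have w2_0 : w2 = 0 by apply: xz w20 _ w2z; exact: trans w2w wx.
by rewrite e w1_0 w2_0 addr0.
Qed.

Lemma orth_sum x (I : Type) (r : seq I) (f : I -> Y) :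
  (forall i, le 0 (f i)) -> (forall i, orth x (f i)) -> orth x (\sum_(i <- r) f i).
Proof.
move=> f0 xf; elim: r => [|i r ih]; first by rewrite big_nil; exact: orth0.
by rewrite big_cons; apply: orthD => //; exact: blat_sum_ge0.
Qed.

Lemma orthZ x y (c : R) : 0 <= c -> le 0 x -> le 0 y -> orth x y -> orth x (c *: y).
Proof.
move=> c0 x0 y0 xy w w0 wx wcy.
have d0 : 0 < 1 + c by rewrite ltr_pwDl.
have dV0 : 0 <= (1 + c)^-1 by rewrite invr_ge0 ltW.
suff : (1 + c)^-1 *: w = 0.
  by move/eqP; rewrite scaler_eq0 invr_eq0 (gt_eqF d0) /= => /eqP.
apply: xy; first exact: blat_scale_ge0.
  apply: (trans _ wx); rewrite -[X in le _ X]scale1r; apply: blat_scale2 => //.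
  by rewrite invf_le1 // lerDl.
apply: trans (blat_scale HL dV0 wcy) _; rewrite scalerA -[X in le _ X]scale1r.
by apply: blat_scale2 => //; rewrite mulrC ler_pdivrMr // mul1r lerDr.
Qed.

Lemma orth_self x : le 0 x -> orth x x -> x = 0.
Proof. by move=> x0; apply. Qed.

(** Disjoint positive elements have their sum as supremum: v lies below
    u + (x - u), and the share of u in v vanishes. *)
Lemma orth_add_le u v x : le 0 u -> le 0 v -> orth u v -> le u x -> le v x -> le (u + v) x.
Proof.
move=> u0 v0 uv ux vx.
have [] := @blat_riesz v u (x - u) v0 u0; first exact/blat_subr_ge0.
  by rewrite addrC subrK.
move=> v1 [v2 [e v10 v1u v20 v2x]].
have v1v : le v1 v by apply/blat_subr_ge0; rewrite e addrC addKr.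
have v1_0 : v1 = 0 by apply: uv.
apply/blat_subr_ge0; rewrite opprD addrA; apply/blat_subr_ge0.
by rewrite e v1_0 add0r.
Qed.

Lemma orth_parts x : orth (pospart x) (pospart x - x).
Proof.
move=> w w0 wp wn; apply: anti => //.
have h : le (pospart x) (pospart x - w).
  apply: pospart_le; last exact/blat_subr_ge0.
  apply/blat_subr_ge0; rewrite addrAC; exact/blat_subr_ge0.
by move/blat_subr_ge0: h; rewrite addrAC subrr add0r => /blat_opp; rewrite opprK oppr0.
Qed.

Definition disjoint_system k (e : 'I_k -> Y) :=
  (forall i, le 0 (e i) /\ e i <> 0) /\ (forall i j, i != j -> orth (e i) (e j)).

(** In a linear relation the positive and the negative part of the coefficients
    give two equal vectors that are disjoint, hence both 0. *)
Lemma disjoint_free k (e : 'I_k -> Y) : disjoint_system e -> free_family e.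
Proof.
move=> [e_pos e_orth] a a0.
pose u := \sum_i Num.max (a i) 0 *: e i; pose v := \sum_i Num.max (- a i) 0 *: e i.
have pos_ge0 (b : 'I_k -> R) i : le 0 (Num.max (b i) 0 *: e i).
  by apply: blat_scale_ge0 (e_pos i).1; rewrite le_max lexx orbT.
have uv : u = v.
  apply/eqP; rewrite -subr_eq0 -sumrB; apply/eqP; rewrite -[RHS]a0.
  apply: eq_bigr => i _; rewrite -scalerBl; congr (_ *: _).
  by rewrite !maxEle; case: ifP; case: ifP; lra.
have uv_orth : orth u v.
  apply: orth_sum => [i|i]; first exact: (pos_ge0 (fun i => - a i)).
  apply/orth_sym/orth_sum => [j|j]; first exact: (pos_ge0 a).
  have [<-|ij] := eqVneq i j.
    have [ai|ai] := leP 0 (a i).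
      by rewrite (max_r (x := - a i)) ?oppr_le0 // scale0r; apply: orth_sym; exact: orth0.
    by rewrite scale0r; exact: orth0.
  apply: orthZ; rewrite ?le_max ?lexx ?orbT //.
  - exact: (pos_ge0 (fun i => - a i)).
  - exact: (e_pos j).1.
  apply/orth_sym/orthZ; rewrite ?le_max ?lexx ?orbT //.
  - exact: (e_pos j).1.
  - exact: (e_pos i).1.
  - by apply: e_orth; rewrite eq_sym.
have zero (b : 'I_k -> R) : \sum_i Num.max (b i) 0 *: e i = 0 -> forall i, b i <= 0.
  move=> b0 i; rewrite leNgt; apply/negP => bi.
  have : Num.max (b i) 0 *: e i = 0.
    apply: anti; last exact: pos_ge0.
    rewrite -[X in le _ X]b0 (bigD1 i) //= -[X in le X _]addr0; apply: blat_addl.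
    by apply: blat_sum_ge0 => j _; exact: pos_ge0.
  rewrite (max_l (ltW bi)) => /eqP; rewrite scaler_eq0 (gt_eqF bi) /= => /eqP.
  exact: (e_pos i).2.
have u0 : u = 0.
  apply: orth_self; last by rewrite {2}uv.
  by apply: blat_sum_ge0 => i _; exact: pos_ge0.
move=> i; apply/eqP; rewrite eq_le (zero a u0 i) /= -oppr_le0.
by apply: (zero (fun i => - a i)); rewrite -/v -uv.
Qed.

Hypothesis fin_card : exists dm, forall k (e : 'I_k -> Y), free_family e -> (k <= dm)%N.

(** Disjoint systems are free, so their length is bounded. *)
Lemma maximal_disjoint : exists k (e : 'I_k -> Y), disjoint_system e /\
  forall e' : 'I_k.+1 -> Y, ~ disjoint_system e'.
Proof.
have [dm dmP] := fin_card; apply: contrapT => no.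
have all k : exists e : 'I_k -> Y, disjoint_system e.
  elim: k => [|k [e eP]].
    by exists (fun=> 0); split=> [[]|[]].
  apply: contrapT => no_e; apply: no; exists k, e; split=> // e' e'P.
  by apply: no_e; exists e'.
have [e eP] := all dm.+1.
by have := dmP _ _ (disjoint_free eP); rewrite ltnn.
Qed.

Section atoms.
Variables (k : nat) (e : 'I_k -> Y).
Hypothesis eP : disjoint_system e.
Hypothesis e_max : forall e' : 'I_k.+1 -> Y, ~ disjoint_system e'.

Let e0 i : le 0 (e i). Proof. exact: (eP.1 i).1. Qed.

Let norm_e i : 0 < `|e i|.
Proof. by rewrite normr_gt0; apply/eqP; exact: (eP.1 i).2. Qed.

Lemma orth_all_eq0 z : le 0 z -> (forall i, orth z (e i)) -> z = 0.
Proof.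
move=> z0 ze; apply: contrapT => zn0.
apply: (e_max (e' := fun i => if unlift ord0 i is Some j then e j else z)).
split=> [i|i j].
  by case: unliftP => [j|] _ //; exact: eP.1.
case: unliftP => [i' ->|->]; case: unliftP => [j' ->|->] //.
- by rewrite (inj_eq lift_inj); exact: eP.2.
- by move=> _; apply: orth_sym.
Qed.

(** Otherwise u and v could take the place of e i, giving a longer disjoint
    system. *)
Lemma atom_dichotomy i u v : le 0 u -> le 0 v -> orth u v ->
  (forall j, j != i -> orth u (e j)) -> (forall j, j != i -> orth v (e j)) ->
  u = 0 \/ v = 0.
Proof.
move=> u0 v0 uv ue ve; have [->|un0] := pselect (u = 0); first by left.
right; apply: contrapT => vn0.
pose e1 j := if j == i then u else e j.
apply: (e_max (e' := fun l => if unlift ord0 l is Some j then e1 j else v)).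
have e1_pos j : le 0 (e1 j) /\ e1 j <> 0.
  by rewrite /e1; case: ifP => // _; exact: eP.1.
have ve1 j : orth v (e1 j).
  by rewrite /e1; case: eqVneq => [_|ji]; [exact: orth_sym|exact: ve].
split=> [l|l m]; first by case: unliftP.
case: unliftP => [l' ->|->]; case: unliftP => [m' ->|->] //.
- rewrite (inj_eq lift_inj) => lm; rewrite /e1.
  case: (eqVneq l' i) => [li|li]; case: (eqVneq m' i) => [mi|mi].
  + by rewrite li mi eqxx in lm.
  + exact: ue.
  + exact/orth_sym/ue.
  + exact: eP.2.
- by move=> _; apply: orth_sym.
Qed.

(** The multiples of the atom e i that lie below x; the largest of them is the
    component of x along e i. *)
Let cut i x : set R := [set t | 0 <= t /\ le (t *: e i) x].

Let cut_sup i x : le 0 x -> has_sup (cut i x).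
Proof.
move=> x0; split; first by exists 0; split=> //; rewrite scale0r.
exists (`|x| / `|e i|) => t [t0 tx]; rewrite ler_pdivlMr //.
rewrite -(ger0_norm t0) -normrZ.
by apply: blat_norm_le tx; exact: blat_scale_ge0.
Qed.

Definition coef i x := sup (cut i x).

Lemma coef_ge0 i x : le 0 x -> 0 <= coef i x.
Proof.
move=> x0; apply: ub_le_sup; first by case: (cut_sup i x0).
by split=> //; rewrite scale0r.
Qed.

Lemma coef_ub i x t : le 0 x -> 0 <= t -> le (t *: e i) x -> t <= coef i x.
Proof. by move=> x0 t0 tx; apply: ub_le_sup => //; case: (cut_sup i x0). Qed.

Lemma coef_le i x : le 0 x -> le (coef i x *: e i) x.
Proof.
move=> x0; apply/blat_subr_ge0; rewrite -opprB -oppr0; apply: blat_opp.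
apply: (blat_archi (e0 i)) => eps eps0.
have [t [t0 tx] tc] := sup_adherent eps0 (cut_sup i x0).
apply: trans (_ : le _ (coef i x *: e i - t *: e i)) _.
  by apply: blat_addl; exact: blat_opp.
by rewrite -scalerBl; apply: blat_scale2 => //; rewrite lerBlDr -lerBlDl ltW.
Qed.

(** By [atom_dichotomy] one of the two parts of x - t e_i vanishes for every
    t >= 0: the elements below e_i are comparable to its multiples, and the
    Archimedean property makes x itself a multiple. *)
Lemma atom i x : le 0 x -> le x (e i) -> x = coef i x *: e i.
Proof.
move=> x0 xe; apply: anti; last exact: coef_le.
have tot t : 0 <= t -> le x (t *: e i) \/ le (t *: e i) x.
  move=> t0; pose z := x - t *: e i.
  have te0 : le 0 (t *: e i) by exact: blat_scale_ge0.
  have px : le (pospart z) x.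
    apply: pospart_le => //; rewrite -[X in le _ X]subr0.
    by apply: blat_addl; exact: blat_opp.
  have pz : le (pospart z) (e i) by exact: trans px xe.
  have nz : le (pospart z - z) (t *: e i).
    have -> : t *: e i = x - z by rewrite /z opprB addrC subrK.
    exact: (blat_add HL).
  have oe j : j != i -> orth (e i) (e j) by rewrite eq_sym; exact: eP.2.
  have nz0 : le 0 (pospart z - z) by apply/blat_subr_ge0; exact: pospart_ge.
  have [|||j ji|j ji|z0|z0] := @atom_dichotomy i (pospart z) (pospart z - z).
  - exact: pospart_ge0.
  - exact: nz0.
  - exact: orth_parts.
  - by apply/orth_sym; apply: orth_le pz; apply/orth_sym; exact: oe.
  - apply/orth_sym; apply: orth_le nz; apply: orthZ => //; apply/orth_sym; exact: oe.
  - left; apply/blat_subr_ge0; rewrite -opprB -/z -oppr0; apply: blat_opp.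
    by rewrite -z0; exact: pospart_ge.
  - right; apply/blat_subr_ge0; rewrite -/z.
    by move/eqP: z0; rewrite subr_eq0 => /eqP <-; exact: pospart_ge0.
apply/blat_subr_ge0; rewrite -opprB -oppr0; apply: blat_opp.
apply: (blat_archi (e0 i)) => eps eps0.
have c0 := coef_ge0 i x0.
have [h|h] := tot (coef i x + eps) (addr_ge0 c0 (ltW eps0)).
  have := blat_add HL (- (coef i x *: e i)) h.
  by rewrite scalerDl addrAC subrr add0r.
have := coef_ub x0 (addr_ge0 c0 (ltW eps0)) h.
by rewrite gerDl leNgt eps0.
Qed.

(** The sum y of the components lies below x because they are disjoint.  What is
    left of x is disjoint from every atom, since an element under both would
    enlarge a component; by maximality nothing is left. *)
Lemma pos_expand x : le 0 x -> x = \sum_i coef i x *: e i.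
Proof.
move=> x0; set y := \sum_i _.
have ce0 i : le 0 (coef i x *: e i) by apply: blat_scale_ge0 => //; exact: coef_ge0.
have yx : le y x.
  rewrite /y; elim: (index_enum _) (index_enum_uniq 'I_k) => [|i r ih] /=.
    by rewrite big_nil.
  move=> /andP[ir ur]; rewrite big_cons; apply: orth_add_le => //.
  - exact: blat_sum_ge0.
  - rewrite big_seq_cond; apply: (@orth_le _ (\sum_(j <- r) if j == i then 0 else coef j x *: e j)).
      apply: orth_sum => j; case: eqVneq => ji //; first exact: orth0.
      apply/orth_sym/orthZ => //; first exact: coef_ge0.
      apply/orth_sym/orthZ => //; first exact: coef_ge0.
      by apply: eP.2; rewrite eq_sym.
    rewrite -big_seq_cond [X in le X _]
      (eq_big_seq (fun j => if j == i then 0 else coef j x *: e j)).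
      exact: refl.
    by move=> j jr; case: eqVneq => // ji; rewrite -ji jr in ir.
  - exact: coef_le.
  - exact: ih.
have z0 : le 0 (x - y) by apply/blat_subr_ge0.
apply/eqP; rewrite -subr_eq0; apply/eqP/orth_all_eq0 => // i w w0 wz we.
have wc := atom w0 we.
have c0 := coef_ge0 i w0.
suff -> : w = 0 by [].
rewrite wc; have -> : coef i w = 0; last by rewrite scale0r.
apply/eqP; rewrite eq_le c0 andbT -(lerD2l (coef i x)) addr0.
apply: coef_ub => //; first by rewrite addr_ge0 // coef_ge0.
rewrite scalerDl -wc; apply: trans (_ : le _ (coef i x *: e i + (x - y))) _.
  exact: blat_addl.
have cy : le (coef i x *: e i) y.
  rewrite /y (bigD1 i) //= -[X in le X _]addr0; apply: blat_addl.
  exact: blat_sum_ge0.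
by have := blat_add HL (x - y) cy; rewrite (addrC y) subrK.
Qed.

Lemma lattice_expand x : exists c, x = lincomb e c.
Proof.
exists (fun i => coef i (pospart x) - coef i (pospart x - x)).
rewrite lincombB /lincomb -!pos_expand; first by rewrite opprB addrC subrK.
- by apply/blat_subr_ge0; exact: pospart_ge.
- exact: pospart_ge0.
Qed.

Lemma lattice_order c : le 0 (lincomb e c) <-> forall i, 0 <= c i.
Proof.
split=> [c0 i|c0]; last first.
  by apply: blat_sum_ge0 => i _; exact: blat_scale_ge0.
have := pos_expand c0; rewrite -/(lincomb e (fun i => coef i (lincomb e c))).
by move=> /(lincomb_inj (disjoint_free eP)) ->; exact: coef_ge0.
Qed.

Lemma lattice_le c c' : le (lincomb e c) (lincomb e c') <-> forall i, c i <= c' i.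
Proof.
rewrite -blat_subr_ge0 -lincombB lattice_order.
by split=> h i; have := h i; rewrite subr_ge0.
Qed.

End atoms.

(** A maximal disjoint system consists of atoms, and it is a basis in which the
    order is that of the coordinates. *)
Theorem finite_lattice_coordinates : exists k (e : 'I_k -> Y),
  [/\ free_family e, forall x, exists c, x = lincomb e c &
    forall c c', le (lincomb e c) (lincomb e c') <-> forall i, c i <= c' i].
Proof.
have [k [e [eP e_max]]] := maximal_disjoint; exists k, e; split.
- exact: disjoint_free.
- by move=> x; exact: lattice_expand.
- by move=> c c'; exact: lattice_le.
Qed.

End finite_lattice.

(** * Riesz products and the Khintchine inequality *)

Section rademacher_real.
Variable R : realType.
Local Notation M := (expR (1 : R)).

Lemma sum_signs_prod (A : comPzRingType) m (F : 'I_m -> bool -> A) :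
  \sum_(e : {ffun 'I_m -> bool}) \prod_k F k (e k) = \prod_k (F k true + F k false).
Proof.
rewrite -(bigA_distr_bigA F); apply: eq_bigr => k _.
by rewrite big_bool.
Qed.

(** The function is Im (prod_k (1 + i e_k c_k)).  Multiplying the product by e_n
    and averaging, each factor with k <> n becomes 1 and the factor n becomes
    i c_n; the modulus is prod_k (1 + c_k^2)^(1/2), at most exp (1/2). *)
Lemma riesz_product m (c : 'I_m -> R) : \sum_n c n ^+ 2 <= 1 ->
  exists g : {ffun 'I_m -> bool} -> R,
    (forall n, \sum_(e : {ffun 'I_m -> bool}) (-1) ^+ (e n) * g e = (2 ^ m)%:R * c n) /\
    forall e, `|g e| <= M.
Proof.
move=> c1.
have signE (b : bool) : (-1) ^+ b = (if b then -1 else 1) :> R by case: b.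
pose G (e : {ffun 'I_m -> bool}) : R[i] := \prod_k Complex 1 ((-1) ^+ (e k) * c k).
exists (fun e => complex.Im (G e)); split=> [n|e].
  pose F k b : R[i] := (if k == n then (((-1) ^+ (b : bool) : R)%:C) else 1)
    * Complex 1 ((-1) ^+ b * c k).
  have -> : \sum_(e : {ffun 'I_m -> bool}) (-1) ^+ (e n) * complex.Im (G e) =
      complex.Im (\sum_(e : {ffun 'I_m -> bool}) \prod_k F k (e k)).
    rewrite raddf_sum; apply: eq_bigr => e _.
    rewrite big_split /= -/(G e) (bigD1 n) //= eqxx big1 ?mulr1; last first.
      by move=> k /negbTE ->.
    by case: (G e) => x y /=; rewrite mul0r addr0.
  rewrite sum_signs_prod (bigD1 n) //=.
  have -> : \prod_(k < m | k != n) (F k true + F k false) =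
      ((\prod_(k < m | k != n) 2 : R))%:C.
    rewrite rmorph_prod; apply: eq_bigr => k /negbTE kn.
    rewrite /F kn !mul1r !signE; apply/eqP; rewrite eq_complex /=.
    by apply/andP; split; apply/eqP; ring.
  have -> : F n true + F n false = Complex 0 (2 * c n).
    rewrite /F eqxx !signE; apply/eqP; rewrite eq_complex /=.
    by apply/andP; split; apply/eqP; ring.
  rewrite prodr_const /=.
  have -> : (2 ^ m)%:R = 2 * 2 ^+ #|[pred k : 'I_m | k != n]| :> R.
    rewrite -exprS natrX; congr (_ ^+ _).
    have := cardC1 n; rewrite card_ord => ->; rewrite prednK //.
    exact: leq_ltn_trans (ltn_ord n).
  rewrite mul0r add0r; ring.
have normG : `|G e| ^+ 2 = (\prod_k (1 + c k ^+ 2))%:C.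
  rewrite normr_prod -prodrXl rmorph_prod; apply: eq_bigr => k _.
  rewrite -add_Re2_Im2 /=; congr (_ %:C).
  by rewrite expr1n exprMn -exprM mulnC exprM sqrrN expr1n expr1n mul1r.
have G_le : \prod_k (1 + c k ^+ 2) <= M.
  apply: le_trans (_ : \prod_k expR (c k ^+ 2) <= _).
    apply: ler_prod => k _; rewrite addr_ge0 ?sqr_ge0 //=.
    exact: expR_ge1Dx.
  by rewrite -expR_sum ler_expR.
have M1 : 1 <= M by rewrite -expR0 ler_expR.
have sq : complex.Im (G e) ^+ 2 <= M ^+ 2.
  apply: le_trans (_ : M <= _); last by rewrite expr2 ler_peMl // (le_trans ler01).
  apply: le_trans G_le; have := normG; rewrite -add_Re2_Im2 => /(congr1 (@complex.Re _)) /= <-.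
  by rewrite lerDr sqr_ge0.
rewrite -(@ler_pXn2r _ 2) ?nnegrE ?expR_ge0 //.
by rewrite real_normK ?num_real.
Qed.

Lemma riesz_product_scaled m (c : 'I_m -> R) t : 0 <= t -> \sum_n c n ^+ 2 <= t ^+ 2 ->
  exists g : {ffun 'I_m -> bool} -> R,
    (forall n, (2 ^ m)%:R^-1 * \sum_(e : {ffun 'I_m -> bool}) (-1) ^+ (e n) * g e = c n) /\
    forall e, `|g e| <= M * t.
Proof.
move=> t0 ct; have two0 : (2 ^ m)%:R != 0 :> R by rewrite pnatr_eq0 expn_eq0.
have [tz|tn0] := eqVneq t 0.
  have c0 n : c n = 0.
    apply/eqP; rewrite -sqrf_eq0 eq_le sqr_ge0 andbT.
    move: ct; rewrite tz expr0n /= (bigD1 n) //= => h.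
    by apply: le_trans h; rewrite lerDl; apply: sumr_ge0 => k _; exact: sqr_ge0.
  exists (fun=> 0); split=> [n|e]; last by rewrite normr0 tz mulr0.
  by rewrite big1 ?mulr0 ?c0 // => e _; rewrite mulr0.
have {}tn0 : 0 < t by rewrite lt_neqAle eq_sym tn0.
have [|g [g1 g2]] := @riesz_product m (fun n => c n / t).
  under eq_bigr do rewrite exprMn.
  by rewrite -mulr_suml exprVn ler_pdivrMr ?exprn_gt0 // mul1r.
exists (fun e => t * g e); split=> [n|e].
  under eq_bigr do rewrite mulrCA.
  rewrite -mulr_sumr g1 mulrCA mulKf // mulrC divfK // gt_eqF //.
by rewrite normrM gtr0_norm // mulrC ler_wpM2r // ltW.
Qed.

(** Duality: with the Riesz product g for v itself, the sum of the squares of v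
    is the mean of g(e) sum_n e_n v_n. *)
Lemma khintchine m (v : 'I_m -> R) : Num.sqrt (\sum_n v n ^+ 2) <=
  M * ((2 ^ m)%:R^-1 * \sum_(e : {ffun 'I_m -> bool}) `|\sum_n (-1) ^+ (e n) * v n|).
Proof.
set s := Num.sqrt _; set A := _^-1 * _.
have s0 : 0 <= s by exact: sqrtr_ge0.
have s2 : s ^+ 2 = \sum_n v n ^+ 2 by rewrite sqr_sqrtr // sumr_ge0 // => n _; exact: sqr_ge0.
have [|g [g1 g2]] := @riesz_product_scaled m v s s0; first by rewrite s2.
have two0 : 0 <= (2 ^ m)%:R^-1 :> R by rewrite invr_ge0.
have key : s ^+ 2 <= s * (M * A).
  rewrite s2; have -> : \sum_n v n ^+ 2 = (2 ^ m)%:R^-1 *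
      \sum_(e : {ffun 'I_m -> bool}) g e * \sum_n (-1) ^+ (e n) * v n.
    under [in RHS]eq_bigr do rewrite mulr_sumr.
    rewrite exchange_big mulr_sumr; apply: eq_bigr => n _ /=.
    rewrite expr2 -{1}(g1 n) -mulrA mulr_suml; congr (_ * _).
    by apply: eq_bigr => e _; ring.
  have -> : s * (M * A) = (2 ^ m)%:R^-1 *
      \sum_(e : {ffun 'I_m -> bool}) M * s * `|\sum_n (-1) ^+ (e n) * v n|.
    by rewrite /A -mulr_sumr; ring.
  rewrite ler_wpM2l //.
  apply: ler_sum => e _; apply: le_trans (ler_norm _) _; rewrite normrM.
  by rewrite ler_wpM2r.
have [sz|sn0] := eqVneq s 0.
  rewrite sz mulr_ge0 ?expR_ge0 // mulr_ge0 // sumr_ge0 // => e _; exact: normr_ge0.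
have {}sn0 : 0 < s by rewrite lt_neqAle eq_sym sn0.
by rewrite -(ler_pM2l sn0) -expr2.
Qed.

End rademacher_real.

(** * Reduction of the theorem to coordinatewise lattice norms *)

Section lattice_models.
Variables (R : realType) (K : numFieldType) (S : scalars R K).
Local Notation nrm := (nrm S).
Local Notation av := (av S).

Lemma free_family_card (X : normedModType K) d k (e : 'I_k -> X) :
  has_dim [set: X] d -> free_family e -> (k <= d)%N.
Proof.
move=> [g [_ gE]] fe.
have /choice[M eM] : forall i, exists a : 'I_d -> K, e i = \sum_j a j *: g j.
  move=> i; have : [set: X] (e i) by [].
  by rewrite gE => -[a _ <-]; exists a.
pose A := \matrix_(i, j) M i j.
suff /eqP <- : row_free A by exact: rank_leq_col.
rewrite -kermx_eq0; apply/rowV0P => u /sub_kermxP uA.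
apply/rowP => i; rewrite mxE; apply: (fe (fun i => u 0 i)).
rewrite /lincomb; under eq_bigr do rewrite eM scaler_sumr.
rewrite exchange_big big1 // => j _.
under eq_bigr do rewrite scalerA.
have uAj : \sum_l u 0 l * M l j = 0.
  have /matrixP/(_ 0 j) := uA; rewrite !mxE; apply: etrans.
  by apply: eq_bigr => l _; rewrite mxE.
by rewrite -scaler_suml uAj scale0r.
Qed.

(** What real lattices and complexifications have in common: up to coordinates,
    the norm depends monotonically on the absolute values only. *)
Definition lattice_model (Y : normedModType K) : Prop :=
  exists k (e : 'I_k -> Y) (rho : ('I_k -> R) -> R),
  [/\ forall s t, rho (fun i => s i + t i) <= rho s + rho t,
      forall (c : R) s, 0 <= c -> rho (fun i => c * s i) <= c * rho s
    & forall s t, (forall i, 0 <= s i <= t i) -> rho s <= rho t] /\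
  [/\ free_family e, forall y, exists z, y = lincomb e z
    & forall z, nrm (lincomb e z) = rho (fun i => av (z i))].

(** The norm of B is absorbed into rho, so that the constant of the
    factorization bounds the first operator. *)
Lemma lust_of_models (lat : completeNormedModType K -> Prop) (X : completeNormedModType K) :
  (forall Y : completeNormedModType K, lat Y -> fin_dim [set: Y] -> lattice_model Y) ->
  has_lust_wrt lat X -> coordinate_lust S X.
Proof.
move=> model [C CP].
have C_ge0 : 0 <= C.
  have [Y [A [B [a [b [_ _ [[a0 _ _] [b0 _ _]] abC _]]]]]] := CP _ (fin_dim_zero X).
  by apply: le_trans abC; rewrite mulr_ge0.
have [c c0 Cc] := exists_emb_ge S C_ge0.
exists c => // F fF.
have [Y [A [B [a [b [[latY fY] A_lin [[a0 A_le _] [b0 B_le _]] abC BA]]]]]] := CP F fF.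
have [a' a'0 ea] := exists_emb_ge S a0; have [b' b'0 eb] := exists_emb_ge S b0.
have [k [e [rho [[rhoD rhoZ rho_le] [fe span normE]]]]] := model Y latY fY.
have [cf cfP] := choice span.
exists k, (fun x => cf (A x)), (fun i => B (e i)), (fun s => b' * rho s); split.
  split=> [s t|t s t0|s t st].
  - by rewrite -mulrDr ler_wpM2l.
  - by rewrite mulrCA ler_wpM2l // rhoZ.
  - by rewrite ler_wpM2l // rho_le.
have B_comb z : lincomb (fun i => B (e i)) z = B (lincomb e z).
  by rewrite /lincomb linear_sum; apply: eq_bigr => i _; rewrite linearZ.
split=> [z|x Fx|t x y Fx Fy i|x Fx].
- rewrite B_comb -normE -(emb_le S) rmorphM /= !emb_nrm -eb.
  exact: B_le.
- rewrite -normE -cfP; apply: le_trans (_ : b' * (a' * nrm x) <= _).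
    rewrite ler_wpM2l // -(emb_le S) rmorphM /= !emb_nrm -ea.
    exact: A_le.
  rewrite mulrA ler_wpM2r ?nrm_ge0 // -(emb_le S) -Cc rmorphM /= -ea -eb mulrC.
  exact: abC.
- suff -> : cf (A (t *: x + y)) = (fun i => t * cf (A x) i + cf (A y) i) by [].
  apply: (lincomb_inj fe); rewrite -cfP A_lin // lincombD lincombZ.
  by rewrite -!cfP.
- by rewrite B_comb -cfP BA.
Qed.

(** The theorem for any scalars and any class of lattices that has coordinates;
    near-Auerbach bases of the E_n serve to express operators as matrices. *)
Theorem unconditional_basis_of_lust (lat : completeNormedModType K -> Prop)
    (X : completeNormedModType K) (E : nat -> set X) :
  (forall Y : completeNormedModType K, lat Y -> fin_dim [set: Y] -> lattice_model Y) ->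
  has_lust_wrt lat X -> uniform_ufdd E ->
  exists f : forall n, 'I_(fdim (E n)) -> X,
       (forall n, unconditional_basis (E n) (f n)) /\
       unconditional_basis [set: X]
         (fun p : {n : nat & 'I_(fdim (E n))} => f (tag p) (tagged p)).
Proof.
move=> model lust [uE [N dN]].
have hd n : has_dim (E n) (fdim (E n)).
  have [d hd] := uE.1 n; rewrite /fdim; case: xgetP => // /(_ d).
  by move=> h; case: (h hd).
pose g n := sval (cid (near_auerbach S (hd n))).
have gP n := svalP (cid (near_auerbach S (hd n))).
apply: (resolution_basis uE (g := g) _ _ _ _ dN (lust_of_models model lust)) => n;
  by case: (gP n).
Qed.

End lattice_models.

(** * Real and complex scalars *)

Lemma size_rank1_poly (A : nzRingType) (t : A) d :
  (size (('X^d - t *: 'X^(d.-1))%R : {poly A}) <= d.+1)%N.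
Proof.
apply: leq_trans (size_polyD _ _) _; rewrite geq_max size_polyXn leqnn size_polyN /=.
by apply: leq_trans (size_scale_leq _ _) _; rewrite size_polyXn; lia.
Qed.

Section real_scalars.
Variable R : realType.

(** The limit is the supremum of the numbers that are below the sequence on a
    set of the ultrafilter. *)
Lemma real_ultra_cvg (G : set_system nat) (z : nat -> R) (b : R) :
  UltraFilter G -> (forall k, `|z k| <= b) -> exists l : R, z k @[k --> G] --> l.
Proof.
move=> UG zb; have PG : ProperFilter G by exact: ultra_proper.
pose A := [set t | G [set k | t <= z k]].
have supA : has_sup A.
  split.
    exists (- b); apply: filterS filterT => k _ /=.
    by have := zb k; rewrite ler_norml => /andP[].
  exists b => t At; have [k /= tk] := filter_ex At.
  by apply: le_trans tk _; have := zb k; rewrite ler_norml => /andP[].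
exists (sup A); apply/cvgrPdist_lt => e e0.
have [t At te] := sup_adherent e0 supA.
have up : G [set k | z k < sup A + e].
  have [|h] := in_ultra_setVsetC [set k | sup A + e <= z k] UG.
    move=> h; have := ub_le_sup supA.2 (h : A (sup A + e)).
    by rewrite gerDl leNgt e0.
  by apply: filterS h => k /= /negP; rewrite -ltNge.
apply: filterS2 At up => k /= h1 h2.
by rewrite distrC ltr_distl h2 (lt_le_trans te).
Qed.

Lemma real_grid (e : R) : 0 < e -> exists (L : nat) (cl : R -> 'I_L),
    forall x y, `|x| <= 1 -> `|y| <= 1 -> cl x = cl y -> `|x - y| <= e.
Proof.
move=> e0.
pose u (x : R) := (x + 1) / e; pose L := (Num.truncn (2 / e)).+1.
exists L, (fun x => inord (Num.truncn (u x))).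
have u_itv x : `|x| <= 1 -> 0 <= u x <= 2 / e.
  rewrite ler_norml => /andP[h1 h2]; rewrite /u divr_ge0 ?ler_pM2r ?invr_gt0 ?(ltW e0) //=; lra.
have uL x : `|x| <= 1 -> (Num.truncn (u x) < L)%N.
  by move=> /u_itv/andP[_ h]; rewrite ltnS; exact: le_truncn.
move=> x y x1 y1 /(congr1 (@nat_of_ord _)); rewrite !inordK ?uL // => xy.
have /andP[ux0 _] := u_itv x x1; have /andP[uy0 _] := u_itv y y1.
have /andP[h1 h2] := truncn_itv ux0; have /andP[h3 h4] := truncn_itv uy0.
rewrite xy in h1 h2.
have : `|u x - u y| <= 1.
  rewrite ler_norml -natr1 in h2 h4 *; apply/andP; split; lra.
rewrite /u -mulrBl normrM normfV (gtr0_norm e0) ler_pdivrMr // mul1r.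
by rewrite opprD addrACA subrr addr0.
Qed.

(** The limit polynomial X^(d-1) (X - t) changes sign between t - |t| / 2 and
    t + |t| / 2; so does p k, for k near the limit. *)
Lemma real_root_near (G : set_system nat) (p : nat -> {poly R}) (d : nat) (t : R) :
    ProperFilter G -> (0 < d)%N -> t != 0 ->
    (forall k, p k \is monic /\ size (p k) = d.+1) ->
    (forall i, (p k)`_i @[k --> G] --> ('X^d - t *: 'X^(d.-1))`_i) ->
    \forall k \near G, exists l, root (p k) l /\ `|l - t| <= `|t| / 2.
Proof.
move=> PG d0 t0 pP pc.
have t_gt0 : 0 < `|t| by rewrite normr_gt0.
pose P : {poly R} := 'X^d - t *: 'X^(d.-1).
have PE z : P.[z] = z ^+ d.-1 * (z - t).
  by rewrite /P !hornerE mulrBr -exprSr prednK // (mulrC t).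
pose a := t - `|t| / 2; pose b := t + `|t| / 2.
have sizeP : (size P <= d.+1)%N.
  exact: size_rank1_poly.
have cvg_at z : (p k).[z] @[k --> G] --> P.[z].
  apply: (@pcvg_horner _ _ PG _ _ _ _ d.+1) => //; last exact: cvg_cst.
  by move=> k; rewrite (pP k).2.
have neg : P.[a] * P.[b] < 0.
  rewrite !PE mulrACA -exprMn /a /b.
  have -> : (t - `|t| / 2) * (t + `|t| / 2) = 3 / 4 * t ^+ 2.
    by rewrite -subr_sqr exprMn real_normK ?num_real //; field.
  rewrite [X in _ * X](_ : _ = - (`|t| ^+ 2 / 4)); last by field.
  rewrite pmulr_rlt0 ?oppr_lt0 ?divr_gt0 ?exprn_gt0 //.
  by rewrite mulr_gt0 ?divr_gt0 // exprn_even_gt0 //= t0 orbT.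
have prod_cvg : (p k).[a] * (p k).[b] @[k --> G] --> P.[a] * P.[b].
  exact: cvgM.
have near_neg : \forall k \near G, (p k).[a] * (p k).[b] < 0.
  by have /cvgrPdist_lt/(_ (- (P.[a] * P.[b]))) := prod_cvg; rewrite oppr_gt0 => /(_ neg);
    apply: filterS => k; rewrite ltr_distlC => /andP[_]; rewrite subrr.
apply: filterS near_neg => k h.
have ab : a <= b by rewrite /a /b; lra.
have [l] := polyrcf.poly_ivtoo ab h.
rewrite in_itv /= /a /b => /andP[h1 h2] rl; exists l; split=> //.
by rewrite ler_norml; apply/andP; split; lra.
Qed.

End real_scalars.

Section real_instance.
Variable R : realType.
Local Notation M := (expR (1 : R)).

Lemma real_rademacher m (u v : 'I_m -> R) : (forall n, `|u n| <= `|v n|) ->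
  exists g : {ffun 'I_m -> bool} -> R,
    (forall n, (2 ^ m)%:R^-1 * \sum_(e : {ffun 'I_m -> bool}) (-1) ^+ (e n) * g e = u n) /\
    forall e, `|g e| <= M ^+ 2 *
      ((2 ^ m)%:R^-1 * \sum_(e' : {ffun 'I_m -> bool}) `|\sum_n (-1) ^+ (e' n) * v n|).
Proof.
move=> uv; have s0 := sqrtr_ge0 (\sum_n v n ^+ 2).
have [|g [g1 g2]] := riesz_product_scaled (c := u) s0.
  rewrite sqr_sqrtr; last by apply: sumr_ge0 => n _; exact: sqr_ge0.
  apply: ler_sum => n _; rewrite -(real_normK (num_real (u n))) -(real_normK (num_real (v n))).
  by rewrite lerXn2r ?nnegrE.
exists g; split=> // e; apply: le_trans (g2 e) _.
by rewrite expr2 -mulrA ler_wpM2l ?expR_ge0 //; exact: khintchine.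
Qed.

Definition real_scalars : scalars R R.
Proof.
refine (@Scalars R R (idfun : {rmorphism R -> R}) id _ _ _ _ _ _) => //.
- exact: real_ultra_cvg.
- exact: real_root_near.
- exact: real_grid.
- exists (M ^+ 2); split; first exact: sqr_ge0.
  exact: real_rademacher.
Defined.

(** The modulus in the lattice is taken coordinatewise, and an element has the
    same norm as its modulus. *)
Lemma real_lattice_model (Y : completeNormedModType R) :
  real_banach_lattice Y -> fin_dim [set: Y] -> lattice_model real_scalars Y.
Proof.
move=> [le HL] [d hd].
have [|k [e [fe span leE]]] := finite_lattice_coordinates HL.
  by exists d => k e; exact: free_family_card.
exists k, e, (fun s => `|lincomb e s|).
have lin0 : 0 = lincomb e (fun=> 0) by rewrite /lincomb big1 // => i _; rewrite scale0r.
split; split=> //.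
- by move=> s t; rewrite lincombD ler_normD.
- by move=> c s c0; rewrite lincombZ normrZ ger0_norm.
- move=> s t st; apply: (blat_norm_le HL); first by rewrite lin0; apply/leE => i; case/andP: (st i).
  by apply/leE => i; case/andP: (st i).
move=> z; change (`|lincomb e z| = `|lincomb e (fun i => `|z i|)|).
have lub (w : 'I_k -> R) : is_lub le [set lincomb e w; - lincomb e w]
    (lincomb e (fun i => `|w i|)).
  split=> [x [->|->]|x h]; first by apply/leE => i; exact: ler_norm.
    by rewrite -lincombN; apply/leE => i; rewrite -normrN ler_norm.
  have [c xc] := span x; rewrite xc; apply/leE => i.
  have h1 : le (lincomb e w) (lincomb e c) by rewrite -xc; apply: h; left.
  have h2 : le (lincomb e (fun i => - w i)) (lincomb e c).
    by rewrite -xc lincombN; apply: h; right.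
  by rewrite ler_norml lerNl ((leE _ _).1 h1) ((leE _ _).1 h2).
have lub2 := lub (fun i => `|z i|).
have idem : (fun i => `| `|z i| |) = (fun i => `|z i|) by apply/funext => i; rewrite normr_id.
rewrite idem in lub2.
apply/eqP; rewrite eq_le.
by rewrite (blat_norm HL (lub z) lub2 (blat_refl HL _))
  (blat_norm HL lub2 (lub z) (blat_refl HL _)).
Qed.

End real_instance.

Section complex_instance.
Variable R : realType.
Local Notation M := (expR (1 : R)).
Local Notation C := (R[i]).
Let CF : numFieldType := R[i].
Local Notation Re := (@complex.Re R).
Local Notation Im := (@complex.Im R).

Lemma norm_complex_real (x : R) : `|x%:C| = `|x|%:C.
Proof. by rewrite normc_def /= expr0n /= addr0 sqrtr_sqr. Qed.

Lemma complex_split (z : C) : z = (Re z)%:C + 'i * (Im z)%:C.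
Proof. by case: z => x y; apply/eqP; rewrite eq_complex /=; apply/andP; split; apply/eqP; ring. Qed.

Lemma norm_complex_le (z : C) : `|z| <= (`|Re z| + `|Im z|)%:C.
Proof.
rewrite {1}(complex_split z); apply: le_trans (ler_normD _ _) _.
rewrite normrM !norm_complex_real (_ : `|'i : C| = 1) ?mul1r -?rmorphD //.
by rewrite normc_def /= expr0n /= add0r expr1n sqrtr1.
Qed.

Lemma normc_ge_Im (z : C) : `|Im z|%:C <= `|z|.
Proof. by rewrite normc_def lecR -sqrtr_sqr ler_wsqrtr // lerDr sqr_ge0. Qed.

Lemma norm_Re_le (z : C) (b : R) : `|z| <= b%:C -> `|Re z| <= b.
Proof. by move=> zb; rewrite -lecR; apply: le_trans (normc_ge_Re _) zb. Qed.

Lemma norm_Im_le (z : C) (b : R) : `|z| <= b%:C -> `|Im z| <= b.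
Proof. by move=> zb; rewrite -lecR; apply: le_trans (normc_ge_Im _) zb. Qed.

Lemma nonneg_complex (z : C) : 0 <= z -> (Re z)%:C = z.
Proof. by case: z => x y; rewrite lecE /= => /andP[/eqP -> _]. Qed.

Lemma complex_ultra_cvg (G : set_system nat) (z : nat -> CF) (b : R) :
  UltraFilter G -> (forall k, `|z k| <= b%:C) -> exists l : CF, z k @[k --> G] --> l.
Proof.
move=> UG zb; have PG : ProperFilter G by exact: ultra_proper.
have [x xP] := real_ultra_cvg UG (fun k => norm_Re_le (zb k)).
have [y yP] := real_ultra_cvg UG (fun k => norm_Im_le (zb k)).
exists (Complex x y : CF); apply/cvgrPdist_lt => e e0.
have er := nonneg_complex (ltW e0).
have r0 : 0 < Re e / 2 by rewrite divr_gt0 // -ltcR er.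
move/cvgrPdist_lt/(_ _ r0): xP; move/cvgrPdist_lt/(_ _ r0): yP.
apply: filterS2 => k h1 h2; rewrite -er; apply: le_lt_trans (norm_complex_le _) _.
rewrite ltcR; case: (z k) h1 h2 => zx zy /= h1 h2; lra.
Qed.

Lemma complex_grid (e : R) : 0 < e -> exists (L : nat) (cl : C -> 'I_L),
    forall x y, `|x| <= 1 -> `|y| <= 1 -> cl x = cl y -> `|x - y| <= e%:C.
Proof.
move=> e0; have e20 : 0 < e / 2 by rewrite divr_gt0.
have [L [cl clP]] := real_grid e20.
exists #|{: 'I_L * 'I_L}|, (fun z => enum_rank (cl (Re z), cl (Im z))).
move=> x y x1 y1 /enum_rank_inj[hR hI].
apply: le_trans (norm_complex_le _) _; rewrite lecR.
have := clP _ _ (norm_Re_le x1) (norm_Re_le y1) hR.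
have := clP _ _ (norm_Im_le x1) (norm_Im_le y1) hI.
by case: x {x1 hR hI} => ? ?; case: y {y1} => ? ? /=; lra.
Qed.

(** The modulus of the monic polynomial p k at t is the product of the distances
    from t to its roots.  It tends to 0, so these distances cannot all exceed
    |t| / 2. *)
Lemma complex_root_near (G : set_system nat) (p : nat -> {poly CF}) (d : nat) (t : CF) :
    ProperFilter G -> (0 < d)%N -> t != 0 ->
    (forall k, p k \is monic /\ size (p k) = d.+1) ->
    (forall i, (p k)`_i @[k --> G] --> ('X^d - t *: 'X^(d.-1))`_i) ->
    \forall k \near G, exists l, root (p k) l /\ `|l - t| <= `|t| / 2.
Proof.
move=> PG d0 t0 pP pc.
pose P : {poly CF} := 'X^d - t *: 'X^(d.-1).
have Pt : P.[t] = 0 by rewrite /P !hornerE -{1}(prednK d0) exprS subrr.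
have lim : (p k).[t] @[k --> G] --> P.[t].
  apply: (@pcvg_horner _ _ PG _ _ _ _ d.+1) => //; last exact: cvg_cst.
    exact: size_rank1_poly.
  by move=> k; rewrite (pP k).2.
have t_gt0 : 0 < `|t| by rewrite normr_gt0.
have e0 : 0 < (`|t| / 2) ^+ d by rewrite exprn_gt0 // divr_gt0.
have near_small : \forall k \near G, `|(p k).[t]| < (`|t| / 2) ^+ d.
  move/cvgrPdist_lt/(_ _ e0): lim; apply: filterS => k.
  by rewrite Pt sub0r normrN.
apply: filterS near_small => k small.
have [r pr] := closed_field_poly_normal (p k).
have [pm ps] := pP k.
move: pr; rewrite (monicP pm) scale1r => pr.
have [/hasP[l lr lt]|/hasPn no] := boolP (has (fun l => `|t - l| <= `|t| / 2) r).
  by exists l; rewrite distrC lt; split=> //; rewrite pr root_prod_XsubC.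
exfalso; move: small; rewrite pr horner_prod normr_prod.
have size_r : size r = d by move: ps; rewrite pr size_prod_XsubC => -[].
have -> : (`|t| / 2) ^+ d = \prod_(z <- r) (`|t| / 2).
  by rewrite big_const_seq count_predT size_r iter_mulr_1.
apply/negP; rewrite -real_leNgt ?ger0_real ?prodr_ge0 //.
rewrite big_seq [leRHS]big_seq; apply: ler_prod => z zr.
rewrite divr_ge0 //= !hornerE; apply: ltW.
by rewrite real_ltNge ?ger0_real ?divr_ge0 // no.
Qed.

(** Real and imaginary parts of u are treated separately; both are dominated by
    the l2 norms of the real and imaginary parts of v, hence by the mean. *)
Lemma complex_rademacher m (u v : 'I_m -> C) : (forall n, `|u n| <= `|v n|) ->
  exists g : {ffun 'I_m -> bool} -> C,
    (forall n, (2 ^ m)%:R^-1 * \sum_(e : {ffun 'I_m -> bool}) (-1) ^+ (e n) * g e = u n) /\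
    forall e, `|g e| <= (4 * M ^+ 2)%:C *
      ((2 ^ m)%:R^-1 * \sum_(e' : {ffun 'I_m -> bool}) `|\sum_n (-1) ^+ (e' n) * v n|).
Proof.
move=> uv.
pose s1 := Num.sqrt (\sum_n Re (v n) ^+ 2); pose s2 := Num.sqrt (\sum_n Im (v n) ^+ 2).
have s1_ge0 : 0 <= s1 by exact: sqrtr_ge0.
have s2_ge0 : 0 <= s2 by exact: sqrtr_ge0.
have t0 : 0 <= s1 + s2 by rewrite addr_ge0.
have sum_sq (f : 'I_m -> R) : (forall n, f n ^+ 2 <= Re (u n) ^+ 2 + Im (u n) ^+ 2) ->
    \sum_n f n ^+ 2 <= (s1 + s2) ^+ 2.
  move=> fu; apply: le_trans (_ : s1 ^+ 2 + s2 ^+ 2 <= _); last by nra.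
  rewrite !sqr_sqrtr; [|by apply: sumr_ge0 => n _; exact: sqr_ge0..].
  rewrite -big_split; apply: ler_sum => n _; apply: le_trans (fu n) _.
  rewrite -lecR !add_Re2_Im2.
  by rewrite lerXn2r ?nnegrE.
have [|g1 [g11 g12]] := riesz_product_scaled (c := fun n => Re (u n)) t0.
  by apply: sum_sq => n; rewrite lerDl sqr_ge0.
have [|g2 [g21 g22]] := riesz_product_scaled (c := fun n => Im (u n)) t0.
  by apply: sum_sq => n; rewrite lerDr sqr_ge0.
pose A : C := (2 ^ m)%:R^-1 * \sum_(e' : {ffun 'I_m -> bool}) `|\sum_n (-1) ^+ (e' n) * v n|.
have signC (b : bool) : (-1) ^+ b = ((-1) ^+ b : R)%:C.
  by rewrite rmorphXn rmorphN1.
have part (f : {additive C -> R}) (fle : forall z, `|f z|%:C <= `|z|)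
    (fZ : forall (r : R) z, f (r%:C * z) = r * f z) :
    (Num.sqrt (\sum_n f (v n) ^+ 2))%:C <= M%:C * A.
  apply: le_trans (_ : (M * ((2 ^ m)%:R^-1 *
     \sum_(e : {ffun 'I_m -> bool}) `|\sum_n (-1) ^+ (e n) * f (v n)|))%:C <= _).
    by rewrite lecR; exact: khintchine.
  rewrite rmorphM ler_wpM2l ?ler0c ?expR_ge0 // rmorphM fmorphV rmorph_nat.
  rewrite ler_wpM2l ?invr_ge0 // rmorph_sum; apply: ler_sum => e _.
  apply: le_trans (fle _); rewrite raddf_sum.
  rewrite [X in _ <= `|X|%:C](eq_bigr (fun n => (-1) ^+ (e n) * f (v n))) //.
  by move=> n _; rewrite signC fZ.
have tA : (s1 + s2)%:C <= (2 * M)%:C * A.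
  rewrite rmorphD [X in _ <= X * _](_ : _ = M%:C + M%:C);
    last by rewrite -rmorphD; congr (_%:C); ring.
  rewrite mulrDl; apply: lerD.
    by apply: (part Re) => [z|r [x y]] /=; [exact: normc_ge_Re|rewrite mul0r subr0].
  by apply: (part Im) => [z|r [x y]] /=; [exact: normc_ge_Im|rewrite mul0r addr0].
exists (fun e => Complex (g1 e) (g2 e)); split=> [n|e].
  rewrite [u n](complex_split (u n)) -g11 -g21 !rmorphM !fmorphV !rmorph_nat !rmorph_sum /=.
  rewrite mulrCA -mulrDr; congr (_ * _); rewrite mulr_sumr -big_split; apply: eq_bigr => e _ /=.
  rewrite signC !rmorphM [Complex _ _]complex_split /=; ring.
apply: le_trans (norm_complex_le _) _ => /=.
apply: le_trans (_ : (2 * M * (s1 + s2))%:C <= _).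
  by rewrite lecR; have := g12 e; have := g22 e; lra.
rewrite (_ : 4 * M ^+ 2 = (2 * M) * (2 * M)); last by ring.
by rewrite rmorphM [X in _ <= X * _]rmorphM -mulrA ler_wpM2l // ler0c mulr_ge0 ?expR_ge0.
Qed.

Definition complex_scalars : scalars R C.
Proof.
refine (@Scalars R C (real_complex R : {rmorphism R -> C}) Re _ _ _ _ _ _).
- exact: lecR.
- exact: nonneg_complex.
- exact: complex_ultra_cvg.
- exact: complex_root_near.
- exact: complex_grid.
- exists (4 * M ^+ 2); split; first by rewrite mulr_ge0 // sqr_ge0.
  exact: complex_rademacher.
Defined.

End complex_instance.

(** * Complexifications, and the theorem *)

Section complex_model.
Variable R : realType.
Local Notation Re := (@complex.Re R).
Local Notation Im := (@complex.Im R).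

(** The point (x, y) has polar angle acos (x / r) up to sign. *)
Lemma modulus_attained (x y : R) : exists t, cos t * x + sin t * y = Num.sqrt (x ^+ 2 + y ^+ 2).
Proof.
set r := Num.sqrt _.
have r2 : r ^+ 2 = x ^+ 2 + y ^+ 2 by rewrite sqr_sqrtr // addr_ge0 ?sqr_ge0.
have [r0|r_neq0] := eqVneq r 0.
  exists 0; rewrite cos0 sin0 mul1r mul0r addr0 r0.
  apply/eqP; rewrite -sqrf_eq0 eq_le sqr_ge0 andbT.
  by rewrite (_ : 0 = x ^+ 2 + y ^+ 2) ?lerDl ?sqr_ge0 // -r2 r0 expr0n.
have r_gt0 : 0 < r by rewrite lt_neqAle eq_sym r_neq0 sqrtr_ge0.
have xr2 : (x / r) ^+ 2 + (y / r) ^+ 2 = 1.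
  by rewrite !exprMn -mulrDl -r2 -exprMn divff // expr1n.
have xr : -1 <= x / r <= 1.
  rewrite -ler_norml -(@ler_pXn2r _ 2) ?nnegrE // expr1n real_normK ?num_real //.
  by rewrite -xr2 lerDl sqr_ge0.
have sin2 : sin (acos (x / r)) = `|y / r|.
  rewrite sin_acos // -sqrtr_sqr; congr Num.sqrt.
  by rewrite -xr2 addrC addKr.
have tot : x / r * x + y / r * y = r.
  rewrite mulrAC [y / r * y]mulrAC -mulrDl -!expr2 -r2 expr2 mulfK //.
have [y0|y0] := leP 0 y.
  exists (acos (x / r)); rewrite acosK ?in_itv //= sin2.
  by rewrite ger0_norm ?tot // divr_ge0 // ltW.
exists (- acos (x / r)); rewrite cosN sinN acosK ?in_itv //= sin2.
by rewrite ltr0_norm ?opprK ?tot // pmulr_llt0 // invr_gt0.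
Qed.

Lemma rotation_le (t x y : R) : cos t * x + sin t * y <= Num.sqrt (x ^+ 2 + y ^+ 2).
Proof.
have h : (cos t * x + sin t * y) ^+ 2 <= x ^+ 2 + y ^+ 2.
  have := cos2Dsin2 t; set c := cos t; set s := sin t => cs.
  have -> : x ^+ 2 + y ^+ 2 = (c * x + s * y) ^+ 2 + (s * x - c * y) ^+ 2.
    by rewrite -[LHS]mul1r -cs; ring.
  by rewrite lerDl sqr_ge0.
by apply: le_trans (ler_norm _) _; rewrite -sqrtr_sqr ler_wsqrtr.
Qed.

Lemma av_complex (z : R[i]) :
  av (complex_scalars R) z = Num.sqrt (Re z ^+ 2 + Im z ^+ 2).
Proof. by rewrite /av normc_def. Qed.

(** The atoms of the real lattice are a basis over the complex numbers too.  The
    modulus of x + i y, the supremum of its rotations, has the moduli of the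
    coordinates as coordinates, since in each coordinate the supremum is the
    value at some angle. *)
Lemma complex_lattice_model (Z : completeNormedModType R[i]) :
  complex_banach_lattice Z -> fin_dim [set: Z] -> lattice_model (complex_scalars R) Z.
Proof.
move=> [Y [le [j [HL [j_lin j_split j_norm]]]]] [d hd].
have j0 : j 0 = 0.
  have := j_lin 1 0 0; rewrite scaler0 addr0 rmorph1 scale1r => /eqP.
  by rewrite -subr_eq subrr eq_sym => /eqP.
have jD x y : j (x + y) = j x + j y.
  by have := j_lin 1 x y; rewrite rmorph1 !scale1r.
have jZ a x : j (a *: x) = a%:C *: j x.
  by have := j_lin a x 0; rewrite !addr0 j0 addr0.
have j_sum k (e : 'I_k -> Y) c : j (lincomb e c) = \sum_i (c i)%:C *: j (e i).
  by rewrite /lincomb (big_morph j jD j0); apply: eq_bigr => i _; rewrite jZ.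
have j_comb k (e : 'I_k -> Y) (z : 'I_k -> R[i]) :
    lincomb (fun i => j (e i)) z =
    j (lincomb e (fun i => Re (z i))) + 'i *: j (lincomb e (fun i => Im (z i))).
  rewrite !j_sum scaler_sumr -big_split; apply: eq_bigr => i _ /=.
  by rewrite scalerA -scalerDl {1}(complex_split (z i)).
have j_inj x y x' y' : j x + 'i *: j y = j x' + 'i *: j y' -> x = x' /\ y = y'.
  move=> h; have [p [_ pu]] := j_split (j x + 'i *: j y).
  by have := pu (x, y) erefl; rewrite (pu (x', y') h) => -[-> ->].
have j_free k (e : 'I_k -> Y) : free_family e -> free_family (fun i => j (e i)).
  move=> fe z; rewrite j_comb => h.
  have [h1 h2] : lincomb e (fun i => Re (z i)) = 0 /\ lincomb e (fun i => Im (z i)) = 0.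
    by apply: j_inj; rewrite h j0 scaler0 addr0.
  move=> i; apply/eqP; rewrite eq_complex /=.
  by rewrite (fe _ h1 i) (fe _ h2 i) eqxx.
have [|k [e [fe span leE]]] := finite_lattice_coordinates HL.
  by exists d => k e /j_free; exact: free_family_card.
exists k, (fun i => j (e i)), (fun s => `|lincomb e s|).
have lin0 : 0 = lincomb e (fun=> 0) by rewrite /lincomb big1 // => i _; rewrite scale0r.
split; split.
- by move=> s t; rewrite lincombD ler_normD.
- by move=> c s c0; rewrite lincombZ normrZ ger0_norm.
- move=> s t st; apply: (blat_norm_le HL); first by rewrite lin0; apply/leE => i; case/andP: (st i).
  by apply/leE => i; case/andP: (st i).
- exact: j_free.
- move=> z; have [[x y] [/= zE _]] := j_split z.
  have [a xa] := span x; have [b yb] := span y.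
  exists (fun i => Complex (a i) (b i)); rewrite j_comb /= zE xa yb.
  by congr (j _ + _ *: j _).
move=> z; rewrite j_comb.
set x := lincomb e _; set y := lincomb e _.
have [m [[m_ub m_least] m_norm]] := j_norm x y.
have -> : (fun i => av (complex_scalars R) (z i)) =
    (fun i => Num.sqrt (Re (z i) ^+ 2 + Im (z i) ^+ 2)).
  by apply/funext => i; exact: av_complex.
set w := fun i => Num.sqrt _.
have rot t : cos t *: x + sin t *: y =
    lincomb e (fun i => cos t * Re (z i) + sin t * Im (z i)).
  by rewrite lincombD !lincombZ.
have -> : lincomb e w = m.
  apply: (blat_anti HL); last first.
    by apply: m_least => _ [t _ <-]; rewrite rot; apply/leE => i; exact: rotation_le.
  have [c mc] := span m; rewrite mc; apply/leE => i.
  have [t] := modulus_attained (Re (z i)) (Im (z i)); rewrite /w => <-.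
  have : le (cos t *: x + sin t *: y) m by apply: m_ub; exists t.
  by rewrite rot mc => /leE.
apply: (fmorph_inj (emb (complex_scalars R))); rewrite emb_nrm.
exact: m_norm.
Qed.

End complex_model.

Theorem theorem3p8 (R : realType) :
  (forall (X : completeNormedModType R) (E : nat -> set X),
     has_real_lust X -> uniform_ufdd E ->
     exists f : forall n, 'I_(fdim (E n)) -> X,
       (forall n, unconditional_basis (E n) (f n)) /\
       unconditional_basis [set: X]
         (fun p : {n : nat & 'I_(fdim (E n))} => f (tag p) (tagged p)))
  /\
  (forall (X : completeNormedModType R[i]) (E : nat -> set X),
     has_complex_lust X -> uniform_ufdd E ->
     exists f : forall n, 'I_(fdim (E n)) -> X,
       (forall n, unconditional_basis (E n) (f n)) /\
       unconditional_basis [set: X]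
         (fun p : {n : nat & 'I_(fdim (E n))} => f (tag p) (tagged p))).
Proof.
split=> X E; apply: unconditional_basis_of_lust.
  exact: real_lattice_model.
exact: complex_lattice_model.
Qed.
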